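(* Let $G\subset \mathrm{GL}(n,\mathbb{R})$ be a real algebraic group and let $L$ be an algebraic subgroup of $G$ (that is, a subgroup of $G$ which is itself a real algebraic group) such that the complexification $L^{\mathbb{C}}$ contains a maximal torus of $G^{\mathbb{C}}$. Then $L$ contains a Cartan subgroup of $G$.
   Context: A connected (Lie) subgroup $G\subset \mathrm{GL}(n,\mathbb{R})$ with Lie algebra $\mathfrak{g}=\mathrm{Lie}(G)$ is called a real algebraic group if the connected subgroup of $\mathrm{GL}(n,\mathbb{C})$ with Lie algebra $\mathfrak{g}+\sqrt{-1}\cdot\mathfrak{g}$ is an algebraic subgroup of $\mathrm{GL}(n,\mathbb{C})$; this connected subgroup of $\mathrm{GL}(n,\mathbb{C})$ is called the complexification of $G$ and is denoted $G^{\mathbb{C}}$. In particular, real algebraic groups are connected by definition. The same notation is used for subgroups of $G$: for example $L^{\mathbb{C}}$ is the connected subgroup of $\mathrm{GL}(n,\mathbb{C})$ with Lie algebra $\mathrm{Lie}(L)+\sqrt{-1}\cdot\mathrm{Lie}(L)$. A maximal torus of $G^{\mathbb{C}}$ is a maximal algebraic torus, i.e. an algebraic subgroup isomorphic to some $(\mathbb{C}^* )^r$ and maximal among such subgroups. A connected subgroup $C$ of a real algebraic group $G$ is a Cartan subgroup of $G$ if its complexification $C^{\mathbb{C}}$ is a maximal algebraic torus in $G^{\mathbb{C}}$. *)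

(* Defs.v *)
From HB Require Import structures.
From mathcomp Require Import all_boot all_order all_algebra.
From mathcomp Require Import all_classical all_reals all_analysis.
From mathcomp Require Import complex.
(* not Imported: its notations clash with those of MathComp-Analysis *)
From mathcomp Require mpoly.

Set Implicit Arguments.
Unset Strict Implicit.
Unset Printing Implicit Defensive.

Import Order.TTheory GRing.Theory Num.Theory.
Import numFieldNormedType.Exports.

Local Open Scope classical_set_scope.
Local Open Scope ring_scope.

Definition GL_subgroup (F : fieldType) (n : nat) (H : set 'M[F]_n) : Prop :=
  [/\ (forall A, H A -> A \in unitmx),
      H 1%:M,
      (forall A B, H A -> H B -> H (A *m B)) &
      (forall A, H A -> H (invmx A))].

Definition expm (F : numFieldType) (n : nat) (A : 'M[F]_n) : 'M[F]_n :=
  lim (series (fun k => (k`!%:R)^-1 *: A ^+ k) @ \oo).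

(* For a Lie subalgebra g of gl(n), the subgroup generated by exp(g) is the
   connected (immersed, not necessarily closed) Lie subgroup of GL(n) with Lie
   algebra g. *)
Definition integral_subgroup (F : numFieldType) (n : nat) (g : set 'M[F]_n) :
    set 'M[F]_n :=
  smallest (@GL_subgroup F n) (@expm F n @` g).

Definition Lie_subalgebra (F : fieldType) (n : nat) (g : set 'M[F]_n) : Prop :=
  [/\ g 0,
      (forall (a : F) X Y, g X -> g Y -> g (a *: X + Y)) &
      (forall X Y, g X -> g Y -> g (X *m Y - Y *m X))].

Definition Lie (R : realType) (n : nat) (G : set 'M[R]_n) : set 'M[R]_n :=
  [set X | forall t : R, G (expm (t *: X))].

Definition connected_Lie_subgroup (R : realType) (n : nat)
    (G : set 'M[R]_n) : Prop :=
  Lie_subalgebra (Lie G) /\ G = integral_subgroup (Lie G).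

Definition Lie_complexification (R : realType) (n : nat)
    (g : set 'M[R]_n) : set 'M[R[i]]_n :=
  [set \matrix_(i, j) (X i j +i* Y i j)%C | X in g & Y in g].

Definition complexification (R : realType) (n : nat)
    (G : set 'M[R]_n) : set 'M[R[i]]_n :=
  integral_subgroup (Lie_complexification (Lie G)).

(* The n * n variables are the matrix entries, in the order of mxvec. *)
Definition mx_eval (F : fieldType) (n : nat) (p : mpoly.mpoly (n * n) F)
    (A : 'M[F]_n) : F :=
  mpoly.meval (mxvec A 0) p.

Definition algebraic_subgroup (F : fieldType) (n : nat)
    (H : set 'M[F]_n) : Prop :=
  GL_subgroup H /\
  exists P : set (mpoly.mpoly (n * n) F),
    H = [set A | A \in unitmx /\ forall p, P p -> mx_eval p A = 0].

(* The coordinate ring of GL(m) is F[x_ij, 1 / det]; the coordinate ring of a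
   Zariski closed subset of GL(m) is its quotient by restriction. *)
Definition regular_on (F : fieldType) (m n : nat) (H : set 'M[F]_m)
    (f : 'M[F]_m -> 'M[F]_n) : Prop :=
  forall i j, exists (p : mpoly.mpoly (m * m) F) (k : nat),
    forall A, H A -> f A i j = mx_eval p A / \det A ^+ k.

Definition algebraic_isomorphic (F : fieldType) (m n : nat)
    (H : set 'M[F]_m) (K : set 'M[F]_n) : Prop :=
  exists (f : 'M[F]_m -> 'M[F]_n) (g : 'M[F]_n -> 'M[F]_m),
    [/\ regular_on H f /\ regular_on K g,
        (forall A, H A -> K (f A)) /\ (forall B, K B -> H (g B)),
        (forall A, H A -> g (f A) = A) /\ (forall B, K B -> f (g B) = B) &
        (forall A A', H A -> H A' -> f (A *m A') = f A *m f A')].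

(* (F^* )^r, realized as the invertible diagonal matrices of size r *)
Definition diagonal_torus (F : fieldType) (r : nat) : set 'M[F]_r :=
  [set A | A \in unitmx /\ is_diag_mx A].

Definition algebraic_torus (F : fieldType) (n : nat) (T : set 'M[F]_n) : Prop :=
  algebraic_subgroup T /\
  exists r : nat, algebraic_isomorphic (@diagonal_torus F r) T.

Definition maximal_torus (F : fieldType) (n : nat) (H T : set 'M[F]_n) : Prop :=
  [/\ algebraic_torus T, T `<=` H &
      forall T', algebraic_torus T' -> T' `<=` H -> T `<=` T' -> T' = T].

Definition real_algebraic_group (R : realType) (n : nat)
    (G : set 'M[R]_n) : Prop :=
  connected_Lie_subgroup G /\ algebraic_subgroup (complexification G).

Definition Cartan_subgroup (R : realType) (n : nat) (G C : set 'M[R]_n) : Prop :=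
  [/\ connected_Lie_subgroup C, C `<=` G &
      maximal_torus (complexification G) (complexification C)].

(* Main.v *)
Require Import Defs.
From mathcomp Require Import all_boot all_order all_fingroup all_algebra.
From mathcomp Require Import all_classical all_reals all_analysis.
From mathcomp Require Import complex.
From mathcomp Require Import ring lra zify.
From mathcomp Require mpoly.

(** Let g and l be the complex Lie algebras of the two groups. Two correspondences reduce the
statement to Lie algebras. First, an algebraic torus is exactly the exponential of an algebra
[toral P K], made of the matrices that are diagonal in a fixed eigenbasis, with eigenvalues in
a subspace [K] defined over the rational numbers ([toral_torus], [torus_toral]). Second, the
one-parameter subgroups of the group generated by exp(h) are those with generator in h
([integral_Lie]). So let t be a maximal rational toral subalgebra of g, and suppose that it
lies in l. It is enough to find a rational toral subalgebra of l, of the dimension of t, that is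
invariant under complex conjugation, and to know that no rational toral subalgebra of g has a
larger dimension: the real points of the former generate a Cartan subgroup.

The invariant algebra is generated by one real matrix ([real_toral]). The Lie algebra of an
algebraic group contains, with X, the smallest rational toral algebra a(X) containing the
semisimple part of X ([replica]): an equation of the group, evaluated at exp(zX), is an
exponential polynomial in z, and its vanishing depends only on the rational relations between
the eigenvalues. Write a general element of t as A + iB with A and B real elements of l, and let
X = A + uB with u real. Having eigenvalues in a given rational subspace of dimension less than
dim t is a polynomial condition on u that fails at u = i, and there are countably many of these
subspaces; hence for some real u the dimension of a(X) is at least dim t
([avoid_small_hulls]). The elements of a(X) are polynomials in the real matrix X, so a(X)
commutes with its conjugate, the sum of the two is again a rational toral algebra
([toral_sum]), and by the bound on dimensions the two are equal.

The bound ([toral_rank]) holds because, up to their order, the eigenvalues of every element of g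
form a vector of the weight space [K] of t ([eigvals_weight]). Near a general element H of t, a
Newton iteration conjugates the elements of g into the centralizer of t
([newton_limit]); there the semisimple part lies in t, by maximality
([centralizer_eigvals]). Arbitrary elements of g are reached along lines through multiples of
H, because the condition on the eigenvalues is polynomial along a line ([line_eigvals]).

For [integral_Lie], call a product of exponentials of elements of h short when the sum of the
norms of the exponents is small. Countably many translates of the limits of short products cover
the group generated by exp(h) ([covering]). If exp(tY) is in this group for all real t, two of
these elements are in the same translate, and so some exp(s Y) with s small and nonzero is a
limit of short products. Short products stay in the image of the chart
(s_1, ..., s_r) -> exp(s_1 e_1) ... exp(s_r e_r), for a basis (e_i) of h ([shortlim_chart]),
while exp(s Y) is at a distance at least c |s| from this image when Y is not in h
([transversal]). *)

Set Implicit Arguments.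
Unset Strict Implicit.
Unset Printing Implicit Defensive.

Import Order.TTheory GRing.Theory Num.Theory.
Import numFieldNormedType.Exports.
Import Normc.
Import (canonicals) mpoly.

Local Open Scope classical_set_scope.
Local Open Scope ring_scope.

(** * A norm on complex matrices *)

Section Norm.
Variable R : realType.
Local Notation C := (R[i]).

Lemma normcD (x y : C) : normc (x + y) <= normc x + normc y.
Proof. exact: le_normcD. Qed.

Lemma normc_ge0 (x : C) : 0 <= normc x.
Proof. by case: x => a b /=; rewrite sqrtr_ge0. Qed.

Lemma normcNE (x : C) : normc (- x) = normc x.
Proof. exact: normcN. Qed.

Lemma normcR (x : R) : normc (x%:C)%C = `|x|.
Proof. by rewrite /= expr0n addr0 sqrtr_sqr. Qed.

Lemma normC_normc (x : C) : `|x| = ((normc x)%:C)%C.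
Proof. by rewrite normc_def; case: x. Qed.

Lemma normc_nat k : normc (k%:R : C) = k%:R.
Proof.
have -> : (k%:R : C) = (k%:R%:C)%C by rewrite rmorph_nat.
by rewrite normcR ger0_norm.
Qed.

Lemma Re_le_normc (x : C) : `|complex.Re x| <= normc x.
Proof.
case: x => a b /=; rewrite -sqrtr_sqr ler_sqrt ?lerDl ?sqr_ge0 //.
by rewrite addr_ge0 ?sqr_ge0.
Qed.

Lemma Im_le_normc (x : C) : `|complex.Im x| <= normc x.
Proof.
case: x => a b /=; rewrite -sqrtr_sqr ler_sqrt ?lerDr ?sqr_ge0 //.
by rewrite addr_ge0 ?sqr_ge0.
Qed.

Lemma normc_le_ReIm (x : C) : normc x <= `|complex.Re x| + `|complex.Im x|.
Proof.
case: x => a b /=; rewrite -[leRHS]ger0_norm ?addr_ge0 // -sqrtr_sqr.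
rewrite ler_sqrt ?sqr_ge0 // sqrrD !real_normK ?num_real //.
by rewrite addrAC lerDl mulrn_wge0 // mulr_ge0.
Qed.

Definition nm m n (A : 'M[C]_(m, n)) : R := \sum_i \sum_j normc (A i j).

Section NormBasics.
Variables m n : nat.
Implicit Types A B : 'M[C]_(m, n).

Lemma nm_ge0 A : 0 <= nm A.
Proof. by do 2!apply: sumr_ge0 => ? _; exact: normc_ge0. Qed.

Lemma nmD A B : nm (A + B) <= nm A + nm B.
Proof.
rewrite -big_split /=; apply: ler_sum => i _; rewrite -big_split /=.
by apply: ler_sum => j _; rewrite mxE normcD.
Qed.

Lemma nmN A : nm (- A) = nm A.
Proof. by apply: eq_bigr => i _; apply: eq_bigr => j _; rewrite mxE normcNE. Qed.

Lemma nmB A B : nm (A - B) = nm (B - A).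
Proof. by rewrite -nmN opprB. Qed.

Lemma nmZ a A : nm (a *: A) = normc a * nm A.
Proof.
rewrite mulr_sumr; apply: eq_bigr => i _; rewrite mulr_sumr.
by apply: eq_bigr => j _; rewrite mxE normcM.
Qed.

Lemma nm0 : nm (0 : 'M[C]_(m, n)) = 0.
Proof. by rewrite /nm big1 // => i _; rewrite big1 // => j _; rewrite mxE normc0. Qed.

Lemma nm_entry A i j : normc (A i j) <= nm A.
Proof.
rewrite /nm (bigD1 i) //= (bigD1 j) //= -addrA lerDl addr_ge0 //.
  by apply: sumr_ge0 => ? _; exact: normc_ge0.
by do 2!apply: sumr_ge0 => ? _; exact: normc_ge0.
Qed.

Lemma nm_eq0 A : nm A <= 0 -> A = 0.
Proof.
move=> A0; apply/matrixP => i j; rewrite mxE; apply: eq0_normc; apply/eqP.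
by rewrite eq_le normc_ge0 (le_trans (nm_entry A i j) A0).
Qed.

Lemma nm_sum (I : Type) (r : seq I) (P : pred I) (F : I -> 'M[C]_(m, n)) :
  nm (\sum_(i <- r | P i) F i) <= \sum_(i <- r | P i) nm (F i).
Proof.
elim/big_rec2: _ => [|i y1 y2 _ IH]; first by rewrite nm0.
by rewrite (le_trans (nmD _ _)) // lerD2l.
Qed.

Lemma nm_triB A B D : nm (A - D) <= nm (A - B) + nm (B - D).
Proof. by rewrite -[A - D](subrKA B) nmD. Qed.

Lemma nm_leB A B : nm A <= nm (A - B) + nm B.
Proof. by rewrite -{1}[A](subrK B) nmD. Qed.

End NormBasics.

Lemma nmM m n p (A : 'M[C]_(m, n)) (B : 'M[C]_(n, p)) :
  nm (A *m B) <= nm A * nm B.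
Proof.
rewrite /nm mulr_suml; apply: ler_sum => i _.
have -> : (\sum_j normc (A i j)) * nm B = \sum_k \sum_j normc (A i j) * \sum_l normc (B k l).
  rewrite exchange_big mulr_suml /=; apply: eq_bigr => j _.
  by rewrite -mulr_sumr.
apply: (@le_trans _ _ (\sum_k \sum_j normc (A i k) * normc (B k j))).
  rewrite exchange_big /=; apply: ler_sum => j _; rewrite mxE.
  elim/big_rec2: _ => [|k y1 y2 _ IH]; first by rewrite normc0.
  by rewrite (le_trans (normcD _ _)) // normcM lerD2l.
apply: ler_sum => k _; rewrite (bigD1 k) //= -mulr_sumr lerDl.
apply: sumr_ge0 => j _; rewrite mulr_ge0 ?normc_ge0 //.
by apply: sumr_ge0 => ? _; exact: normc_ge0.
Qed.

Lemma nm_scalar n (a : C) : nm (a%:M : 'M[C]_n) = normc a * n%:R.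
Proof.
rewrite /nm (eq_bigr (fun=> normc a)) ?sumr_const ?card_ord ?mulr_natr //.
move=> i _; rewrite (bigD1 i) //= mxE eqxx big1 ?addr0 // => j ji.
by rewrite mxE eq_sym (negbTE ji) normc0.
Qed.

Lemma nm1 n : nm (1%:M : 'M[C]_n) = n%:R.
Proof. by rewrite nm_scalar normc1 mul1r. Qed.

Lemma nmX n (A : 'M[C]_n) k : nm (A ^+ k.+1) <= nm A ^+ k.+1.
Proof.
elim: k => [|k IH]; first by rewrite !expr1.
rewrite exprS [leRHS]exprS (le_trans (nmM _ _)) //.
by rewrite ler_wpM2l ?nm_ge0.
Qed.

Lemma nmX1 n (A : 'M[C]_n) k : nm (A ^+ k) <= (n%:R + 1) * nm A ^+ k.
Proof.
case: k => [|k]; first by rewrite !expr0 nm1 mulr1 lerDl.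
by rewrite (le_trans (nmX _ _)) // ler_peMl ?exprn_ge0 ?nm_ge0 // lerDr.
Qed.

Lemma nm_mxvec m n (A : 'M[C]_(m, n)) : nm (mxvec A) = nm A.
Proof.
rewrite /nm big_ord1 pair_big /=.
rewrite (reindex (fun k => enum_val (cast_ord (esym (mxvec_cast m n)) k))) /=.
  apply: eq_bigr => k _; case: (mxvec_indexP k) => i j.
  by rewrite mxvecE /mxvec_index cast_ordK enum_rankK.
exists (fun x => mxvec_index x.1 x.2) => [k _|[i j] _] /=.
  by rewrite /mxvec_index -surjective_pairing enum_valK cast_ordKV.
by rewrite /mxvec_index cast_ordK enum_rankK.
Qed.

(** Convergence is stated through a real sequence, to which real squeezing arguments apply. *)
Definition mcvg m n (u : nat -> 'M[C]_(m, n)) (l : 'M[C]_(m, n)) : Prop :=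
  (fun k => nm (u k - l)) @ \oo --> (0 : R).

Section Conv.
Variables m n : nat.
Implicit Types (u v : nat -> 'M[C]_(m, n)) (l : 'M[C]_(m, n)).

Lemma mcvg_le u l (b : nat -> R) :
  (forall k, nm (u k - l) <= b k) -> b @ \oo --> (0 : R) -> mcvg u l.
Proof.
move=> ub b0; apply: squeeze_cvgr (cvg_cst (0 : R)) b0.
by near=> k; rewrite nm_ge0 ub.
Unshelve. all: by end_near. Qed.

Lemma mcvg_cst l : mcvg (fun=> l) l.
Proof. by rewrite /mcvg subrr nm0; exact: cvg_cst. Qed.

Lemma mcvgD u v l l' : mcvg u l -> mcvg v l' -> mcvg (fun k => u k + v k) (l + l').
Proof.
move=> ul vl; apply: (@mcvg_le _ _ (fun k => nm (u k - l) + nm (v k - l'))).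
  by move=> k; rewrite opprD addrACA nmD.
by rewrite -[X in _ --> X]addr0; apply: cvgD.
Qed.

Lemma mcvg_uniq u l l' : mcvg u l -> mcvg u l' -> l = l'.
Proof.
move=> ul ul'; apply/eqP; rewrite -subr_eq0; apply/eqP/nm_eq0.
have h : (fun k => nm (u k - l) + nm (u k - l')) @ \oo --> (0 + 0 : R) by apply: cvgD.
rewrite addr0 in h; apply: (ler_cvg_to (cvg_cst _) h); near=> k.
by rewrite (le_trans (nm_triB _ (u k) _)) // nmB.
Unshelve. all: by end_near. Qed.

Lemma mcvg_nm_le u l b : mcvg u l -> (forall k, nm (u k) <= b) -> nm l <= b.
Proof.
move=> ul ub.
have h : (fun k => nm (u k - l) + b) @ \oo --> (0 + b : R).
  by apply: cvgD ul (cvg_cst _).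
rewrite add0r in h; apply: (ler_cvg_to (cvg_cst _) h); near=> k.
by rewrite (le_trans (nm_leB _ (u k))) // nmB lerD2l.
Unshelve. all: by end_near. Qed.

Lemma mcvg_eventually u l e : mcvg u l -> 0 < e ->
  exists K, forall k, (K <= k)%N -> nm (u k - l) < e.
Proof.
move=> /cvgrPdist_lt /(_ e) h e0; have [K _ hK] := h e0.
exists K => k /hK /=; rewrite sub0r normrN ger0_norm ?nm_ge0 //.
Qed.

Lemma mcvg_eps u l : (forall e, 0 < e ->
  exists K, forall k, (K <= k)%N -> nm (u k - l) < e) -> mcvg u l.
Proof.
move=> h; apply/cvgrPdist_lt => e e0; have [K hK] := h e e0.
by exists K => //= k /hK; rewrite sub0r normrN ger0_norm ?nm_ge0.
Qed.

Lemma mcvg_sub u l (f : nat -> nat) : (forall k, (k <= f k)%N) ->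
  mcvg u l -> mcvg (fun k => u (f k)) l.
Proof.
move=> fk ul; apply: mcvg_eps => e e0.
have [K hK] := mcvg_eventually ul e0; exists K => k Kk.
by apply: hK; exact: leq_trans Kk (fk k).
Qed.

End Conv.

Lemma mcvgM m n p (u : nat -> 'M[C]_(m, n)) (v : nat -> 'M[C]_(n, p)) l l' :
  mcvg u l -> mcvg v l' -> mcvg (fun k => u k *m v k) (l *m l').
Proof.
move=> ul vl; apply: (@mcvg_le _ _ _ _
  (fun k => nm (u k - l) * (nm (v k - l') + nm l') + nm l * nm (v k - l'))).
  move=> k; have -> : u k *m v k - l *m l' = (u k - l) *m v k + l *m (v k - l').
    by rewrite mulmxBl mulmxBr addrA subrK.
  rewrite (le_trans (nmD _ _)) // lerD ?nmM // (le_trans (nmM _ _)) //.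
  by rewrite ler_wpM2l ?nm_ge0 // nm_leB.
have -> : (0 : R) = 0 * (0 + nm l') + nm l * 0 by rewrite mul0r mulr0 addr0.
have c1 : (fun k => nm (v k - l') + nm l') @ \oo --> 0 + nm l'.
  by apply: cvgD => //; exact: cvg_cst.
by apply: cvgD; apply: cvgM => //; exact: cvg_cst.
Qed.

Lemma mcvgZ m n a (u : nat -> 'M[C]_(m, n)) l :
  mcvg u l -> mcvg (fun k => a *: u k) (a *: l).
Proof.
move=> ul; apply: (@mcvg_le _ _ _ _ (fun k => normc a * nm (u k - l))).
  by move=> k; rewrite -scalerBr nmZ.
by rewrite -(mulr0 (normc a)); apply: cvgM => //; exact: cvg_cst.
Qed.

Lemma mcvgMl m n p (A : 'M[C]_(m, n)) (v : nat -> 'M[C]_(n, p)) l' :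
  mcvg v l' -> mcvg (fun k => A *m v k) (A *m l').
Proof. by move=> vl; apply: mcvgM => //; exact: mcvg_cst. Qed.

Lemma mcvgMr m n p (A : 'M[C]_(n, p)) (v : nat -> 'M[C]_(m, n)) l' :
  mcvg v l' -> mcvg (fun k => v k *m A) (l' *m A).
Proof. by move=> vl; apply: mcvgM => //; exact: mcvg_cst. Qed.

Lemma cvg_finsum (I : Type) (r : seq I) (f : I -> nat -> R) (l : I -> R) :
  (forall i, f i @ \oo --> l i) ->
  (fun k => \sum_(i <- r) f i k) @ \oo --> \sum_(i <- r) l i.
Proof.
move=> fl; elim: r => [|i r IH].
  rewrite big_nil; under eq_fun do rewrite big_nil; exact: cvg_cst.
rewrite big_cons; under eq_fun do rewrite big_cons; exact: cvgD.
Qed.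

Definition lin_closed n (h : set 'M[C]_n) : Prop :=
  h 0 /\ forall a X Y, h X -> h Y -> h (a *: X + Y).

Lemma mcvg_entry m n (u : nat -> 'M[C]_(m, n)) (l : 'M[C]_(m, n)) i j :
  mcvg u l -> mcvg (fun k => (u k i j)%:M : 'M[C]_1) (l i j)%:M.
Proof.
move=> ul; apply: mcvg_le ul => k; rewrite -raddfB nm_scalar mulr1.
have -> : u k i j - l i j = (u k - l) i j by rewrite !mxE.
exact: nm_entry.
Qed.

Lemma mcvg_entries m n (u : nat -> 'M[C]_(m, n)) (l : 'M[C]_(m, n)) :
  (forall i j, mcvg (fun k => (u k i j)%:M : 'M[C]_1) (l i j)%:M) -> mcvg u l.
Proof.
move=> h; rewrite /mcvg /nm.
have e0 : \sum_(i < m) \sum_(j < n) (0 : R) = 0.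
  by rewrite big1 // => i _; rewrite big1.
rewrite -[X in _ --> X]e0.
apply: (@cvg_finsum _ _ (fun i k => \sum_j normc ((u k - l) i j))) => i.
apply: (@cvg_finsum _ _ (fun j k => normc ((u k - l) i j))) => j.
apply: cvg_trans (h i j); apply: near_eq_cvg; near=> k.
by rewrite -raddfB nm_scalar mulr1 !mxE.
Unshelve. all: by end_near. Qed.

Local Notation CF := (R[i] : numFieldType).

Lemma mcvg_topo n (u : nat -> 'M[CF]_n) (l : 'M[CF]_n) : mcvg u l -> u @ \oo --> l.
Proof.
move=> ul; apply/cvg_ballP => e e0.
have eE : e = ((complex.Re e)%:C)%C by rewrite RRe_real // realE ltW.
have e'0 : 0 < complex.Re e by rewrite -ltcR -eE.
have [K hK] := mcvg_eventually ul e'0; exists K => // k /= Kk; split=> // i j.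
rewrite -ball_normE /ball_ /= normC_normc eE ltcR /=.
apply: le_lt_trans (hK k Kk); rewrite nmB.
have -> : l i j - u k i j = (l - u k) i j by rewrite !mxE.
exact: nm_entry.
Qed.

Lemma mcvg_lim n (u : nat -> 'M[CF]_n) (l : 'M[CF]_n) : mcvg u l -> lim (u @ \oo) = l.
Proof.
by move=> /mcvg_topo ul; apply: cvg_lim => //; exact: norm_hausdorff.
Qed.

(** The real and imaginary parts of every entry converge absolutely. *)
Lemma mcvg_series m n (a : nat -> 'M[C]_(m, n)) (b : nat -> R) :
  (forall k, nm (a k) <= b k) -> cvgn (series b) ->
  exists l, mcvg (series a) l.
Proof.
move=> ab sb.
have re_cvg i j : cvgn (series (fun k => complex.Re (a k i j))).
  apply: normed_cvg; apply: series_le_cvg sb => //= k; first by rewrite (le_trans (nm_ge0 _) (ab k)).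
  by rewrite (le_trans (Re_le_normc _)) // (le_trans (nm_entry _ _ _)).
have im_cvg i j : cvgn (series (fun k => complex.Im (a k i j))).
  apply: normed_cvg; apply: series_le_cvg sb => //= k; first by rewrite (le_trans (nm_ge0 _) (ab k)).
  by rewrite (le_trans (Im_le_normc _)) // (le_trans (nm_entry _ _ _)).
exists (\matrix_(i, j) (limn (series (fun k => complex.Re (a k i j))) +i*
  limn (series (fun k => complex.Im (a k i j))))%C).
apply: mcvg_entries => i j.
apply: (@mcvg_le _ _ _ _ (fun k =>
  `|series (fun k => complex.Re (a k i j)) k - limn (series (fun k => complex.Re (a k i j)))| +
  `|series (fun k => complex.Im (a k i j)) k - limn (series (fun k => complex.Im (a k i j)))|)).
  move=> k; rewrite -raddfB nm_scalar mulr1 (le_trans (normc_le_ReIm _)) //.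
  rewrite mxE; have -> : series a k i j = (series (fun k => complex.Re (a k i j)) k +i*
     series (fun k => complex.Im (a k i j)) k)%C.
    rewrite /series /= summxE; elim: k => [|k IH]; first by rewrite !big_nil.
    by rewrite !big_nat_recr //= IH; case: (a k i j) => x y.
  by [].
have cvd (w : nat -> R) : cvgn w -> (fun k => `|w k - limn w|) @ \oo --> (0 : R).
  move=> /cvgrPdist_lt h; apply/cvgrPdist_lt => e /h.
  by apply: filterS => k; rewrite sub0r normrN normr_id distrC.
by rewrite -(addr0 0); apply: cvgD; apply: cvd.
Qed.

End Norm.

(** * The matrix exponential *)

Section BigTriangle.
Variable V : zmodType.

(** Of a square array, the triangle of small total degree leaves the far corner: this compares the
    product of two partial sums with the partial sum of their Cauchy product. *)
Lemma sum_square_triangle (T : nat -> nat -> V) K :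
  \sum_(0 <= i < K) \sum_(0 <= j < K) T i j
  - \sum_(0 <= k < K) \sum_(0 <= i < k.+1) T i (k - i)%N
  = \sum_(0 <= i < K) \sum_(0 <= j < K | (K <= i + j)%N) T i j.
Proof.
have -> : \sum_(0 <= k < K) \sum_(0 <= i < k.+1) T i (k - i)%N =
    \sum_(0 <= k < K) \sum_(0 <= i < K | (i <= k)%N) T i (k - i)%N.
  by apply: eq_big_nat => k /andP[_ kK]; rewrite (big_nat_widen 0 k.+1 K).
rewrite (@exchange_big_dep_nat _ _ _ 0 K 0 K xpredT (fun k i => (i <= k)%N)
   xpredT (fun k i => T i (k - i)%N)) //=.
rewrite -sumrB; apply: eq_big_nat => i /andP[_ iK].
rewrite (bigID (fun j => (K <= i + j)%N)) /= -addrA [X in _ + X](_ : _ = 0) ?addr0 //.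
apply/eqP; rewrite subr_eq0; apply/eqP.
have -> : \sum_(0 <= k < K | (i <= k)%N) T i (k - i)%N =
    \sum_(0 <= j < K - i) T i (j + i - i)%N.
  transitivity (\sum_(0 + i <= k < K) T i (k - i)%N); last by rewrite big_addn.
  by rewrite add0n [RHS](big_nat_widenl i 0).
rewrite (big_nat_widen 0 (K - i) K) ?leq_subr //.
rewrite [LHS]big_nat_cond [RHS]big_nat_cond; apply: eq_big => [j|j _]; last by rewrite addnK.
by rewrite /= -ltnNge ltn_subRL; case: (j < K)%N; rewrite ?andbT ?andbF ?andTb.
Qed.
End BigTriangle.

Section Expm.
Variable R : realType.
Local Notation C := (R[i]).
Implicit Types n : nat.

Definition expt n (A : 'M[C]_n) (k : nat) : 'M[C]_n := (k`!%:R)^-1 *: A ^+ k.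

Lemma nm_expt n (A : 'M[C]_n) k : nm (expt A k) <= (n%:R + 1) * exp_coeff (nm A) k.
Proof.
rewrite nmZ normcV normc_nat /exp_coeff /= mulrC.
by rewrite mulrA ler_pM2r ?invr_gt0 ?ltr0n ?fact_gt0 // nmX1.
Qed.

Lemma expmP n (A : 'M[C]_n) : mcvg (series (expt A)) (expm A).
Proof.
have [l hl] : exists l, mcvg (series (expt A)) l.
  apply: (mcvg_series (nm_expt A)).
  rewrite (_ : series _ = (fun k => (n%:R + 1) * series (exp_coeff (nm A)) k)).
    by apply: is_cvgM; [exact: is_cvg_cst|exact: is_cvg_series_exp_coeff].
  by apply/funext => k; rewrite /series /= mulr_sumr.
by rewrite /expm (mcvg_lim hl).
Qed.

Lemma expt_fact n (A : 'M[C]_n) k : (k.+1)%:R *: expt A k.+1 = A *m expt A k.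
Proof.
rewrite /expt scalerA factS natrM invfM mulrA divff ?pnatr_eq0 // mul1r.
by rewrite exprS -scalemxAr mulmxE.
Qed.

Lemma expt_factr n (A : 'M[C]_n) k : (k.+1)%:R *: expt A k.+1 = expt A k *m A.
Proof.
rewrite /expt scalerA factS natrM invfM mulrA divff ?pnatr_eq0 // mul1r.
by rewrite exprSr -scalemxAl mulmxE.
Qed.

Lemma expt0 n (A : 'M[C]_n) : expt A 0 = 1%:M.
Proof. by rewrite /expt expr0 fact0 invr1 scale1r. Qed.

(** The degree [k] part of [expm A *m X *m expm B]. When [B = - A] its recursion is that of the
    exponential of the bracket with [A]. *)
Definition cauchy_term m n (A : 'M[C]_m) (X : 'M[C]_(m, n)) (B : 'M[C]_n) (k : nat) :=
  \sum_(0 <= i < k.+1) expt A i *m X *m expt B (k - i).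

Lemma cauchy_term0 m n (A : 'M[C]_m) (X : 'M[C]_(m, n)) (B : 'M[C]_n) :
  cauchy_term A X B 0 = X.
Proof. by rewrite /cauchy_term big_nat1 !expt0 mul1mx mulmx1. Qed.

(** Leibniz rule for the derivative in t of exp(tA) X exp(tB), read on coefficients. *)
Lemma cauchy_term_rec m n (A : 'M[C]_m) (X : 'M[C]_(m, n)) (B : 'M[C]_n) k :
  (k.+1)%:R *: cauchy_term A X B k.+1 = A *m cauchy_term A X B k + cauchy_term A X B k *m B.
Proof.
rewrite /cauchy_term scaler_sumr.
have -> : \sum_(0 <= i < k.+2) k.+1%:R *: (expt A i *m X *m expt B (k.+1 - i)) =
  \sum_(0 <= i < k.+2) (i%:R *: expt A i) *m X *m expt B (k.+1 - i) +
  \sum_(0 <= i < k.+2) expt A i *m X *m ((k.+1 - i)%:R *: expt B (k.+1 - i)).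
  rewrite -big_split; apply: eq_big_nat => i /andP[_ ik] /=.
  by rewrite -!(scalemxAl i%:R) -(scalemxAr (k.+1 - i)%:R) -scalerDl -natrD subnKC.
congr (_ + _).
  rewrite big_nat_recl // scale0r !mul0mx add0r mulmx_sumr.
  apply: eq_big_nat => i _; rewrite subSS expt_fact -!mulmxA //.
rewrite big_nat_recr //= subnn scale0r mulmx0 addr0 mulmx_suml.
by apply: eq_big_nat => i /andP[_ ik]; rewrite subSn // expt_factr !mulmxA.
Qed.

Lemma series_expR (x : R) : series (exp_coeff x) @ \oo --> expR x.
Proof. exact: is_cvg_series_exp_coeff. Qed.

Lemma exp_coeffD (a b : R) k :
  \sum_(0 <= i < k.+1) exp_coeff a i * exp_coeff b (k - i)%N = exp_coeff (a + b) k.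
Proof.
rewrite /exp_coeff /= addrC exprDn mulr_suml big_mkord; apply: eq_bigr => i _.
have ik : (i <= k)%N by rewrite -ltnS.
rewrite -mulrnAl -mulr_natr -[in RHS](bin_fact ik).
rewrite !natrM; have := @pnatr_eq0 R; move=> p0.
have h1 : (i`!%:R : R) != 0 by rewrite p0 -lt0n fact_gt0.
have h2 : ((k - i)`!%:R : R) != 0 by rewrite p0 -lt0n fact_gt0.
have h3 : ('C(k, i)%:R : R) != 0 by rewrite p0 -lt0n bin_gt0.
by field; rewrite h1 h2 h3.
Qed.

(** The difference from the product of the partial sums is dominated by the same difference for the
    real series of the norms, where the limit is the functional equation of the real exponential. *)
Lemma cauchy_term_cvg m n (A : 'M[C]_m) (X : 'M[C]_(m, n)) (B : 'M[C]_n) :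
  mcvg (series (cauchy_term A X B)) (expm A *m X *m expm B).
Proof.
pose SS K := series (expt A) K *m X *m series (expt B) K.
have hSS : mcvg SS (expm A *m X *m expm B).
  by apply: mcvgM; [apply: mcvgMr|]; exact: expmP.
pose a := nm A; pose b := nm B.
pose M := (m%:R + 1) * nm X * (n%:R + 1).
pose d K := series (exp_coeff a) K * series (exp_coeff b) K - series (exp_coeff (a + b)) K.
have d0 : d @ \oo --> (0 : R).
  have -> : (0 : R) = expR a * expR b - expR (a + b) by rewrite expRD subrr.
  by apply: cvgB; [apply: cvgM|]; exact: series_expR.
have M0 : 0 <= M by rewrite /M !mulr_ge0 ?nm_ge0 ?addr_ge0.
have bound K : nm (SS K - series (cauchy_term A X B) K) <= M * d K.
  have -> : SS K - series (cauchy_term A X B) K =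
    \sum_(0 <= i < K) \sum_(0 <= j < K | (K <= i + j)%N) expt A i *m X *m expt B j.
    rewrite -sum_square_triangle; congr (_ - _).
    rewrite /SS /series /= !mulmx_suml; apply: eq_bigr => i _.
    by rewrite mulmx_sumr.
  have -> : d K = \sum_(0 <= i < K) \sum_(0 <= j < K | (K <= i + j)%N)
     exp_coeff a i * exp_coeff b j.
    rewrite -sum_square_triangle /d; congr (_ - _).
      rewrite /series /= mulr_suml; apply: eq_bigr => i _.
      by rewrite mulr_sumr.
    by apply: eq_bigr => k _; rewrite exp_coeffD.
  rewrite mulr_sumr (le_trans (nm_sum _ _ _)) //; apply: ler_sum => i _.
  rewrite mulr_sumr (le_trans (nm_sum _ _ _)) //; apply: ler_sum => j _.
  rewrite (le_trans (nmM _ _)) //.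
  apply: (@le_trans _ _ (((m%:R + 1) * exp_coeff a i * nm X) *
     ((n%:R + 1) * exp_coeff b j))).
    apply: ler_pM; rewrite ?nm_ge0 ?nm_expt //.
    rewrite (le_trans (nmM _ _)) // ler_wpM2r ?nm_ge0 ?nm_expt //.
  by rewrite le_eqVlt; apply/orP; left; apply/eqP; rewrite /M; ring.
apply: (@mcvg_le _ _ _ _ _ (fun K => M * d K + nm (SS K - (expm A *m X *m expm B)))).
  move=> K; rewrite (le_trans (nm_triB _ (SS K) _)) // lerD2r nmB; exact: bound.
rewrite -(addr0 (0:R)); apply: cvgD hSS.
by rewrite -(mulr0 M); apply: cvgM => //; exact: cvg_cst.
Qed.

End Expm.

Opaque expm.
Section ExpmTheory.
Variable R : realType.
Local Notation C := (R[i]).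
Implicit Types n : nat.

Lemma nat1_neq0 k : (k.+1%:R : C) != 0.
Proof. by rewrite pnatr_eq0. Qed.

Lemma series1 m n (u : nat -> 'M[C]_(m, n)) l :
  mcvg (series u) l -> (forall k, u k.+1 = 0) -> l = u 0%N.
Proof.
move=> ul u0; have := @mcvg_sub _ _ _ _ _ S (fun k => leqnSn k) ul.
have -> : (fun k => series u k.+1) = fun=> u 0%N.
  apply/funext => k; rewrite /series /= big_nat_recl // big1 ?addr0 // => i _.
by move=> h; exact: (mcvg_uniq h (mcvg_cst _)).
Qed.

Lemma expm0 n : expm (0 : 'M[C]_n) = 1%:M.
Proof.
rewrite (series1 (expmP 0)) ?expt0 // => k.
by rewrite /expt expr0n scaler0.
Qed.

(** The binomial formula, obtained by comparing the two recursions. *)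
Lemma cauchy_comm n (A B : 'M[C]_n) : A *m B = B *m A ->
  cauchy_term A 1%:M B = expt (A + B).
Proof.
move=> AB; apply/funext; elim=> [|k IH]; first by rewrite cauchy_term0 expt0.
apply: (scalerI (nat1_neq0 k)); rewrite cauchy_term_rec expt_fact IH mulmxDl; congr (_ + _).
rewrite /expt -scalemxAl -scalemxAr !mulmxE; congr (_ *: _).
by apply/esym/commrX/commrD; rewrite /GRing.comm -!mulmxE.
Qed.

Lemma expmD n (A B : 'M[C]_n) : A *m B = B *m A ->
  expm (A + B) = expm A *m expm B.
Proof.
move=> /cauchy_comm AB; apply: mcvg_uniq (expmP _) _.
by rewrite -AB -[expm A]mulmx1; exact: cauchy_term_cvg.
Qed.

Lemma expmNr n (A : 'M[C]_n) : expm A *m expm (- A) = 1%:M.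
Proof. by rewrite -expmD ?subrr ?expm0 // mulmxN mulNmx. Qed.

Lemma expmNl n (A : 'M[C]_n) : expm (- A) *m expm A = 1%:M.
Proof. by rewrite -{2}[A]opprK expmNr. Qed.

Lemma expm_unit n (A : 'M[C]_n) : expm A \in unitmx.
Proof. exact: (proj1 (mulmx1_unit (expmNr A))). Qed.

Lemma expm_inv n (A : 'M[C]_n) : invmx (expm A) = expm (- A).
Proof. by rewrite -[LHS]mulmx1 -(expmNr A) mulmxA mulVmx ?expm_unit // mul1mx. Qed.

Lemma expm_natmul n (A : 'M[C]_n) k : expm (A *+ k) = expm A ^+ k.
Proof.
elim: k => [|k IH]; first by rewrite mulr0n expm0 expr0.
rewrite mulrS expmD ?IH ?exprS ?mulmxE // -!mulmxE.
by rewrite -scaler_nat -scalemxAl -scalemxAr.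
Qed.

(** [P] passes through every term of the series. *)
Lemma expm_intertwine m n (A : 'M[C]_m) (B : 'M[C]_n) (P : 'M[C]_(m, n)) :
  A *m P = P *m B -> expm A *m P = P *m expm B.
Proof.
move=> AP; have e k : expt A k *m P = P *m expt B k.
  elim: k => [|k IH]; first by rewrite !expt0 mul1mx mulmx1.
  apply: (scalerI (nat1_neq0 k)).
  by rewrite scalemxAl scalemxAr expt_fact expt_fact -mulmxA IH !mulmxA AP.
have := mcvgMr P (expmP A); have -> : (fun k => series (expt A) k *m P) =
    (fun k => P *m series (expt B) k).
  apply/funext => k; rewrite /series /= mulmx_suml mulmx_sumr.
  by apply: eq_bigr => i _.
by move=> h; apply: mcvg_uniq h _; exact: mcvgMl (expmP B).
Qed.

Lemma expm_conj n (P A : 'M[C]_n) : P \in unitmx ->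
  expm (invmx P *m A *m P) = invmx P *m expm A *m P.
Proof.
move=> Pu; have /expm_intertwine : A *m P = P *m (invmx P *m A *m P).
  by rewrite !mulmxA mulmxV // mul1mx.
by move=> h; rewrite -[RHS]mulmxA h [RHS]mulmxA mulVmx // mul1mx.
Qed.

Lemma half_fact k : ((k.+2)`!%:R : R)^-1 <= (2^-1) ^+ k.+1.
Proof.
rewrite exprVn lef_pV2 ?posrE ?ltr0n ?fact_gt0 ?exprn_gt0 //.
rewrite -natrX ler_nat; elim: k => [//|k IH].
by rewrite factS expnS leq_mul.
Qed.

Lemma sum_half k : \sum_(0 <= i < k) (2^-1 : R) ^+ i.+1 <= 1.
Proof.
suff -> : \sum_(0 <= i < k) (2^-1 : R) ^+ i.+1 = 1 - (2^-1) ^+ k.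
  by rewrite gerBl exprn_ge0.
elim: k => [|k IH]; first by rewrite big_nil expr0 subrr.
by rewrite big_nat_recr //= IH !exprS; field.
Qed.

Lemma expm_le n (A : 'M[C]_n) : nm A <= 1 -> nm (expm A - 1%:M - A) <= nm A ^+ 2.
Proof.
move=> A1; have h := @mcvg_sub _ _ _ _ _ (fun k => k.+2) (fun k => leqW (leqnSn k)) (expmP A).
have -> : expm A - 1%:M - A = expm A + - (1%:M + A) by rewrite opprD addrA.
apply: (mcvg_nm_le (mcvgD h (mcvg_cst (- (1%:M + A))))) => k.
have -> : series (expt A) k.+2 - (1%:M + A) = \sum_(0 <= i < k) expt A i.+2.
  rewrite /series /= !big_nat_recl // expt0.
  have -> : expt A 1 = A by rewrite /expt factS fact0 muln1 invr1 scale1r expr1.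
  by rewrite opprD addrACA subrr add0r addrAC subrr add0r.
rewrite (le_trans (nm_sum _ _ _)) //.
apply: (@le_trans _ _ (\sum_(0 <= i < k) (nm A ^+ 2 * (2^-1) ^+ i.+1))).
  apply: ler_sum => i _; rewrite nmZ normcV normc_nat mulrC.
  apply: ler_pM; rewrite ?nm_ge0 ?invr_ge0 ?half_fact //.
  rewrite (le_trans (nmX _ _)) // -addn2 exprD.
  by rewrite ler_piMl ?exprn_ge0 ?nm_ge0 // exprn_ile1 ?nm_ge0.
by rewrite -mulr_sumr ler_piMr ?exprn_ge0 ?nm_ge0 // sum_half.
Qed.

Lemma expm1_le n (A : 'M[C]_n) : nm A <= 1 -> nm (expm A - 1%:M) <= 2 * nm A.
Proof.
move=> A1; rewrite (le_trans (nm_leB _ A)) // mulr_natl mulr2n lerD2r.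
by rewrite (le_trans (expm_le A1)) // ler_piMr ?nm_ge0.
Qed.

(** A matrix of maximal rank among those whose row space is contained in the subspace. *)
Lemma lin_matrix n (h : set 'M[C]_n) : lin_closed h ->
  exists B : 'M[C]_(n * n), forall X, h X <-> (mxvec X <= B)%MS.
Proof.
case=> h0 hlin.
pose P r := `[< exists B : 'M[C]_(n * n), \rank B = r /\
   forall X, (mxvec X <= B)%MS -> h X >].
have exP : exists r, P r.
  exists 0%N; apply/asboolP; exists 0; rewrite mxrank0; split=> // X.
  rewrite submx0 mxvec_eq0 => /eqP ->; exact: h0.
have bP r : P r -> (r <= n * n)%N.
  by move/asboolP => [B [<- _]]; exact: rank_leq_row.
have [r /asboolP [B [rB hB]] maxr] := ex_maxnP exP bP.
exists B => X; split=> [hX|]; last exact: hB.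
apply: contraT => nXB.
have /maxr : P (\rank (B + mxvec X)%MS).
  apply/asboolP; exists (B + mxvec X)%MS; split=> // Y.
  case/sub_addsmxP => -[u1 u2] /= eY.
  have -> : Y = vec_mx (u1 *m B) + u2 0 0 *: X.
    rewrite -[Y]mxvecK eY linearD /=; congr (_ + _).
    by rewrite -[X in RHS]mxvecK -linearZ /= [u2]mx11_scalar mul_scalar_mx mxE mulr1n.
  rewrite addrC; apply: hlin => //; apply: hB.
  by rewrite vec_mxK submxMl.
rewrite leqNgt -rB => /negP; case.
by rewrite ltn_neqAle mxrankS ?addsmxSl // andbT; apply: contra nXB => /eqP e;
  rewrite (submx_trans (addsmxSr B _)) // -(geq_leqif (mxrank_leqif_sup (addsmxSl B (mxvec X)))) e.
Qed.

Lemma linear_mcvg_mxvec n (u : nat -> 'M[C]_n) l : mcvg u l ->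
  mcvg (fun k => mxvec (u k)) (mxvec l).
Proof. by apply: mcvg_le => k; rewrite -linearB nm_mxvec. Qed.

(** Membership is a system of linear equations, which passes to the limit. *)
Lemma lin_closed_mcvg n (h : set 'M[C]_n) u l : lin_closed h ->
  mcvg u l -> (forall k, h (u k)) -> h l.
Proof.
move=> /lin_matrix [B hB] ul hu; apply/hB; rewrite submxE; apply/eqP.
apply: (mcvg_uniq (mcvgMr (cokermx B) (linear_mcvg_mxvec ul))).
have -> : (fun k => mxvec (u k) *m cokermx B) = fun=> 0.
  by apply/funext => k; apply/eqP; rewrite -submxE; apply/hB.
exact: mcvg_cst.
Qed.

Lemma lin_closed_sum n (h : set 'M[C]_n) (I : Type) (r : seq I) (P : pred I) F :
  lin_closed h -> (forall i, P i -> h (F i)) -> h (\sum_(i <- r | P i) F i).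
Proof.
case=> h0 hl hF; elim/big_rec: _ => // i x Pi hx.
by rewrite -[F i]scale1r; apply: hl => //; exact: hF.
Qed.

Lemma lin_closedZ n (h : set 'M[C]_n) a X : lin_closed h -> h X -> h (a *: X).
Proof. by case=> h0 hl hX; rewrite -[_ *: X]addr0; exact: hl. Qed.

Lemma lin_closedD n (h : set 'M[C]_n) X Y : lin_closed h -> h X -> h Y -> h (X + Y).
Proof. by case=> h0 hl hX hY; rewrite -[X]scale1r; exact: hl. Qed.

Lemma lin_closedN n (h : set 'M[C]_n) X : lin_closed h -> h X -> h (- X).
Proof. by move=> hh hX; rewrite -scaleN1r; exact: lin_closedZ. Qed.

Lemma lin_closedB n (h : set 'M[C]_n) X Y : lin_closed h -> h X -> h Y -> h (X - Y).
Proof. by move=> hh hX hY; apply: lin_closedD => //; exact: lin_closedN. Qed.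

Lemma Lie_lin n (h : set 'M[C]_n) : Lie_subalgebra h -> lin_closed h.
Proof. by case. Qed.

Lemma cauchy_term_Lie n (h : set 'M[C]_n) (X Y : 'M[C]_n) k : Lie_subalgebra h ->
  h X -> h Y -> h (cauchy_term Y X (- Y) k).
Proof.
move=> hL hX hY; elim: k => [|k IH]; first by rewrite cauchy_term0.
rewrite -[cauchy_term _ _ _ _](scalerK (nat1_neq0 k)); apply: lin_closedZ; first exact: Lie_lin.
by rewrite cauchy_term_rec mulmxN; case: hL => _ _; apply.
Qed.

(** The terms of the series are iterated brackets with [Y], up to a scalar, and subspaces are closed. *)
Lemma Ad_Lie n (h : set 'M[C]_n) (X Y : 'M[C]_n) : Lie_subalgebra h ->
  h X -> h Y -> h (expm Y *m X *m expm (- Y)).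
Proof.
move=> hL hX hY; apply: lin_closed_mcvg (cauchy_term_cvg Y X (- Y)) _; first exact: Lie_lin.
move=> k; apply: lin_closed_sum => [|i _]; first exact: Lie_lin.
exact: cauchy_term_Lie.
Qed.

End ExpmTheory.

(** * The complex exponential *)

Section ScalarExp.
Variable R : realType.
Local Notation C := (R[i]).

(** Defined through matrices of size 1, to which the properties of [expm] apply. *)
Definition cexp (z : C) : C := expm (z%:M : 'M[C]_1) 0 0.

Lemma mx11_nm (x : C) : nm (x%:M : 'M[C]_1) = normc x.
Proof. by rewrite nm_scalar mulr1. Qed.

Lemma scalar1M (x y : C) : (x * y)%:M = x%:M *m y%:M :> 'M[C]_1.
Proof. by rewrite scalar_mxM. Qed.

Lemma expm_scalar11 z : expm (z%:M : 'M[C]_1) = (cexp z)%:M.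
Proof. by rewrite /cexp -mx11_scalar. Qed.

Opaque cexp.

Lemma scalar1_inj (x y : C) : x%:M = y%:M :> 'M[C]_1 -> x = y.
Proof. by move=> /matrixP /(_ 0 0); rewrite !mxE. Qed.

Lemma cexpD z w : cexp (z + w) = cexp z * cexp w.
Proof.
have zw : (z%:M : 'M[C]_1) *m w%:M = w%:M *m z%:M by rewrite -!scalar_mxM mulrC.
have eD : (z + w)%:M = z%:M + w%:M :> 'M[C]_1 by exact: raddfD.
have := expmD zw; rewrite -eD !expm_scalar11 -scalar_mxM; exact: scalar1_inj.
Qed.

Lemma cexp0 : cexp 0 = 1.
Proof.
have e0 : (0 : C)%:M = 0 :> 'M[C]_1 by exact: raddf0.
by apply: scalar1_inj; rewrite -expm_scalar11 e0 expm0.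
Qed.

Lemma cexp_neq0 z : cexp z != 0.
Proof.
apply/eqP => z0; have := cexpD z (- z); rewrite subrr cexp0 z0 mul0r.
by move/eqP; rewrite oner_eq0.
Qed.

Lemma cexpN z : cexp (- z) = (cexp z)^-1.
Proof. by apply: (mulfI (cexp_neq0 z)); rewrite -cexpD subrr cexp0 divff ?cexp_neq0. Qed.

Lemma cexp_sum (I : Type) (r : seq I) (F : I -> C) :
  cexp (\sum_(i <- r) F i) = \prod_(i <- r) cexp (F i).
Proof. by elim/big_rec2: _ => [|i x y _ <-]; rewrite ?cexp0 ?cexpD. Qed.

Lemma cexp_natmul z k : cexp (z *+ k) = cexp z ^+ k.
Proof. by elim: k => [|k IH]; rewrite ?cexp0 // mulrS exprS cexpD IH. Qed.

Lemma cexp_intmul z (k : int) : cexp (z *~ k) = cexp z ^ k.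
Proof.
case: k => k; first by rewrite -pmulrn cexp_natmul exprnP.
by rewrite NegzE mulrNz cexpN -pmulrn cexp_natmul -exprnN.
Qed.

(** Because |exp z - 1 - z| <= |z|^2. *)
Lemma cexp_eq1_small z : normc z < 1 -> cexp z = 1 -> z = 0.
Proof.
move=> z1 ez; apply: eq0_normc; apply/eqP.
have := @expm_le R 1 z%:M; rewrite mx11_nm => /(_ (ltW z1)).
rewrite expm_scalar11 ez.
rewrite subrr sub0r nmN mx11_nm expr2 => h.
rewrite eq_le normc_ge0 andbT leNgt; apply/negP => z0.
by move: h; rewrite -{1}[normc z]mul1r ler_pM2r // leNgt z1.
Qed.

Lemma mcvg_complex (u : nat -> C) (a b : R) :
  (fun k => complex.Re (u k)) @ \oo --> a -> (fun k => complex.Im (u k)) @ \oo --> b ->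
  mcvg (fun k => (u k)%:M : 'M[C]_1) (a +i* b)%C%:M.
Proof.
move=> ua ub; apply: (@mcvg_le _ _ _ _ _ (fun k =>
  `|complex.Re (u k) - a| + `|complex.Im (u k) - b|)).
  move=> k; rewrite -raddfB mx11_nm (le_trans (normc_le_ReIm _)) //.
  by case: (u k).
have cvd (w : nat -> R) l : w @ \oo --> l -> (fun k => `|w k - l|) @ \oo --> (0 : R).
  move=> /cvgrPdist_lt h; apply/cvgrPdist_lt => e /h.
  by apply: filterS => k; rewrite sub0r normrN normr_id distrC.
by rewrite -(addr0 0); apply: cvgD; exact: cvd.
Qed.

Lemma expt_scalar11 (z : C) k : expt (z%:M : 'M[C]_1) k = (z ^+ k / k`!%:R)%:M.
Proof.
rewrite /expt mulrC -scale_scalar_mx; congr (_ *: _).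
elim: k => [|k IH]; first by rewrite !expr0.
by rewrite !exprS IH scalar1M mulmxE.
Qed.

Lemma cexp_cvg (z : C) :
  mcvg (fun k => (\sum_(0 <= j < k) z ^+ j / j`!%:R)%:M : 'M[C]_1) (cexp z)%:M.
Proof.
rewrite -expm_scalar11; have := expmP (z%:M : 'M[C]_1).
congr (mcvg _ _); apply/funext => k; rewrite /series /= raddf_sum /=.
by apply: eq_bigr => i _; rewrite expt_scalar11.
Qed.

Lemma cexp_ReIm (z : C) (a b : R) (u v : nat -> R) :
  (forall k, z ^+ k / k`!%:R = (u k +i* v k)%C) ->
  series u @ \oo --> a -> series v @ \oo --> b -> cexp z = (a +i* b)%C.
Proof.
move=> huv ha hb; apply: scalar1_inj; apply: mcvg_uniq (cexp_cvg z) _.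
have S k : \sum_(0 <= j < k) z ^+ j / j`!%:R = (series u k +i* series v k)%C.
  rewrite /series /=; elim: k => [|k IH]; first by rewrite !big_nil.
  by rewrite !big_nat_recr //= IH huv.
under eq_fun do rewrite S.
exact: mcvg_complex.
Qed.

Lemma cexp_real (a : R) : cexp (a%:C)%C = ((expR a)%:C)%C.
Proof.
apply: (@cexp_ReIm _ _ _ (exp_coeff a) (fun=> 0)).
- move=> k; rewrite /exp_coeff /= -[RHS]/((a ^+ k / k`!%:R)%:C)%C.
  by rewrite rmorphM rmorphXn fmorphV rmorph_nat.
- exact: series_expR.
- rewrite (_ : series _ = fun=> 0); first exact: cvg_cst.
  by apply/funext => k; rewrite /series /= big1.
Qed.

Lemma i_pow k : ('i%C : C) ^+ k =
  (((~~ odd k)%:R * (-1) ^ k./2) +i* ((odd k)%:R * (-1) ^+ k.-1./2))%C.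
Proof.
have -> : k = (odd k + k./2 * 2)%N by rewrite muln2 odd_double_half.
set b := odd k; set m := k./2; rewrite exprD mulnC exprM sqr_i.
have -> : odd (b + 2 * m) = b by rewrite oddD mul2n odd_double addbF oddb.
have e1 : ((-1 : C) ^+ m = (((-1) ^+ m) +i* 0)%C).
  by rewrite -[RHS]/(((-1) ^+ m)%:C)%C rmorphXn rmorphN1.
have -> : (b + 2 * m)./2 = m by rewrite mul2n halfD odd_double andbF add0n doubleK; case: (b).
rewrite e1 -exprnP; case: b => /=.
  have -> : ((2 * m)./2 = m)%N by rewrite mul2n doubleK.
  by rewrite expr1; simpc.
by rewrite expr0; simpc.
Qed.

Lemma cexp_im (b : R) : cexp (0 +i* b)%C = (cos b +i* sin b)%C.
Proof.
apply: (@cexp_ReIm _ _ _ (cos_coeff b) (sin_coeff b)).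
- move=> k; have -> : (0 +i* b)%C = 'i%C * (b%:C)%C :> C by simpc.
  rewrite exprMn i_pow -mulrA.
  have -> : (b%:C)%C ^+ k / k`!%:R = ((b ^+ k / k`!%:R)%:C)%C.
    by rewrite rmorphM rmorphXn fmorphV rmorph_nat.
  by rewrite /cos_coeff /sin_coeff /=; simpc; rewrite ?mulrA.
- by rewrite unlock; exact: is_cvg_series_cos_coeff.
- by rewrite unlock; exact: is_cvg_series_sin_coeff.
Qed.

(** Polar decomposition. *)
Lemma cexp_surj (w : C) : w != 0 -> exists z, cexp z = w.
Proof.
move=> w0; pose r := normc w.
have r0 : 0 < r.
  rewrite lt_neqAle normc_ge0 andbT eq_sym; apply/eqP => h.
  by move: w0; rewrite (eq0_normc h) eqxx.
have [t [ct st]] : exists t, cos t = complex.Re w / r /\ sin t = complex.Im w / r.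
  have rr : (complex.Re w) ^+ 2 + (complex.Im w) ^+ 2 = r ^+ 2.
    by rewrite /r; case: (w) => x y /=; rewrite sqr_sqrtr ?addr_ge0 ?sqr_ge0.
  have hc : -1 <= complex.Re w / r <= 1.
    rewrite -ler_norml normrM normfV (gtr0_norm r0) ler_pdivrMr // mul1r.
    exact: Re_le_normc.
  pose t := acos (complex.Re w / r).
  have ct : cos t = complex.Re w / r by rewrite acosK // in_itv.
  have st : (sin t) ^+ 2 = (complex.Im w / r) ^+ 2.
    apply/eqP; rewrite -(inj_eq (addrI ((cos t) ^+ 2))) cos2Dsin2 ct.
    by rewrite !expr_div_n -mulrDl rr divff // expf_neq0 // lt0r_neq0.
  move/eqP: st; rewrite eqf_sqr => /orP[] /eqP st; first by exists t.
  by exists (- t); rewrite cosN sinN st opprK.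
exists ((ln r)%:C + (0 +i* t))%C; rewrite cexpD cexp_real cexp_im lnK ?posrE // ct st.
case: (w) => x y /=; simpc; congr (_ +i* _)%C; rewrite mulrCA divff ?mulr1 //; exact: lt0r_neq0.
Qed.

Lemma expt_diag n (x : 'rV[C]_n) k :
  expt (diag_mx x) k = diag_mx (\row_i (x 0 i ^+ k / k`!%:R)).
Proof.
elim: k => [|k IH].
  rewrite expt0; apply/matrixP => i j; rewrite !mxE expr0 fact0 invr1 mulr1.
  by case: eqP.
apply: (scalerI (nat1_neq0 R k)); rewrite expt_fact IH mulmx_diag -linearZ /=; congr diag_mx.
apply/rowP => i; rewrite !mxE factS natrM invfM exprS [RHS]mulrCA.
by rewrite (mulVKf (nat1_neq0 R k)) mulrA.
Qed.

Lemma expm_diag n (x : 'rV[C]_n) : expm (diag_mx x) = diag_mx (map_mx cexp x).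
Proof.
apply: mcvg_uniq (expmP _) _; apply: mcvg_entries => i j.
have -> : (fun k => (series (expt (diag_mx x)) k i j)%:M : 'M[C]_1) =
  fun k => ((\sum_(0 <= l < k) x 0 i ^+ l / l`!%:R) *+ (i == j))%:M.
  apply/funext => k; congr (_%:M); rewrite /series /= summxE -sumrMnl.
  by apply: eq_bigr => l _; rewrite expt_diag !mxE.
rewrite !mxE; case: (i == j); last by rewrite !mulr0n; exact: mcvg_cst.
by rewrite !mulr1n; exact: cexp_cvg.
Qed.

Lemma expm_nilp n (N : 'M[C]_n) k : N ^+ k = 0 -> expm N = \sum_(0 <= j < k) expt N j.
Proof.
move=> Nk; have h := @mcvg_sub _ _ _ _ _ (fun j => j + k)%N (fun j => leq_addr k j) (expmP N).
apply: (mcvg_uniq h); rewrite (_ : (fun _ => _) = fun=> \sum_(0 <= j < k) expt N j).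
  exact: mcvg_cst.
apply/funext => j; rewrite /series /= (big_cat_nat (n := k)) ?leq_addl //=.
have -> : \sum_(k <= i < j + k) expt N i = 0; last by rewrite addr0.
rewrite big_nat_cond big1 // => l /andP[/andP[kl _] _].
by rewrite /expt -(subnKC kl) exprD Nk mul0r scaler0.
Qed.

Local Notation toC := (map_mx (real_complex R)).

(** The partial sums have no imaginary part. *)
Lemma expm_toC n (A : 'M[R]_n) : toC (expm A) = expm (toC A).
Proof.
have e k : series (expt (toC A)) k = toC (series (fun k => (k`!%:R)^-1 *: A ^+ k) k).
  rewrite /series /= raddf_sum; apply: eq_bigr => j _.
  rewrite /expt /= map_mxZ fmorphV rmorph_nat; congr (_ *: _).
  by elim: j => [|j IH]; rewrite ?expr0 ?map_mx1 // !exprS -!mulmxE map_mxM /= IH mulmxE.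
have hE := expmP (toC A).
have [L hL] : exists L : 'M[R]_n, expm (toC A) = toC L.
  exists (map_mx (@complex.Re R) (expm (toC A))).
  apply/matrixP => i j; rewrite !mxE.
  have hI : mcvg (fun k => ((complex.Im (series (expt (toC A)) k i j))%:C)%C%:M : 'M[C]_1)
     ((complex.Im (expm (toC A) i j))%:C)%C%:M.
    apply: mcvg_le (mcvg_entry i j hE) => k.
    by rewrite -!raddfB !mx11_nm [leLHS]normcR; exact: Im_le_normc.
  have I0 : complex.Im (expm (toC A) i j) = 0.
    have : (fun k => ((complex.Im (series (expt (toC A)) k i j))%:C)%C%:M : 'M[C]_1) = fun=> 0.
      by apply/funext => k; rewrite e !mxE /= raddf0.
    move=> h0; rewrite h0 in hI; have := mcvg_uniq hI (mcvg_cst 0).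
    by rewrite -(raddf0 (@scalar_mx C 1)) => /scalar1_inj [].
  by move: I0; case: (expm _ _ _) => a b /= ->.
rewrite hL; congr toC.
apply: (@cvg_lim _ _ _ \oo); first exact: norm_hausdorff.
apply/cvg_ballP => eps e0; have [K hK] := mcvg_eventually hE e0; exists K => // k /= Kk.
split=> // i j; rewrite -ball_normE /ball_ /=; apply: le_lt_trans (hK k Kk).
rewrite -normcR nmB hL e.
have -> : ((L i j - series (fun k0 => (k0`!%:R)^-1 *: A ^+ k0) k i j)%:C)%C =
   (toC L - toC (series (fun k0 => (k0`!%:R)^-1 *: A ^+ k0) k)) i j.
  by rewrite !mxE rmorphB.
exact: nm_entry.
Qed.

End ScalarExp.

(** * The chart of second kind *)

Section Chart.
Variable R : realType.
Local Notation C := (R[i]).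

Lemma series_exp_le (x : R) k : 0 <= x -> series (exp_coeff x) k <= expR x.
Proof.
move=> x0; apply: (limr_ge (is_cvg_series_exp_coeff x)); near=> m.
have km : (k <= m)%N by near: m; exists k.
rewrite /series /= [leRHS](big_cat_nat (n := k)) //= lerDl.
by apply: sumr_ge0 => i _; exact: exp_coeff_ge0.
Unshelve. all: by end_near. Qed.

Lemma nm_expm_le n (A : 'M[C]_n) : nm (expm A) <= (n%:R + 1) * expR (nm A).
Proof.
apply: (mcvg_nm_le (expmP A)) => k; rewrite (le_trans (nm_sum _ _ _)) //.
apply: (@le_trans _ _ (\sum_(0 <= i < k) (n%:R + 1) * exp_coeff (nm A) i)).
  by apply: ler_sum => i _; exact: nm_expt.
by rewrite -mulr_sumr ler_wpM2l ?addr_ge0 // series_exp_le ?nm_ge0.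
Qed.

Lemma expm_le2 n (A : 'M[C]_n) :
  nm (expm A - 1%:M - A) <= nm A ^+ 2 * expR (nm A).
Proof.
have h := @mcvg_sub _ _ _ _ _ (fun k => k.+2) (fun k => leqW (leqnSn k)) (expmP A).
have -> : expm A - 1%:M - A = expm A + - (1%:M + A) by rewrite opprD addrA.
apply: (mcvg_nm_le (mcvgD h (mcvg_cst (- (1%:M + A))))) => k.
have -> : series (expt A) k.+2 - (1%:M + A) = \sum_(0 <= i < k) expt A i.+2.
  rewrite /series /= !big_nat_recl // expt0.
  have -> : expt A 1 = A by rewrite /expt factS fact0 muln1 invr1 scale1r expr1.
  by rewrite opprD addrACA subrr add0r addrAC subrr add0r.
rewrite (le_trans (nm_sum _ _ _)) //.
apply: (@le_trans _ _ (\sum_(0 <= i < k) (nm A ^+ 2 * exp_coeff (nm A) i))).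
  apply: ler_sum => i _; rewrite nmZ normcV normc_nat mulrC.
  rewrite /exp_coeff /= mulrA -exprD.
  apply: ler_pM; rewrite ?nm_ge0 ?invr_ge0 //; first exact: nmX.
  by rewrite lef_pV2 ?posrE ?ltr0n ?fact_gt0 // ler_nat leq_fact // ltnW.
by rewrite -mulr_sumr ler_wpM2l ?exprn_ge0 ?nm_ge0 // series_exp_le ?nm_ge0.
Qed.

Lemma expm1_le2 n (A : 'M[C]_n) c : nm A <= c ->
  nm (expm A - 1%:M) <= nm A * (1 + c * expR c).
Proof.
move=> Ac; rewrite (le_trans (nm_leB _ A)) // mulrDr mulr1 addrC lerD2l.
rewrite (le_trans (expm_le2 A)) // expr2 -mulrA ler_wpM2l ?nm_ge0 //.
by rewrite ler_pM ?nm_ge0 ?expR_ge0 // ler_expR.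
Qed.

Variables (n : nat) (e : nat -> 'M[C]_n).

(** The chart of second kind exp(s_0 e_0) ... exp(s_(k-1) e_(k-1)). *)
Fixpoint expchart (k : nat) (s : nat -> C) : 'M[C]_n :=
  if k is k'.+1 then expchart k' s *m expm (s k' *: e k') else 1%:M.

Fixpoint expchartV (k : nat) (s : nat -> C) : 'M[C]_n :=
  if k is k'.+1 then expm (- (s k' *: e k')) *m expchartV k' s else 1%:M.

Lemma expchartK k s : expchart k s *m expchartV k s = 1%:M.
Proof.
elim: k => [|k IH] /=; first by rewrite mulmx1.
by rewrite -mulmxA (mulmxA (expm _)) expmNr mul1mx.
Qed.

Lemma expchartVK k s : expchartV k s *m expchart k s = 1%:M.
Proof.
elim: k => [|k IH] /=; first by rewrite mulmx1.
by rewrite -mulmxA (mulmxA (expchartV _ _)) IH mul1mx expmNl.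
Qed.

(** The velocity of the chart in the direction [sg], moved to the identity by a right translation. *)
Definition expchart_dir (k : nat) (s sg : nat -> C) : 'M[C]_n :=
  \sum_(0 <= i < k) sg i *: (expchart i s *m e i *m expchartV i s).

Lemma nm_scale_le1 (x : C) k : normc x <= 1 -> nm (x *: e k) <= nm (e k).
Proof. by move=> x1; rewrite nmZ ler_piMl ?nm_ge0. Qed.

Lemma expchart_bound k : exists2 M, 0 <= M & forall s, (forall i, normc (s i) <= 1) ->
  nm (expchart k s) <= M /\ nm (expchartV k s) <= M.
Proof.
elim: k => [|k [M M0 IH]]; first by exists n%:R => // s _; rewrite /= nm1.
pose b := (n%:R + 1) * expR (nm (e k)).
have b0 : 0 <= b by rewrite mulr_ge0 ?addr_ge0 ?expR_ge0.
exists (M * b) => [|s hs]; first exact: mulr_ge0.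
have [h1 h2] := IH s hs.
have h (A : 'M[C]_n) : nm A <= nm (e k) -> nm (expm A) <= b.
  by move=> hA; rewrite /b (le_trans (nm_expm_le _)) // ler_wpM2l ?addr_ge0 // ler_expR.
split=> /=; rewrite (le_trans (nmM _ _)) //; last rewrite mulrC.
  by rewrite ler_pM ?nm_ge0 // h // nm_scale_le1.
by rewrite ler_pM ?nm_ge0 // h // nmN nm_scale_le1.
Qed.

Lemma expchart_near1 k : exists2 M, 0 <= M & forall r s, 0 <= r <= 1 ->
  (forall i, normc (s i) <= r) -> nm (expchart k s - 1%:M) <= M * r.
Proof.
elim: k => [|k [M M0 IH]]; first by exists 0 => // r s _ _ /=; rewrite subrr nm0 mul0r.
pose b := (n%:R + 1) * expR (nm (e k)); pose c := nm (e k) * (1 + nm (e k) * expR (nm (e k))).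
exists (M * b + c) => [|r s /andP[r0 r1] hs].
  by rewrite !(addr_ge0, mulr_ge0, expR_ge0, nm_ge0).
have hk : nm (s k *: e k) <= nm (e k).
  by rewrite nm_scale_le1 // (le_trans (hs k)).
rewrite /=; have -> : expchart k s *m expm (s k *: e k) - 1%:M =
   (expchart k s - 1%:M) *m expm (s k *: e k) + (expm (s k *: e k) - 1%:M).
  by rewrite mulmxBl mul1mx addrA subrK.
rewrite (le_trans (nmD _ _)) // mulrDl lerD //.
  rewrite (le_trans (nmM _ _)) // mulrAC ler_pM ?nm_ge0 //; first by rewrite IH ?r0.
  by rewrite /b (le_trans (nm_expm_le _)) // ler_wpM2l ?addr_ge0 // ler_expR.
rewrite (le_trans (expm1_le2 hk)) // /c mulrAC ler_wpM2r //.
  by rewrite addr_ge0 // mulr_ge0 ?nm_ge0 ?expR_ge0.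
by rewrite nmZ mulrC ler_wpM2l ?nm_ge0.
Qed.

Lemma expchart_dir_bound k : exists2 M, 0 <= M & forall s sg, (forall i, normc (s i) <= 1) ->
  (forall i, normc (sg i) <= 1) -> nm (expchart_dir k s sg) <= M.
Proof.
elim: k => [|k [M M0 IH]].
  by exists 0 => // s sg _ _; rewrite /expchart_dir big_nil nm0.
have [b b0 hb] := expchart_bound k; exists (M + b * nm (e k) * b).
  by rewrite !(addr_ge0, mulr_ge0, nm_ge0).
move=> s sg hs hsg; rewrite /expchart_dir big_nat_recr //= (le_trans (nmD _ _)) // lerD //.
  exact: IH.
have [h1 h2] := hb s hs.
rewrite nmZ (le_trans (ler_piMl (nm_ge0 _) (hsg k))) // (le_trans (nmM _ _)) //.
rewrite ler_pM ?nm_ge0 // (le_trans (nmM _ _)) // ler_wpM2r ?nm_ge0 //.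
Qed.

(** First order expansion of the chart, with a uniform quadratic error. The induction splits off the
    last exponential factor. *)
Lemma expchart_deriv k : exists2 K, 0 <= K & forall (d : C) s sg, normc d <= 1 ->
  (forall i, normc (s i) <= 1) -> (forall i, normc (sg i) <= 1) ->
  nm (expchart k (fun i => s i + d * sg i) - (1%:M + d *: expchart_dir k s sg) *m expchart k s)
  <= K * normc d ^+ 2.
Proof.
elim: k => [|k [K K0 IH]].
  exists 0 => // d s sg _ _ _; rewrite /= /expchart_dir big_nil scaler0 addr0 mulmx1 subrr.
  by rewrite nm0 mul0r.
have [b b0 hb] := expchart_bound k; have [u u0 hu] := expchart_dir_bound k.
pose a := nm (e k); have a0 : 0 <= a := nm_ge0 _.
pose x := (n%:R + 1) * expR (a + a).
pose y := (n%:R + 1) * expR a.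
have x0 : 0 <= x by rewrite mulr_ge0 ?addr_ge0 ?expR_ge0.
have y0 : 0 <= y by rewrite mulr_ge0 ?addr_ge0 ?expR_ge0.
pose K' := K * x + (n%:R + u) * b * (a ^+ 2 * expR a * y) + u * (b * a * y).
exists K'; first by rewrite !(addr_ge0, mulr_ge0, expR_ge0, exprn_ge0).
move=> d s sg hd hs hsg.
have [h1 h2] := hb s hs; have hU := hu s sg hs hsg.
set U := expchart_dir k s sg in hU *; set B := expchart k s in h1 *; set Bi := expchartV k s in h2 *.
set Bd := expchart k (fun i => s i + d * sg i).
pose Ed := expm ((d * sg k) *: e k); pose E := expm (s k *: e k).
have hdk : nm ((d * sg k) *: e k) <= normc d * a.
  by rewrite nmZ normcM -mulrA ler_wpM2l ?normc_ge0 // ler_piMl ?nm_ge0.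
have hdk1 : nm ((d * sg k) *: e k) <= a by rewrite (le_trans hdk) // ler_piMl.
have hE : nm E <= y.
  by rewrite /y (le_trans (nm_expm_le _)) // ler_wpM2l ?addr_ge0 // ler_expR nm_scale_le1.
have eE : expchart k.+1 (fun i => s i + d * sg i) = Bd *m (Ed *m E).
  rewrite /= -/Bd /Ed /E -expmD; last by rewrite -!scalemxAl -!scalemxAr scalerA mulrC -scalerA.
  by rewrite scalerDl addrC.
have hEE : nm (Ed *m E) <= x.
  rewrite /Ed /E -expmD; last by rewrite -!scalemxAl -!scalemxAr scalerA mulrC -scalerA.
  rewrite /x (le_trans (nm_expm_le _)) // ler_wpM2l ?addr_ge0 // ler_expR.
  by rewrite (le_trans (nmD _ _)) // lerD // nm_scale_le1.
have eU : expchart_dir k.+1 s sg = U + sg k *: (B *m e k *m Bi).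
  by rewrite /expchart_dir big_nat_recr.
have BiB : Bi *m B = 1%:M by exact: expchartVK.
have eB : (1%:M + d *: expchart_dir k.+1 s sg) *m expchart k.+1 s =
   (1%:M + d *: U) *m B *m E + d *: (sg k *: (B *m e k *m E)).
  rewrite /= -/B -/E eU scalerDr addrA (mulmxDl _ _ (B *m E)) mulmxA; congr (_ + _).
  by rewrite -!scalemxAl -!mulmxA (mulmxA Bi) BiB mul1mx.
have -> : expchart k.+1 (fun i => s i + d * sg i) - (1%:M + d *: expchart_dir k.+1 s sg) *m expchart k.+1 s
  = (Bd - (1%:M + d *: U) *m B) *m (Ed *m E)
  + (1%:M + d *: U) *m B *m ((Ed - 1%:M - (d * sg k) *: e k) *m E)
  + (d *: U) *m (B *m ((d * sg k) *: e k) *m E).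
  set P := (1%:M + d *: U) *m B; set D := (d * sg k) *: e k.
  have eF : d *: (sg k *: (B *m e k *m E)) = P *m (D *m E) - (d *: U) *m (B *m D *m E).
    rewrite /P mulmxDl mul1mx mulmxDl -!mulmxA addrK /D.
    by rewrite -scalemxAl -scalemxAr scalerA.
  have aux (V : zmodType) (q p y' w z : V) :
      q - (y' + (w - z)) = q - p + (p - y' - w) + z.
    by rewrite !opprD opprK !addrA subrK.
  rewrite eE eB eF -/P (mulmxBl Bd) !(mulmxBl _ _ E) mul1mx !mulmxBr; exact: aux.
rewrite (le_trans (nmD _ _)) // (le_trans (lerD (nmD _ _) (lexx _))) //.
have d2 : 0 <= normc d ^+ 2 by rewrite exprn_ge0 ?normc_ge0.
rewrite /K' 2!mulrDl; apply: lerD; first apply: lerD.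
- rewrite (le_trans (nmM _ _)) // mulrAC ler_pM ?nm_ge0 //; exact: IH.
- rewrite (le_trans (nmM _ _)) // -(mulrA ((n%:R + u) * b)) ler_pM ?nm_ge0 //.
    rewrite (le_trans (nmM _ _)) // ler_pM ?nm_ge0 //.
    rewrite (le_trans (nmD _ _)) // nm1 lerD2l nmZ (le_trans _ hU) // ler_piMl ?nm_ge0 //.
  rewrite (le_trans (nmM _ _)) // mulrAC ler_pM ?nm_ge0 // (le_trans (expm_le2 _)) //.
  rewrite [leRHS]mulrAC ler_pM ?exprn_ge0 ?nm_ge0 ?expR_ge0 ?ler_expR // -exprMn.
  by rewrite lerXn2r ?nnegrE ?nm_ge0 ?mulr_ge0 ?normc_ge0 // (mulrC a).
rewrite (le_trans (nmM _ _)) // nmZ.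
apply: (@le_trans _ _ ((normc d * u) * (b * (normc d * a) * y))).
  rewrite ler_pM ?mulr_ge0 ?nm_ge0 ?normc_ge0 //; first by rewrite ler_wpM2l ?normc_ge0.
  rewrite (le_trans (nmM _ _)) // ler_pM ?nm_ge0 // (le_trans (nmM _ _)) // ler_pM ?nm_ge0 //.
rewrite le_eqVlt; apply/orP; left; apply/eqP; ring.
Qed.

End Chart.

(** * Products of exponentials of small length *)

Section IntegralSubgroup.
Variable R : realType.
Local Notation C := (R[i]).
Variable n : nat.
Implicit Types (h : set 'M[C]_n) (X Y g : 'M[C]_n).

Lemma GL_subgroup_capP (F : fieldType) m (E : set 'M[F]_m) : (forall A, E A -> A \in unitmx) ->
  GL_subgroup (smallest (@GL_subgroup F m) E).
Proof.
move=> Eu; split.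
- move=> A /(_ [set B | B \in unitmx]); apply; split=> //.
  split=> [B Bu||B D Bu Du|B Bu]; first exact: Bu.
  - exact: unitmx1.
  - by rewrite /= unitmx_mul Bu; exact: Du.
  - by rewrite /= unitmx_inv.
- by move=> K [[_ h _ _] _].
- by move=> A B hA hB K HK; have [[_ _ h3 _] _] := HK; exact: h3 (hA K HK) (hB K HK).
- by move=> A hA K HK; have [[_ _ _ h4] _] := HK; exact: h4 (hA K HK).
Qed.

Lemma integral_GL h : GL_subgroup (integral_subgroup h).
Proof. by apply: GL_subgroup_capP => _ [X _ <-]; exact: expm_unit. Qed.

Lemma integral_exp h X : h X -> integral_subgroup h (expm X).
Proof. by move=> hX; apply: sub_gen_smallest; exists X. Qed.

Lemma integral_min h (A : set 'M[C]_n) : GL_subgroup A ->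
  (forall X, h X -> A (expm X)) -> integral_subgroup h `<=` A.
Proof. by move=> Agl hA; apply: smallest_sub => // _ [X hX <-]; exact: hA. Qed.

Lemma invmxM (A B : 'M[C]_n) : A \in unitmx -> B \in unitmx ->
  invmx (A *m B) = invmx B *m invmx A.
Proof.
move=> Au Bu; apply: (@row_free_inj _ _ _ _ (A *m B)).
  by rewrite row_free_unit unitmx_mul Au.
rewrite mulVmx ?unitmx_mul ?Au //.
by rewrite mulmxA -(mulmxA (invmx B)) mulVmx // mulmx1 mulVmx.
Qed.

(** The elements of GL that preserve [h] in both directions form a group containing exp(h). *)
Lemma integral_Ad h g X : Lie_subalgebra h -> integral_subgroup h g -> h X ->
  h (g *m X *m invmx g).
Proof.
move=> hL.
pose N := [set g : 'M[C]_n | g \in unitmx /\ forall X, h X ->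
   h (g *m X *m invmx g) /\ h (invmx g *m X *m g)].
suff sN : integral_subgroup h `<=` N by move=> /sN [_ H] /H [].
apply: integral_min => [|Y hY].
  split=> [A [Au _]||A B [Au hA] [Bu hB]|A [Au hA]]; first exact: Au.
  - split=> [|Y hY]; first exact: unitmx1.
    by rewrite invmx1 !mul1mx !mulmx1.
  - split=> [|Y hY]; first by rewrite unitmx_mul Au.
    rewrite invmxM //; split.
      by have := proj1 (hA _ (proj1 (hB _ hY))); rewrite !mulmxA.
    by have := proj2 (hB _ (proj2 (hA _ hY))); rewrite !mulmxA.
  - split=> [|Y hY]; first by rewrite unitmx_inv.
    by rewrite invmxK; have [] := hA _ hY.
split=> [|Z hZ]; first exact: expm_unit.
rewrite expm_inv; split; first exact: Ad_Lie.
rewrite -{2}[Y]opprK; apply: Ad_Lie => //; apply: lin_closedN => //; exact: Lie_lin.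
Qed.

Definition prodexp (u : seq 'M[C]_n) : 'M[C]_n :=
  foldr (fun X acc => expm X *m acc) 1%:M u.

Definition len (u : seq 'M[C]_n) : R := \sum_(X <- u) nm X.

Lemma prodexp_cat u v : prodexp (u ++ v) = prodexp u *m prodexp v.
Proof. by elim: u => [|X u IH] /=; rewrite ?mul1mx // IH mulmxA. Qed.

Lemma len_cat u v : len (u ++ v) = len u + len v.
Proof. by rewrite /len big_cat. Qed.

Lemma len_ge0 u : 0 <= len u.
Proof. by apply: sumr_ge0 => i _; exact: nm_ge0. Qed.

Definition uinv (u : seq 'M[C]_n) := rev (map (fun X => - X) u).

Lemma len_uinv u : len (uinv u) = len u.
Proof.
rewrite /len /uinv; elim: u => [|X u IH]; first by rewrite !big_nil.
by rewrite map_cons rev_cons -cats1 big_cat IH big_seq1 nmN big_cons addrC.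
Qed.

Lemma prodexp_uinv u : prodexp u *m prodexp (uinv u) = 1%:M.
Proof.
elim: u => [|X u IH]; first by rewrite /= mulmx1.
have -> : uinv (X :: u) = uinv u ++ [:: - X] by rewrite /uinv map_cons rev_cons cats1.
have e1 : prodexp [:: - X] = expm (- X) by rewrite /prodexp /= mulmx1.
have e2 : prodexp (X :: u) = expm X *m prodexp u by [].
rewrite prodexp_cat e1 e2 mulmxA -(mulmxA (expm X)) IH mulmx1; exact: expmNr.
Qed.

Lemma prodexp_uinvl u : prodexp (uinv u) *m prodexp u = 1%:M.
Proof. exact: mulmx1C (prodexp_uinv u). Qed.

(** The limits of motions along [h] of total length at most [eta]. *)
Definition shortlim h (eta : R) g := exists u : nat -> seq 'M[C]_n,
  [/\ forall k, {in u k, forall X, h X}, forall k, len (u k) <= eta &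
      mcvg (fun k => prodexp (u k)) g].

Lemma shortlimM h a b g g' : shortlim h a g -> shortlim h b g' ->
  shortlim h (a + b) (g *m g').
Proof.
move=> [u [hu lu cu]] [v [hv lv cv]]; exists (fun k => u k ++ v k); split.
- by move=> k X; rewrite mem_cat => /orP[]; [exact: hu|exact: hv].
- by move=> k; rewrite len_cat lerD.
- by under eq_fun do rewrite prodexp_cat; exact: mcvgM.
Qed.

Lemma shortlim_le h a b g : a <= b -> shortlim h a g -> shortlim h b g.
Proof.
by move=> ab [u [hu lu cu]]; exists u; split=> // k; exact: le_trans (lu k) ab.
Qed.

Lemma mcvg_inv (u v : nat -> 'M[C]_n) g : (forall k, u k *m v k = 1%:M) ->
  g \in unitmx -> mcvg u g -> mcvg v (invmx g).
Proof.
move=> uv gu ug.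
have vu k : v k *m u k = 1%:M by exact: mulmx1C.
pose c := nm (invmx g); have c0 : 0 <= c := nm_ge0 _.
have e k : v k - invmx g = v k *m (g - u k) *m invmx g.
  by rewrite mulmxBr vu mulmxBl mul1mx -mulmxA mulmxV // mulmx1.
have [K hK] : exists K, forall k, (K <= k)%N -> nm (v k) <= 2 * c.
  have : 0 < (2 * (c + 1))^-1 by rewrite invr_gt0 mulr_gt0 // ltr_wpDl.
  move=> /(mcvg_eventually ug) [K hK]; exists K => k /hK ek.
  have : nm (v k - invmx g) <= nm (v k) / 2.
    rewrite e (le_trans (nmM _ _)) // (le_trans (ler_wpM2r c0 (nmM _ _))) //.
    rewrite -mulrA ler_wpM2l ?nm_ge0 // nmB.
    apply: (@le_trans _ _ ((2 * (c + 1))^-1 * c)); first by rewrite ler_wpM2r // ltW.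
    by rewrite invfM -mulrA ler_piMr ?invr_ge0 // mulrC ler_pdivrMr ?mul1r ?lerDl // ltr_wpDl.
  have := nm_leB (v k) (invmx g); rewrite -/c; lra.
apply: mcvg_eps => eps e0.
have : 0 < eps / (2 * c * c + 1) by rewrite divr_gt0 // ltr_wpDl // !mulr_ge0.
move=> /(mcvg_eventually ug) [K' hK']; exists (maxn K K') => k.
rewrite geq_max => /andP[/hK v2 /hK' ek]; rewrite e.
rewrite (le_lt_trans (nmM _ _)) // -/c (le_lt_trans (ler_wpM2r c0 (nmM _ _))) //.
rewrite nmB; apply: (@le_lt_trans _ _ (2 * c * (eps / (2 * c * c + 1)) * c)).
  rewrite ler_wpM2r // ler_pM ?nm_ge0 //; exact: ltW.
have D0 : 0 < 2 * c * c + 1 by rewrite ltr_wpDl // !mulr_ge0.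
rewrite mulrAC mulrA ltr_pdivrMr // mulrC ltr_pM2l //; lra.
Qed.

Lemma shortlimV h a g : lin_closed h -> g \in unitmx -> shortlim h a g ->
  shortlim h a (invmx g).
Proof.
move=> hh gu [u [hu lu cu]]; exists (fun k => uinv (u k)); split.
- move=> k X; rewrite mem_rev => /mapP[Y Yu ->]; apply: lin_closedN => //; exact: hu Yu.
- by move=> k; rewrite len_uinv.
- by apply: mcvg_inv cu => // k; exact: prodexp_uinv.
Qed.

Lemma prodexp_conj g u : g \in unitmx ->
  prodexp (map (fun X => g *m X *m invmx g) u) = g *m prodexp u *m invmx g.
Proof.
move=> gu; elim: u => [|X u IH] /=; first by rewrite mulmx1 mulmxV.
have ec : expm (g *m X *m invmx g) = g *m expm X *m invmx g.
  by have := @expm_conj _ _ (invmx g) X; rewrite unitmx_inv invmxK; apply.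
by rewrite IH ec !mulmxA mulmxKV.
Qed.

(** Conjugation by a fixed element of the group preserves [h], and multiplies lengths by a bounded
    factor. *)
Lemma shortlim_conj h a g p : Lie_subalgebra h -> integral_subgroup h g ->
  shortlim h a p -> shortlim h (nm g * nm (invmx g) * a) (g *m p *m invmx g).
Proof.
move=> hL hg [u [hu lu cu]].
have gu : g \in unitmx by case: (integral_GL h) => H _ _ _; exact: H.
exists (fun k => map (fun X => g *m X *m invmx g) (u k)); split.
- by move=> k _ /mapP[X /hu hX ->]; exact: integral_Ad.
- move=> k; rewrite (le_trans _ (ler_wpM2l _ (lu k))) ?mulr_ge0 ?nm_ge0 //.
  rewrite /len big_map mulr_sumr; apply: ler_sum => X _.
  rewrite (le_trans (nmM _ _)) // (le_trans (ler_wpM2r (nm_ge0 _) (nmM _ _))) //.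
  by rewrite mulrAC.
- under eq_fun do rewrite prodexp_conj //.
  by apply: mcvgMr; exact: mcvgMl.
Qed.

(** Two matrices at distance [L] have [j]-th powers at distance of order [j * L], provided that both
    are within order 1/j of the identity. *)
Lemma pow_close (U V : 'M[C]_n) (a L : R) j : 0 <= a -> 0 <= L ->
  nm (U - 1%:M) <= a -> nm (V - 1%:M) <= a -> nm (U - V) <= L ->
  nm (U ^+ j - V ^+ j) <= j%:R * (L * n%:R) * (1 + a) ^+ j.
Proof.
move=> a0 L0 hU hV hUV.
have Vj i : nm (V ^+ i) <= n%:R * (1 + a) ^+ i.
  elim: i => [|i IH]; first by rewrite !expr0 nm1 mulr1.
  rewrite exprS -mulmxE -[V in V *m _](subrK 1%:M) mulmxDl mul1mx.
  rewrite (le_trans (nmD _ _)) // (le_trans (lerD (nmM _ _) (lexx _))) //.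
  apply: (@le_trans _ _ ((a + 1) * nm (V ^+ i))).
    by rewrite mulrDl mul1r lerD2r ler_wpM2r ?nm_ge0.
  by rewrite exprS mulrCA (addrC a) ler_wpM2l // addr_ge0.
elim: j => [|j IH]; first by rewrite !expr0 subrr nm0 mul0r mul0r.
have -> : U ^+ j.+1 - V ^+ j.+1 = (U ^+ j - V ^+ j) + (U - 1%:M) *m (U ^+ j - V ^+ j)
   + (U - V) *m V ^+ j.
  have aux (W : zmodType) (x y z p q : W) : x - z = p - q + (x - y - (p - q)) + (y - z).
    by rewrite (addrC (p - q)) subrK addrA subrK.
  rewrite !exprS -!mulmxE !mulmxBl !mulmxBr !mul1mx; exact: aux.
rewrite (le_trans (nmD _ _)) //.
have h1 : nm (U ^+ j - V ^+ j + (U - 1%:M) *m (U ^+ j - V ^+ j)) <=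
   (1 + a) * (j%:R * (L * n%:R) * (1 + a) ^+ j).
  rewrite (le_trans (nmD _ _)) // mulrDl mul1r lerD // (le_trans (nmM _ _)) //.
  by rewrite ler_pM ?nm_ge0.
have h2 : nm ((U - V) *m V ^+ j) <= L * n%:R * (1 + a) ^+ j.+1.
  rewrite (le_trans (nmM _ _)) // -mulrA ler_pM ?nm_ge0 // (le_trans (Vj j)) //.
  by rewrite ler_wpM2l // ler_weXn2l ?leqnSn // lerDl.
apply: le_trans (lerD h1 h2) _; rewrite exprS -natr1 le_eqVlt; apply/orP; left; apply/eqP; ring.
Qed.

End IntegralSubgroup.

(** * The product formula of Trotter *)

Section Covering.
Variable R : realType.
Local Notation C := (R[i]).
Variable n : nat.
Implicit Types (h : set 'M[C]_n) (X Y g : 'M[C]_n).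

Lemma mcvg_harmonic p q (u : nat -> 'M[C]_(p, q)) l c :
  (forall k, nm (u k - l) <= c * harmonic k) -> mcvg u l.
Proof.
move=> h; apply: mcvg_le h _; rewrite -(mulr0 c).
by apply: cvgM; [exact: cvg_cst|exact: cvg_harmonic].
Qed.

Definition mesh (k : nat) : C := (k.+1%:R)^-1.

Lemma normc_mesh k : normc (mesh k) = harmonic k.
Proof. by rewrite normcV normc_nat. Qed.

Lemma mesh_le1 k : normc (mesh k) <= 1.
Proof. by rewrite normc_mesh /= invf_le1 ?ltr0n // ler1n. Qed.

Lemma meshK k X : (mesh k *: X) *+ k.+1 = X.
Proof. by rewrite -scaler_nat scalerA divff ?scale1r // nat1_neq0. Qed.

Lemma trotter_step A B : exists2 K, 0 <= K & forall d : C, normc d <= 1 ->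
  nm (expm (d *: A) *m expm (d *: B) - 1%:M - d *: (A + B) : 'M[C]_n) <= K * normc d ^+ 2.
Proof.
pose e k := if k is 0 then A else B.
have [K K0 hK] := expchart_deriv e 2; exists K => // d hd.
have := hK d (fun=> 0) (fun=> 1) hd.
rewrite normc0 normc1 => /(_ (fun=> ler01) (fun=> lexx _)).
by rewrite /expchart_dir !big_nat_recr //= big_nil !scale0r oppr0 expm0 !mulmx1 !mul1mx !add0r
  !scale1r mulr1 opprD addrA.
Qed.

Lemma one_plus_pow (c : R) k : 0 <= c -> (1 + c * harmonic k) ^+ k.+1 <= expR c.
Proof.
move=> c0; have h0 : 0 <= c * harmonic k by rewrite mulr_ge0 // harmonic_ge0.
apply: (@le_trans _ _ (expR (c * harmonic k) ^+ k.+1)).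
  by rewrite lerXn2r ?nnegrE ?expR_ge0 ?addr_ge0 // expR_ge1Dx.
by rewrite -expRM_natr -mulrA mulVf ?mulr1 // pnatr_eq0.
Qed.

(** Both sides are the powers of order k + 1 of matrices that agree up to order 1/(k + 1)^2. *)
Lemma trotter A B : mcvg (fun k =>
  (expm (mesh k *: A) *m expm (mesh k *: B)) ^+ k.+1) (expm (A + B) : 'M[C]_n).
Proof.
have [K K0 hK] := trotter_step A B.
pose c := nm (A + B) + (K + nm (A + B) ^+ 2 * expR (nm (A + B))).
pose L := K + nm (A + B) ^+ 2 * expR (nm (A + B)).
have x0 : 0 <= nm (A + B) := nm_ge0 _.
have L0 : 0 <= L by rewrite addr_ge0 // mulr_ge0 ?exprn_ge0 ?expR_ge0.
have c0 : 0 <= c by rewrite addr_ge0.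
apply: (@mcvg_harmonic _ _ _ _ (L * n%:R * expR c)) => k.
have d1 := mesh_le1 k; set d := mesh k in d1 *.
have hd : normc d = harmonic k := normc_mesh k.
have d2 : normc d ^+ 2 <= normc d by rewrite expr2 ler_piMr ?normc_ge0.
rewrite -[in expm (A + B)](meshK k (A + B)) expm_natmul -/d.
have hV : nm (expm (d *: (A + B)) - 1%:M - d *: (A + B)) <=
    nm (A + B) ^+ 2 * expR (nm (A + B)) * normc d ^+ 2.
  rewrite (le_trans (expm_le2 _)) // nmZ exprMn.
  apply: (@le_trans _ _ (normc d ^+ 2 * nm (A + B) ^+ 2 * expR (nm (A + B)))).
    by rewrite ler_wpM2l ?mulr_ge0 ?exprn_ge0 ?normc_ge0 // ler_expR ler_piMl.
  by rewrite -mulrA mulrC.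
have hU := hK d d1.
have aux (W : 'M[C]_n) y : 0 <= y -> y <= L -> nm (W - 1%:M - d *: (A + B)) <= y * normc d ^+ 2 ->
    nm (W - 1%:M) <= c * harmonic k.
  move=> y0 yL hW; rewrite (le_trans (nm_leB _ (d *: (A + B)))) // nmZ -hd /c mulrDl addrC.
  rewrite [in leRHS]mulrC lerD2l (le_trans hW) // ler_pM ?exprn_ge0 ?normc_ge0 //.
apply: (@le_trans _ _ (k.+1%:R * (L * normc d ^+ 2 * n%:R) * (1 + c * harmonic k) ^+ k.+1)).
  apply: pow_close.
  - by rewrite mulr_ge0 // harmonic_ge0.
  - by rewrite mulr_ge0 // exprn_ge0 ?normc_ge0.
  - by apply: aux hU => //; rewrite lerDl mulr_ge0 ?exprn_ge0 ?expR_ge0.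
  - by apply: aux hV => //; rewrite ?lerDr // mulr_ge0 ?exprn_ge0 ?expR_ge0.
  set W := d *: (A + B) in hU hV *; set U := _ *m _ in hU *; set V := expm _ in hV *.
  have -> : U - V = (U - 1%:M - W) - (V - 1%:M - W).
    by rewrite -(addrA U) -(addrA V) (opprD V) addrACA subrr addr0.
  rewrite (le_trans (nmD _ _)) // nmN /L mulrDl lerD //.
have k0 : (k.+1%:R : R) != 0 by rewrite pnatr_eq0.
apply: (@le_trans _ _ (k.+1%:R * (L * normc d ^+ 2 * n%:R) * expR c)).
  by rewrite ler_wpM2l ?mulr_ge0 ?exprn_ge0 ?normc_ge0 //; exact: one_plus_pow.
rewrite hd /=; move: k0; set N := _%:R => k0.
rewrite le_eqVlt; apply/orP; left; apply/eqP; by field.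
Qed.

(** Write -d = -X + (X - d) and apply the product formula: pulling the factors exp(-X/k) through to
    exp(X) leaves conjugates of the exponentials of (X - d)/k. *)
Lemma short_diff h X d : Lie_subalgebra h -> h X -> h d ->
  shortlim h (((n%:R + 1) * expR (nm X)) ^+ 2 * nm (X - d)) (expm X *m expm (- d)).
Proof.
move=> hL hX hd; have hh := Lie_lin hL.
pose c := (n%:R + 1) * expR (nm X).
have c0 : 0 <= c by rewrite mulr_ge0 ?addr_ge0 ?expR_ge0.
pose a k j := expm ((j%:R * mesh k) *: X).
pose ai k j := expm (- ((j%:R * mesh k) *: X)).
pose Z k := mesh k *: (X - d).
pose w k m := [seq a k j *m Z k *m ai k j | j <- rev (iota 0 m)].
have hZ k : h (Z k) by apply: lin_closedZ => //; exact: lin_closedB.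
pose T k := expm (mesh k *: - X) *m expm (Z k).
have hw k m : prodexp (w k m) = a k m *m T k ^+ m.
  elim: m => [|m IH].
    by rewrite /w /= expr0 /a mul0r scale0r expm0 mulmx1.
  have -> : w k m.+1 = (a k m *m Z k *m ai k m) :: w k m.
    by rewrite /w -addn1 iotaD rev_cat.
  have -> : prodexp ((a k m *m Z k *m ai k m) :: w k m) =
    expm (a k m *m Z k *m ai k m) *m prodexp (w k m) by [].
  have ec : expm (a k m *m Z k *m ai k m) = a k m *m expm (Z k) *m ai k m.
    have := @expm_conj _ _ (ai k m) (Z k); rewrite expm_unit => /(_ isT).
    by rewrite [invmx (ai k m)]expm_inv opprK.
  have e1 : ai k m *m a k m = 1%:M := expmNl _.
  have e2 : a k m.+1 *m expm (mesh k *: - X) = a k m.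
    rewrite /a -expmD.
      by rewrite scalerN -scalerBl -natr1 mulrDl mul1r addrK.
    by rewrite -!scalemxAl -!scalemxAr scalerA mulrC -scalerA mulNmx mulmxN.
  have e3 : a k m.+1 *m T k ^+ m.+1 = a k m *m expm (Z k) *m T k ^+ m.
    rewrite (exprS (T k)) -mulmxE {1}/T -e2.
    move: (expm _) (expm _) (T k ^+ m) (a k m.+1) => A1 A2 A3 A4.
    by rewrite !mulmxA.
  have e4 : expm (a k m *m Z k *m ai k m) *m (a k m *m T k ^+ m) = a k m *m expm (Z k) *m T k ^+ m.
    rewrite ec; move: (T k ^+ m) (expm (Z k)) e1 => A1 A2; move: (a k m) (ai k m) => A3 A4 e1.
    by rewrite mulmxA -(mulmxA _ A4) e1 mulmx1.
  exact: (etrans (congr1 (mulmx _) IH) (etrans e4 (esym e3))).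
exists (fun k => w k k.+1); split.
- move=> k _ /mapP[j _ ->]; apply: Ad_Lie => //; exact: lin_closedZ.
- move=> k; rewrite /len big_map.
  apply: (@le_trans _ _ (\sum_(j <- rev (iota 0 k.+1)) c ^+ 2 * (harmonic k * nm (X - d)))).
    rewrite big_seq [leRHS]big_seq; apply: ler_sum => j.
    rewrite mem_rev mem_iota add0n => /andP[_ jk].
    have jd : normc (j%:R * mesh k) <= 1.
      rewrite normcM normc_mesh normc_nat /= ler_pdivrMr ?ltr0n // mul1r ler_nat; exact: ltnW.
    have hb : nm ((j%:R * mesh k) *: X) <= nm X by rewrite nmZ ler_piMl ?nm_ge0.
    have ha : nm (a k j) <= c.
      by rewrite (le_trans (nm_expm_le _)) // /c ler_wpM2l ?addr_ge0 // ler_expR.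
    have hai : nm (ai k j) <= c.
      by rewrite (le_trans (nm_expm_le _)) // /c ler_wpM2l ?addr_ge0 // ler_expR nmN.
    have hZn : nm (Z k) = harmonic k * nm (X - d) by rewrite nmZ normc_mesh.
    apply: le_trans (nmM _ _) _; rewrite expr2 mulrAC.
    apply: ler_pM (nm_ge0 _) (nm_ge0 _) _ hai.
    by apply: le_trans (nmM _ _) _; rewrite hZn; apply: ler_wpM2r ha; rewrite -hZn nm_ge0.
  rewrite big_const_seq count_predT size_rev size_iota iter_addr_0 -/c /harmonic /=.
  rewrite -[leLHS]mulr_natr; have k0 : (k.+1%:R : R) != 0 by rewrite pnatr_eq0.
  move: k0; set N := _%:R => k0; rewrite le_eqVlt; apply/orP; left; apply/eqP.
  by field.
- have -> : (fun k => prodexp (w k k.+1)) = (fun k => expm X *m T k ^+ k.+1).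
    by apply/funext => k; rewrite hw /a divff ?scale1r // nat1_neq0.
  have -> : - d = - X + (X - d) by rewrite addrA addNr add0r.
  by apply: mcvgMl; exact: trotter.
Qed.

End Covering.

(** * A countable covering of an integral subgroup *)

Section Pigeon.
Variable R : realType.
Local Notation C := (R[i]).
Implicit Types n : nat.

(** An interval is uncountable. *)
Lemma pigeonhole_itv (T : countType) (f : R -> T) (t0 : R) : 0 < t0 ->
  exists t t', [/\ 0 < t < t0, 0 < t' < t0, t <> t' & f t = f t'].
Proof.
move=> t00; apply: contrapT => H.
have : countable `]0, t0[%classic.
  apply/countable_injP; exists (pickle \o f) => t t'; rewrite !inE /= !in_itv /= => ht ht'.
  move=> /(pcan_inj pickleK) e; apply: contrapT => tt'; apply: H; by exists t, t'.
move=> /countable_lebesgue_measure0; rewrite lebesgue_measure_itv /= lte_fin t00.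
by rewrite oppr0 addr0 => -[] /eqP; rewrite gt_eqF.
Qed.

Lemma rat_approx (x d : R) : 0 < d -> exists q : rat, `|x - ratr q| < d.
Proof.
move=> d0; have xd : x - d < x + d by lra.
have [q] := rat_in_itvoo xd; rewrite in_itv /= => /andP[h1 h2]; exists q.
by rewrite ltr_norml; apply/andP; split; lra.
Qed.

Definition ratvec N (p : 'rV[rat]_N * 'rV[rat]_N) : 'rV[C]_N :=
  \row_j (ratr (p.1 0 j) +i* ratr (p.2 0 j))%C.

Lemma ratvec_dense N (w : 'rV[C]_N) (eps : R) : 0 < eps ->
  exists p, nm (w - ratvec p) < eps.
Proof.
move=> e0; pose d := eps / (2 * N.+1%:R).
have d0 : 0 < d by rewrite divr_gt0 // mulr_gt0.
have [f hf] := fin_all_exists (fun j : 'I_N => rat_approx (complex.Re (w 0 j)) d0).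
have [g hg] := fin_all_exists (fun j : 'I_N => rat_approx (complex.Im (w 0 j)) d0).
exists (\row_j f j, \row_j g j).
apply: (@le_lt_trans _ _ (\sum_(j < N) (d + d))).
  rewrite /nm big_ord1; apply: ler_sum => j _; apply: le_trans (normc_le_ReIm _) _.
  rewrite !mxE /=; have := hf j; have := hg j; case: (w 0 j) => a b /= /ltW h1 /ltW h2.
  exact: lerD.
rewrite sumr_const card_ord -mulr_natr /d.
have -> : (eps / (2 * N.+1%:R) + eps / (2 * N.+1%:R)) * N%:R = eps * (N%:R / N.+1%:R).
  have k0 : (N.+1%:R : R) != 0 by rewrite pnatr_eq0.
  by move: k0; set K := N.+1%:R => k0; field.
by rewrite gtr_pMr // ltr_pdivrMr ?ltr0n // mul1r ltr_nat.
Qed.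

Lemma nm_vec_mx m n (v : 'rV[C]_(m * n)) : nm (vec_mx v) = nm v.
Proof. by rewrite -[in RHS](vec_mxK v) nm_mxvec. Qed.

End Pigeon.

Section Cover.
Variable R : realType.
Local Notation C := (R[i]).
Variables (n : nat) (h : set 'M[C]_n) (hL : Lie_subalgebra h).
Variables (B : 'M[C]_(n * n)) (hB : forall X, h X <-> (mxvec X <= B)%MS).
Local Notation idx := ('rV[rat]_(n * n) * 'rV[rat]_(n * n))%type.

Definition ratelt (p : idx) : 'M[C]_n := vec_mx (ratvec R p *m B).

Lemma ratelt_in p : h (ratelt p).
Proof. by apply/hB; rewrite vec_mxK submxMl. Qed.

Lemma ratelt_dense X (eps : R) : 0 < eps -> h X -> exists p, nm (X - ratelt p) < eps.
Proof.
move=> e0 /hB /submxP[w hw].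
have : 0 < eps / (nm B + 1) by rewrite divr_gt0 // ltr_wpDl ?nm_ge0.
move=> /(ratvec_dense w) [p hp]; exists p.
rewrite -[X]mxvecK hw -linearB -mulmxBl nm_vec_mx (le_lt_trans (nmM _ _)) //.
apply: (@le_lt_trans _ _ (eps / (nm B + 1) * nm B)).
  by rewrite ler_wpM2r ?nm_ge0 // ltW.
have b0 : 0 < nm B + 1 by rewrite ltr_wpDl ?nm_ge0.
by rewrite mulrAC ltr_pdivrMr // ltr_pM2l // ltrDl.
Qed.

Definition ratprod (s : seq idx) := prodexp (map ratelt s).

Lemma ratprod_unit s : ratprod s \in unitmx.
Proof. exact: (proj1 (mulmx1_unit (prodexp_uinv _))). Qed.

Lemma ratprod_inv s : exists s', ratprod s' = invmx (ratprod s).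
Proof.
exists (rev (map (fun p : idx => (- p.1, - p.2)) s)).
have e : map ratelt (rev (map (fun p : idx => (- p.1, - p.2)) s)) = uinv (map ratelt s).
  rewrite /uinv map_rev -!map_comp; congr rev; apply: eq_map => p /=.
  have eN : ratvec R (- p.1, - p.2) = - ratvec R p.
    by apply/rowP => j; rewrite !mxE !rmorphN; apply/eqP; rewrite eq_complex /= !eqxx.
  by rewrite /ratelt eN mulNmx linearN.
have := prodexp_uinvl (map ratelt s); rewrite -e -/(ratprod _) -/(ratprod s) => H.
by rewrite -[LHS](mulmxK (ratprod_unit s)) H mul1mx.
Qed.

Lemma shortlim1 eta : 0 <= eta -> shortlim h eta 1%:M.
Proof.
move=> e0; exists (fun=> [::]); split=> //; last exact: mcvg_cst.
by move=> k; rewrite /len big_nil.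
Qed.

(** The elements with this property form a group: the error of the second factor of a product is
    conjugated by the first factor, and so is chosen after it. *)
Lemma covering g : integral_subgroup h g -> forall eta : R, 0 < eta ->
  exists s, shortlim h eta (g *m invmx (ratprod s)).
Proof.
pose Q := [set g | integral_subgroup h g /\ forall eta : R, 0 < eta ->
  exists s, shortlim h eta (g *m invmx (ratprod s))].
suff sQ : integral_subgroup h `<=` Q by move=> /sQ [].
have [Gu G1 GM GV] := integral_GL h.
apply: integral_min => [|X hX].
  split=> [A [/Gu Au _]||A D [GA hA] [GD hD]|A [GA hA]]; first exact: Au.
  - split=> // eta e0; exists [::]; rewrite /ratprod /= invmx1 mulmx1.
    by apply: shortlim1; exact: ltW.
  - split=> [|eta e0]; first exact: GM.
    have c0 : 0 <= nm A * nm (invmx A) by rewrite mulr_ge0 ?nm_ge0.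
    set c := nm A * nm (invmx A) in c0.
    have e2 : 0 < eta / 2 by rewrite divr_gt0.
    have e3 : 0 < eta / 2 / (c + 1) by rewrite divr_gt0 // ltr_wpDl.
    have [s hs] := hA _ e2; have [s' hs'] := hD _ e3; exists (s ++ s').
    have Au := Gu _ GA.
    have -> : ratprod (s ++ s') = ratprod s *m ratprod s' by rewrite /ratprod map_cat prodexp_cat.
    rewrite invmxM ?ratprod_unit //.
    (* the error of [D] is moved across [A] *)
    have -> : A *m D *m (invmx (ratprod s') *m invmx (ratprod s)) =
        (A *m (D *m invmx (ratprod s')) *m invmx A) *m (A *m invmx (ratprod s)).
      by rewrite !mulmxA mulmxKV.
    rewrite [eta]splitr; apply: shortlimM hs.
    apply: shortlim_le (shortlim_conj hL GA hs'); rewrite -/c mulrA.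
    by rewrite ler_pdivrMr ?ltr_wpDl // mulrC ler_pM2l // lerDl.
  - split=> [|eta e0]; first exact: GV.
    have Au := Gu _ GA; have GAV := GV _ GA.
    have c0 : 0 <= nm (invmx A) * nm (invmx (invmx A)) by rewrite mulr_ge0 ?nm_ge0.
    set c := nm (invmx A) * nm (invmx (invmx A)) in c0.
    have e3 : 0 < eta / (c + 1) by rewrite divr_gt0 // ltr_wpDl.
    have [s hs] := hA _ e3; have [s' hs'] := ratprod_inv s; exists s'.
    have pu : A *m invmx (ratprod s) \in unitmx by rewrite unitmx_mul Au unitmx_inv ratprod_unit.
    have aux (g0 : 'M[C]_n) : g0 \in unitmx ->
        invmx A *m invmx (A *m invmx g0) *m invmx (invmx A) = invmx A *m invmx (invmx g0).
      move=> g0u; have vu : invmx g0 \in unitmx by rewrite unitmx_inv.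
      by rewrite (invmxM Au vu) !invmxK mulmxA (mulmxKV Au).
    have := shortlim_conj hL GAV (shortlimV (Lie_lin hL) pu hs).
    rewrite (aux _ (ratprod_unit s)) -hs' => H; apply: shortlim_le H; rewrite -/c.
    by rewrite mulrA ler_pdivrMr ?ltr_wpDl // mulrC ler_pM2l // lerDl.
split=> [|eta e0]; first exact: integral_exp.
pose c := ((n%:R + 1) * expR (nm X)) ^+ 2.
have c0 : 0 <= c by rewrite exprn_ge0 // mulr_ge0 ?addr_ge0 ?expR_ge0.
have e3 : 0 < eta / (c + 1) by rewrite divr_gt0 // ltr_wpDl.
have [p hp] := ratelt_dense e3 hX; exists [:: p].
have -> : ratprod [:: p] = expm (ratelt p) by rewrite /ratprod /prodexp /= mulmx1.
rewrite expm_inv; apply: shortlim_le (short_diff hL hX (ratelt_in p)); rewrite -/c.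
apply: (@le_trans _ _ (c * (eta / (c + 1)))); first by rewrite ler_wpM2l // ltW.
by rewrite mulrA ler_pdivrMr ?ltr_wpDl // mulrC ler_pM2l // lerDl.
Qed.

End Cover.

(** * Small motions stay in the chart *)

Section Euler.
Variable R : realType.
Local Notation C := (R[i]).
Variables (n : nat) (h : set 'M[C]_n) (hL : Lie_subalgebra h).
Variables (r : nat) (Bb : 'M[C]_(r, n * n)) (Bfree : row_free Bb).
Hypothesis hBb : forall X, h X <-> (mxvec X <= Bb)%MS.

Definition basisf (i : nat) : 'M[C]_n :=
  if insub i is Some j then vec_mx (row (j : 'I_r) Bb) else 0.

Definition coordfun (v : 'rV[C]_r) (i : nat) : C := if insub i is Some j then v 0 (j : 'I_r) else 0.

Lemma basisfE (j : 'I_r) : basisf j = vec_mx (row j Bb).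
Proof. by rewrite /basisf valK. Qed.

Lemma coordfunE v (j : 'I_r) : coordfun v j = v 0 j.
Proof. by rewrite /coordfun valK. Qed.

Lemma basisf_in i : h (basisf i).
Proof.
rewrite /basisf; case: insubP => [j _ _|_]; last by case: hL.
by apply/hBb; rewrite vec_mxK row_sub.
Qed.

Local Notation bt := (expchart basisf r).

Lemma expchart_conj k s X : h X -> h (expchart basisf k s *m X *m expchartV basisf k s).
Proof.
elim: k X => [|k IH] X hX /=; first by rewrite mul1mx mulmx1.
have -> : expchart basisf k s *m expm (s k *: basisf k) *m X *m (expm (- (s k *: basisf k)) *m expchartV basisf k s)
  = expchart basisf k s *m (expm (s k *: basisf k) *m X *m expm (- (s k *: basisf k))) *m expchartV basisf k s.
  move: (expm _) (expm _) (expchart _ _ _) (expchartV _ _ _) => A1 A2 A3 A4.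
  by rewrite !mulmxA.
apply: IH; apply: Ad_Lie => //; apply: lin_closedZ; [exact: Lie_lin|exact: basisf_in].
Qed.

Lemma conj_near (e : nat -> 'M[C]_n) k : exists2 M, 0 <= M & forall (rho : R) s X, 0 <= rho <= 1 ->
  (forall i, normc (s i) <= rho) ->
  nm (expchart e k s *m X *m expchartV e k s - X) <= M * rho * nm X.
Proof.
have [M M0 hM] := expchart_near1 e k; have [b b0 hb] := expchart_bound e k.
exists (M * b + M * b); first by rewrite addr_ge0 ?mulr_ge0.
move=> rho s X /andP[rho0 rho1] hs.
have hs1 i : normc (s i) <= 1 by exact: le_trans (hs i) rho1.
have [_ hbi] := hb s hs1.
have := hM rho s; rewrite rho0 rho1 => /(_ isT hs) hG.
have BB := expchartK e k s; set G := expchart e k s in hG BB *; set Gi := expchartV e k s in hbi BB *.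
have -> : G *m X *m Gi - X = (G - 1%:M) *m X *m Gi - X *m (G - 1%:M) *m Gi.
  rewrite mulmxBl mulmxBr mul1mx mulmx1 !mulmxBl -(mulmxA X G) BB mulmx1.
  by rewrite opprB addrA subrK.
rewrite (le_trans (nmD _ _)) // nmN !mulrDl; apply: lerD.
  apply: (le_trans (nmM _ _)); apply: (@le_trans _ _ ((M * rho * nm X) * b)).
    apply: ler_pM => //; rewrite ?nm_ge0 //; apply: (le_trans (nmM _ _)).
    by rewrite ler_wpM2r ?nm_ge0.
  by rewrite le_eqVlt; apply/orP; left; apply/eqP; ring.
apply: (le_trans (nmM _ _)); apply: (@le_trans _ _ ((nm X * (M * rho)) * b)).
  apply: ler_pM => //; rewrite ?nm_ge0 //; apply: (le_trans (nmM _ _)).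
  by rewrite ler_wpM2l ?nm_ge0.
by rewrite le_eqVlt; apply/orP; left; apply/eqP; ring.
Qed.

Lemma nm_rows p q (A : 'M[C]_(p, q)) : nm A = \sum_i nm (row i A).
Proof.
rewrite /nm; apply: eq_bigr => i _; rewrite big_ord1.
by apply: eq_bigr => j _; rewrite mxE.
Qed.

(** A vector killed by 1 + E has at most half of its own norm. *)
Lemma unit_near1 p (E : 'M[C]_p) : nm E <= 2^-1 -> 1%:M + E \in unitmx.
Proof.
move=> hE; rewrite -row_free_unit -kermx_eq0; apply/eqP/row_matrixP => i; rewrite row0.
set x := row i _; have hx : x *m (1%:M + E) = 0.
  by apply/sub_kermxP; exact: row_sub.
apply: nm_eq0; move: hx; rewrite mulmxDr mulmx1 => /eqP; rewrite addr_eq0 => /eqP e.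
have h1 : nm x <= nm x * 2^-1.
  by rewrite {1}e nmN (le_trans (nmM _ _)) // ler_wpM2l ?nm_ge0.
have := nm_ge0 x; lra.
Qed.

(** At the origin the velocities of the chart in the coordinate directions are the basis of [h]. Nearby
    they are elements of [h] close to this basis, so they still form a basis, with comparable bounds. *)
Lemma expchart_dir_solve : exists2 rho : R, 0 < rho <= 1 & exists2 c : R, 0 < c &
  forall s X, (forall i, normc (s i) <= rho) -> h X ->
  exists sg, expchart_dir basisf r s sg = X /\ forall i, normc (sg i) <= c * nm X.
Proof.
have hM k : exists M : R, 0 <= M /\ forall (rho : R) s, 0 <= rho <= 1 ->
  (forall i, normc (s i) <= rho) ->
  nm (expchart basisf k s *m basisf k *m expchartV basisf k s - basisf k) <= M * rho.
  have [M M0 H] := conj_near basisf k; exists (M * nm (basisf k)); split.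
    by rewrite mulr_ge0 ?nm_ge0.
  by move=> rho s h1 h2; rewrite mulrAC; exact: H.
have [M HM] := boolp.choice hM.
pose MM := \sum_(i < r) M i.
have MM0 : 0 <= MM by apply: sumr_ge0 => i _; case: (HM i).
pose Bp := pinvmx Bb; pose b := nm Bp.
have b0 : 0 <= b := nm_ge0 _.
have BBp : Bb *m Bp = 1%:M by exact: mulmxVp.
(* the moved basis is then within 1/(2b) of [Bb], so its matrix is injective *)
pose rho := (2 * (MM * b + 1))^-1.
have D0 : 0 < MM * b + 1 by rewrite ltr_wpDl ?mulr_ge0.
have rho0 : 0 < rho by rewrite invr_gt0 mulr_gt0.
have rho1 : rho <= 1.
  by rewrite invf_le1 ?mulr_gt0 //; have : 0 <= MM * b by [rewrite mulr_ge0]; lra.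
exists rho; first by rewrite rho0.
exists (2 * b + 1); first by rewrite ltr_wpDl // mulr_ge0.
move=> s X hs hX.
pose Rm := \matrix_(j < r) mxvec (expchart basisf j s *m basisf j *m expchartV basisf j s).
have EE : nm (Rm - Bb) <= MM * rho.
  rewrite nm_rows mulr_suml; apply: ler_sum => j _.
  rewrite linearB /= rowK -[row j Bb]vec_mxK -linearB nm_mxvec -basisfE.
  by case: (HM j) => _; apply => //; rewrite ltW // rho1.
have RmBp : Rm *m Bp = 1%:M + (Rm - Bb) *m Bp by rewrite mulmxBl BBp addrC subrK.
have hE : nm ((Rm - Bb) *m Bp) <= 2^-1.
  rewrite (le_trans (nmM _ _)) // (le_trans (ler_wpM2r b0 EE)) // /rho.
  rewrite mulrAC ler_pdivrMr ?mulr_gt0 //; lra.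
have Ru : Rm *m Bp \in unitmx by rewrite RmBp unit_near1.
have Rfree : row_free Rm.
  rewrite -kermx_eq0; apply/eqP/row_matrixP => i; rewrite row0.
  have : row i (kermx Rm) *m (Rm *m Bp) = 0.
    by rewrite mulmxA (_ : _ *m Rm = 0) ?mul0mx //; apply/sub_kermxP; exact: row_sub.
  by move/(canRL (mulmxK Ru)); rewrite mul0mx.
have RB : (Rm <= Bb)%MS.
  apply/row_subP => j; rewrite rowK; apply/hBb; apply: expchart_conj; exact: basisf_in.
have BR : (Bb <= Rm)%MS.
  by rewrite -(geq_leqif (mxrank_leqif_sup RB)) (eqP Bfree) (eqP Rfree).
have /submxP[w hw] : (mxvec X <= Rm)%MS by apply: submx_trans BR; apply/hBb.
exists (coordfun w); split.
  rewrite /expchart_dir big_mkord -[RHS]mxvecK hw mulmx_sum_row linear_sum; apply: eq_bigr => j _.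
  by rewrite coordfunE linearZ /= rowK mxvecK.
have nw : nm w <= 2 * b * nm X.
  have e1 : w *m (1%:M + (Rm - Bb) *m Bp) = mxvec X *m Bp by rewrite -RmBp mulmxA -hw.
  have e2 : w = mxvec X *m Bp - w *m ((Rm - Bb) *m Bp).
    by rewrite -e1 mulmxDr mulmx1 addrK.
  have h1 : nm w <= nm X * b + nm w * 2^-1.
    rewrite {1}e2 (le_trans (nmD _ _)) // nmN lerD //.
      by rewrite (le_trans (nmM _ _)) // nm_mxvec.
    by rewrite (le_trans (nmM _ _)) // ler_wpM2l ?nm_ge0.
  by rewrite -mulrA (mulrC b); have := nm_ge0 w; lra.
move=> i; have : nm w <= (2 * b + 1) * nm X by rewrite mulrDl mul1r ler_wpDr ?nm_ge0.
apply: le_trans; rewrite /coordfun; case: insubP => [j _ _|_]; first exact: nm_entry.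
by rewrite normc0 nm_ge0.
Qed.

(** Euler's method: k + 1 steps of size 1/(k + 1), each one a small change of the coordinates in the
    direction solving for [X], have a total error of order 1/k. The coordinates move by at most
    [c * nm X] in all. *)
Lemma euler_move : exists2 rho : R, 0 < rho <= 1 & exists2 c : R, 0 < c &
  forall (a : R) s X (eps : R), 0 < eps -> h X -> 0 <= a -> a + c * nm X <= rho ->
  (forall i, normc (s i) <= a) ->
  exists2 s', (forall i, normc (s' i) <= a + c * nm X) &
    nm (expm X *m bt s - bt s') < eps.
Proof.
have [rho /andP[rho0 rho1] [c c0 solve]] := expchart_dir_solve.
exists rho; first by rewrite rho0.
exists c => // a s X eps e0 hX a0 acx hs.
have [K K0 hK] := expchart_deriv basisf r; have [M M0 hM] := expchart_bound basisf r.
pose x := nm X; have x0 : 0 <= x := nm_ge0 _.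
have cx0 : 0 <= c * x by rewrite mulr_ge0 // ltW.
pose L := K + x ^+ 2 * expR x * M.
have L0 : 0 <= L by rewrite addr_ge0 // !mulr_ge0 ?exprn_ge0 ?expR_ge0.
pose y := x * (1 + x * expR x).
have y0 : 0 <= y by rewrite mulr_ge0 // addr_ge0 // mulr_ge0 ?expR_ge0.
have step k j : (j <= k.+1)%N -> exists2 sj : nat -> C,
   (forall i, normc (sj i) <= a + j%:R * harmonic k * (c * x)) &
   nm (expm ((mesh R k *: X) *+ j) *m bt s - bt sj) <=
     j%:R * (L * harmonic k ^+ 2) * (1 + y * harmonic k) ^+ j.
  elim: j => [|j IH] jk.
    exists s => [i|]; first by rewrite mul0r mul0r addr0.
    by rewrite mulr0n expm0 mul1mx subrr nm0 mul0r mul0r.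
  have [sj hsj hd] := IH (ltnW jk).
  have harm0 : 0 <= harmonic k :> R := harmonic_ge0 _.
  have jh : j.+1%:R * harmonic k <= 1 :> R.
    by rewrite /= ler_pdivrMr ?ltr0n // mul1r ler_nat.
  have jh' : j%:R * harmonic k <= 1 :> R.
    by apply: le_trans jh; rewrite ler_wpM2r // ler_nat.
  have sjr i : normc (sj i) <= rho.
    apply: le_trans (hsj i) (le_trans _ acx); rewrite lerD2l.
    by rewrite ler_piMl.
  have sj1 i : normc (sj i) <= 1 by exact: le_trans (sjr i) rho1.
  have [sg [hsg nsg]] := solve sj X sjr hX.
  have sg1 i : normc (sg i) <= 1.
    apply: le_trans (nsg i) (le_trans _ rho1); apply: le_trans acx.
    by rewrite lerDr.
  exists (fun i => sj i + mesh R k * sg i).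
    move=> i; apply: le_trans (normcD _ _) _; rewrite normcM normc_mesh.
    apply: (@le_trans _ _ (a + j%:R * harmonic k * (c * x) + harmonic k * (c * x))).
      by apply: lerD => //; rewrite ler_wpM2l.
    by rewrite -addrA -mulrDl -[j.+1%:R]natr1 (mulrDl _ 1) mul1r.
  pose D := expm ((mesh R k *: X) *+ j) *m bt s - bt sj; rewrite -/D in hd.
  pose E := expm (mesh R k *: X).
  have eE : expm ((mesh R k *: X) *+ j.+1) = E *m expm ((mesh R k *: X) *+ j).
    have cm : (mesh R k *: X) *m ((mesh R k *: X) *+ j) = ((mesh R k *: X) *+ j) *m (mesh R k *: X).
      move: (mesh R k *: X) => W; elim: (j) => [|i IHi]; first by rewrite mulr0n mulmx0 mul0mx.
      by rewrite mulrS mulmxDr mulmxDl IHi.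
    by rewrite mulrS (expmD cm).
  have hdX : nm (mesh R k *: X) = harmonic k * x by rewrite nmZ normc_mesh.
  have hdXx : harmonic k * x <= x by rewrite ler_piMl // -normc_mesh mesh_le1.
  have hE : nm (E - 1%:M) <= y * harmonic k.
    have := @expm1_le2 _ _ (mesh R k *: X) x; rewrite hdX => /(_ hdXx) H.
    by apply: le_trans H _; rewrite /y le_eqVlt; apply/orP; left; apply/eqP; ring.
  have hE2 : nm (E - 1%:M - mesh R k *: X) <= x ^+ 2 * expR x * harmonic k ^+ 2.
    apply: le_trans (expm_le2 _) _; rewrite hdX exprMn.
    apply: (@le_trans _ _ (harmonic k ^+ 2 * x ^+ 2 * expR x)).
      by rewrite ler_wpM2l ?mulr_ge0 ?exprn_ge0 // ler_expR.
    by rewrite -mulrA mulrC.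
  have [hbsj _] := hM sj sj1.
  have hK2 := hK (mesh R k) sj sg (mesh_le1 R k) sj1 sg1; rewrite hsg normc_mesh in hK2.
  set s2 := fun i => sj i + mesh R k * sg i in hK2 *.
  have split3 : expm ((mesh R k *: X) *+ j.+1) *m bt s - bt s2 =
     (D + (E - 1%:M) *m D) + ((E - 1%:M - mesh R k *: X) *m bt sj
      - (bt s2 - (1%:M + mesh R k *: X) *m bt sj)).
    rewrite eE /D; move: (expm ((mesh R k *: X) *+ j)) (bt s) (bt sj) (bt s2) => A1 A2 A3 A4.
    have aux (V : zmodType) (p q u v w t : V) :
       u - v = (p - q) + (u - t - (p - q)) + (t - q - w - (v - (q + w))).
      by rewrite (addrC (p - q)) subrK -(addrA t) -opprD opprB !subrKA.
    rewrite !mulmxBl !mulmxBr !mulmxDl !mul1mx -(mulmxA E); exact: aux.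
  rewrite split3; apply: le_trans (nmD _ _) _.
  have h1 : nm (D + (E - 1%:M) *m D) <= (1 + y * harmonic k) * nm D.
    rewrite mulrDl mul1r; apply: le_trans (nmD _ _) _; rewrite lerD2l.
    by apply: le_trans (nmM _ _) _; rewrite ler_wpM2r ?nm_ge0.
  have h2 : nm ((E - 1%:M - mesh R k *: X) *m bt sj
      - (bt s2 - (1%:M + mesh R k *: X) *m bt sj)) <= L * harmonic k ^+ 2.
    apply: le_trans (nmD _ _) _; rewrite nmN /L mulrDl addrC; apply: lerD => //.
    apply: le_trans (nmM _ _) _; rewrite mulrAC ler_pM ?nm_ge0 //.
  have yh0 : 0 <= y * harmonic k by rewrite mulr_ge0.
  apply: le_trans (lerD h1 h2) _.
  apply: (@le_trans _ _ ((1 + y * harmonic k) * (j%:R * (L * harmonic k ^+ 2) * (1 + y * harmonic k) ^+ j)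
     + L * harmonic k ^+ 2 * (1 + y * harmonic k) ^+ j.+1)).
    apply: lerD; first by rewrite ler_wpM2l // addr_ge0.
    by rewrite ler_peMr ?mulr_ge0 ?exprn_ge0 // exprn_ege1 // lerDl.
  rewrite (exprS _ j) -[j.+1%:R]natr1 le_eqVlt; apply/orP; left; apply/eqP.
  have aux2 (z p q w : R) : z * (w * q * p) + q * (z * p) = (w + 1) * q * (z * p) by ring.
  exact: aux2.
have [k hk] : exists k, L * expR y * harmonic k < eps.
  have : (fun k => L * expR y * harmonic k) @ \oo --> (L * expR y * 0 : R).
    by apply: cvgM; [exact: cvg_cst|exact: cvg_harmonic].
  rewrite mulr0 => /cvgrPdist_lt /(_ _ e0) [N _ HN]; exists N.
  have := HN N (leqnn N); rewrite /= sub0r normrN; apply: le_lt_trans; exact: ler_norm.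
have k0 : (k.+1%:R : R) != 0 by rewrite pnatr_eq0.
have [s' hs' hd] := step k k.+1 (leqnn _); exists s'.
  by move=> i; have := hs' i; rewrite /harmonic /= divff // mul1r.
move: hd; rewrite meshK => hd; apply: le_lt_trans hd _; apply: le_lt_trans hk.
apply: (@le_trans _ _ (k.+1%:R * (L * harmonic k ^+ 2) * expR y)).
  by rewrite ler_wpM2l ?mulr_ge0 ?exprn_ge0 ?harmonic_ge0 // one_plus_pow.
rewrite /harmonic /=; move: k0; set N := _%:R => k0.
by rewrite le_eqVlt; apply/orP; left; apply/eqP; field.
Qed.

(** One application of the previous lemma for each factor of a short product. *)
Lemma shortlim_chart : exists2 rho : R, 0 < rho <= 1 & exists2 c : R, 0 < c &
  forall (eta : R) g, c * eta <= rho -> shortlim h eta g -> forall eps : R, 0 < eps ->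
  exists2 s, (forall i, normc (s i) <= c * eta) & nm (g - bt s) < eps.
Proof.
have [rho hrho [c c0 H]] := euler_move; exists rho => //; exists c => //.
have chart_prod u (eps : R) : {in u, forall X, h X} -> c * len u <= rho -> 0 < eps ->
    exists2 s, (forall i, normc (s i) <= c * len u) & nm (prodexp u - bt s) < eps.
  elim: u eps => [|X u IH] eps hu hl e0.
    exists (fun=> 0) => [i|]; first by rewrite normc0 /len big_nil mulr0.
    have b0 k : expchart basisf k (fun=> 0) = 1%:M.
      by elim: k => //= k ->; rewrite scale0r expm0 mulmx1.
    by rewrite b0 /prodexp /= subrr nm0.
  have hX : h X by apply: hu; rewrite mem_head.
  have hu' : {in u, forall Y, h Y} by move=> Y Yu; apply: hu; rewrite inE Yu orbT.
  have eL : len (X :: u) = nm X + len u by rewrite /len big_cons.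
  have lu : c * len u <= rho.
    by apply: le_trans hl; rewrite ler_pM2l // eL lerDr nm_ge0.
  pose b := nm (expm X); have b0 : 0 <= b := nm_ge0 _.
  have e1 : 0 < eps / 2 / (b + 1) by rewrite !divr_gt0 // ltr_wpDl.
  have [s hs ns] := IH _ hu' lu e1.
  have e2 : 0 < eps / 2 by rewrite divr_gt0.
  have cl0 : 0 <= c * len u by rewrite mulr_ge0 ?len_ge0 // ltW.
  have clX : c * len u + c * nm X <= rho by rewrite -mulrDr addrC -eL.
  have [s' hs' ns'] := H _ s X _ e2 hX cl0 clX hs.
  exists s' => [i|]; first by rewrite eL mulrDr addrC.
  have -> : prodexp (X :: u) = expm X *m prodexp u by [].
  apply: le_lt_trans (nm_triB _ (expm X *m bt s) _) _; rewrite [eps]splitr.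
  apply: ler_ltD ns'; rewrite -mulmxBr; apply: le_trans (nmM _ _) _; rewrite -/b.
  apply: (@le_trans _ _ (b * (eps / 2 / (b + 1)))); first by rewrite ler_wpM2l // ltW.
  by rewrite mulrA ler_pdivrMr ?ltr_wpDl // mulrC ler_pM2l // lerDl.
move=> eta g ce [u [hu lu cu]] eps e0.
have e2 : 0 < eps / 2 by rewrite divr_gt0.
have [K hK] := mcvg_eventually cu e2; have := hK K (leqnn K) => nK.
have cl : c * len (u K) <= c * eta by rewrite ler_pM2l.
have [s hs ns] := chart_prod (u K) _ (hu K) (le_trans cl ce) e2.
exists s => [i|]; first exact: le_trans (hs i) cl.
apply: le_lt_trans (nm_triB _ (prodexp (u K)) _) _; rewrite [eps]splitr.
by apply: ltrD => //; rewrite nmB.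
Qed.

End Euler.

(** * The Lie algebra of an integral subgroup *)

Section Transversal.
Variable R : realType.
Local Notation C := (R[i]).
Variables (n : nat) (h : set 'M[C]_n) (hL : Lie_subalgebra h).
Variables (r : nat) (Bb : 'M[C]_(r, n * n)) (Bfree : row_free Bb).
Hypothesis hBb : forall X, h X <-> (mxvec X <= Bb)%MS.
Local Notation e := (basisf Bb).

Lemma expchart_ext (f : nat -> 'M[C]_n) k s s' : (forall i, (i < k)%N -> s i = s' i) ->
  expchart f k s = expchart f k s'.
Proof.
elim: k => [//|k IH] H.
have e1 : expchart f k s = expchart f k s' by apply: IH => i ik; apply: H; exact: ltnW.
by rewrite /= e1 (H k (ltnSn k)).
Qed.

Lemma expchart0 (f : nat -> 'M[C]_n) k : expchart f k (fun=> 0) = 1%:M.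
Proof. by elim: k => //= k ->; rewrite scale0r expm0 mulmx1. Qed.

Lemma expchartV0 (f : nat -> 'M[C]_n) k : expchartV f k (fun=> 0) = 1%:M.
Proof.
by have := expchartVK f k (fun=> 0); rewrite expchart0 mulmx1.
Qed.

(** To first order the difference is the linear combination of the basis of [h] and [Y] with
    coefficients [s] and [- tau]. As this family is free, the size of the combination is at least that
    of its coefficients up to a constant, and the quadratic error is negligible. *)
Lemma transversal Y : ~ h Y -> exists2 rho : R, 0 < rho & exists2 c : R, 0 < c &
  forall s tau, (forall i, normc (s i) <= rho) -> normc tau <= rho ->
  c * normc tau <= nm (expchart e r s - expm (tau *: Y)).
Proof.
move=> nhY; pose F := col_mx Bb (mxvec Y).
have Ffree : row_free F.
  rewrite /row_free eqn_leq rank_leq_row /= /F -addsmxE addn1.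
  rewrite -{1}(eqP Bfree); apply: rank_ltmx; rewrite /ltmx addsmxSl /=.
  by apply/negP => H; apply: nhY; apply/hBb; apply: submx_trans H; exact: addsmxSr.
(* coordinates in the free family [F] are bounded by [f] times the vector *)
pose f := nm (pinvmx F) + 1.
have f0 : 0 < f by rewrite ltr_wpDl ?nm_ge0.
have [K K0 hK] := expchart_deriv e r.
pose y := nm Y; have y0 : 0 <= y := nm_ge0 _.
pose K2 := K + y ^+ 2 * expR y.
have K20 : 0 <= K2 by rewrite addr_ge0 // mulr_ge0 ?exprn_ge0 ?expR_ge0.
have D0 : 0 < f * K2 + 1 by rewrite ltr_wpDl // mulr_ge0 // ltW.
have r0 : 0 < r.+1%:R :> R by rewrite ltr0n.
exists (r.+1%:R^-1 * (2 * (f * K2 + 1))^-1).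
  by rewrite mulr_gt0 ?invr_gt0 // mulr_gt0.
exists ((2 * f)^-1); first by rewrite invr_gt0 mulr_gt0.
set rho := _ * _ => s tau hs htau.
pose dl := \sum_(j < r) normc (s j) + normc tau.
have sdl0 : 0 <= \sum_(j < r) normc (s j) by apply: sumr_ge0 => j _; exact: normc_ge0.
have dl0 : 0 <= dl by rewrite addr_ge0 ?normc_ge0.
have tdl : normc tau <= dl by rewrite lerDr.
have dlr : dl <= (2 * (f * K2 + 1))^-1.
  apply: (@le_trans _ _ (r.+1%:R * rho)); last by rewrite /rho mulrA divff ?mul1r // lt0r_neq0.
  have e1 : r%:R * rho = \sum_(j < r) rho by rewrite sumr_const card_ord mulr_natl.
  rewrite -natr1 mulrDl mul1r e1 lerD //.
  by apply: ler_sum => j _; exact: hs.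
have dlr' : dl * (2 * (f * K2 + 1)) <= 1 by rewrite -ler_pdivlMr ?mulr_gt0 // mul1r.
have fK : 0 <= f * K2 by rewrite mulr_ge0 // ltW.
have dl1 : dl <= 1.
  by apply: le_trans dlr' ; rewrite ler_peMr //; lra.
have [dz|dnz] := eqVneq dl 0.
  have : normc tau = 0 by apply/eqP; rewrite eq_le normc_ge0 andbT -dz.
  by move=> ->; rewrite mulr0 nm_ge0.
pose S := \sum_(0 <= i < r) s i *: e i.
have hS : nm (expchart e r s - (1%:M + S)) <= K * dl ^+ 2.
  (* rescale the direction to have coordinates at most 1 and use the step [dl] *)
  pose dC : C := (dl%:C)%C.
  have ndC : normc dC = dl by rewrite normcR ger0_norm.
  have dC0 : dC != 0 by rewrite -(raddf0 (real_complex R)) (inj_eq (@complexI R)).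
  pose sg i := if (i < r)%N then s i / dC else 0.
  have sg1 i : normc (sg i) <= 1.
    rewrite /sg; case: ltnP => ir; last by rewrite normc0.
    rewrite normcM normcV ndC ler_pdivrMr ?lt_neqAle 1?eq_sym ?dnz // mul1r /dl.
    rewrite (bigD1 (Ordinal ir)) //= -addrA lerDl addr_ge0 ?normc_ge0 //.
    by apply: sumr_ge0 => j _; exact: normc_ge0.
  have ndC1 : normc dC <= 1 by rewrite ndC.
  have z1 (i : nat) : normc (0 : C) <= 1 by rewrite normc0.
  have := hK dC (fun=> 0) sg ndC1 z1 sg1; rewrite expchart0 mulmx1 ndC.
  have -> : expchart e r (fun i => 0 + dC * sg i) = expchart e r s.
    by apply: expchart_ext => i ir; rewrite add0r /sg ir mulrC divfK.
  have -> // : dC *: expchart_dir e r (fun=> 0) sg = S.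
  rewrite /expchart_dir scaler_sumr; apply: eq_big_nat => i /andP[_ ir].
  by rewrite expchart0 expchartV0 mul1mx mulmx1 scalerA /sg ir mulrC divfK.
have hT : nm (expm (tau *: Y) - 1%:M - tau *: Y) <= y ^+ 2 * expR y * dl ^+ 2.
  apply: le_trans (expm_le2 _) _; rewrite nmZ -/y exprMn.
  apply: (@le_trans _ _ (dl ^+ 2 * y ^+ 2 * expR y)); last by rewrite -mulrA mulrC.
  apply: ler_pM; rewrite ?mulr_ge0 ?exprn_ge0 ?normc_ge0 ?expR_ge0 //.
    by rewrite ler_wpM2r ?exprn_ge0 // lerXn2r ?nnegrE ?normc_ge0.
  by rewrite ler_expR ler_piMl // (le_trans tdl).
pose w := row_mx (\row_j s (j : 'I_r)) ((- tau)%:M : 'M[C]_1).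
have nw : nm w = dl.
  rewrite /nm big_ord1 big_split_ord /= /dl big_ord1; congr (_ + _).
    by apply: eq_bigr => j _; rewrite row_mxEl mxE.
  by rewrite row_mxEr mxE /= normcNE.
have wF : w *m F = mxvec (S - tau *: Y).
  rewrite mul_row_col linearB /= linearZ /= mul_scalar_mx scaleNr; congr (_ - _).
  rewrite mulmx_sum_row /S linear_sum big_mkord; apply: eq_bigr => j _.
  by rewrite linearZ /= basisfE vec_mxK mxE.
have h1 : dl <= nm (S - tau *: Y) * f.
  have -> : dl = nm (w *m F *m pinvmx F) by rewrite -mulmxA (mulmxVp Ffree) mulmx1 nw.
  rewrite (le_trans (nmM _ _)) // wF nm_mxvec ler_wpM2l ?nm_ge0 // /f lerDl //.
set Z := nm (expchart e r s - expm (tau *: Y)).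
have h2 : nm (S - tau *: Y) <= Z + K2 * dl ^+ 2.
  have -> : S - tau *: Y = (expchart e r s - expm (tau *: Y)) +
     ((expm (tau *: Y) - 1%:M - tau *: Y) - (expchart e r s - (1%:M + S))).
    have aux (V : zmodType) (a b t x o : V) : a - b = (x - t) + ((t - o - b) - (x - (o + a))).
      by rewrite -(addrA t) -opprD opprB addrA subrKA addrC subrKA opprD addrACA subrr add0r.
    exact: aux.
  apply: le_trans (nmD _ _) _; rewrite lerD2l; apply: le_trans (nmD _ _) _.
  by rewrite nmN /K2 mulrDl addrC lerD.
rewrite mulrC ler_pdivrMr ?mulr_gt0 //.
apply: le_trans tdl _.
have h3 : dl <= (Z + K2 * dl ^+ 2) * f by apply: le_trans h1 _; rewrite ler_wpM2r // ltW.
have h4 : f * K2 * dl * 2 <= 1 by move: dlr'; rewrite mulrDr mulrDr; lra.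
have h5 : f * K2 * dl ^+ 2 * 2 <= dl.
  by rewrite expr2 mulrA mulrAC -[leRHS]mul1r ler_wpM2r.
by move: h3; rewrite mulrDl; lra.
Qed.

End Transversal.

Section LieOfIntegral.
Variable R : realType.
Local Notation C := (R[i]).

(** Uncountably many parameters and a countable covering give a small nonzero multiple of [Y] whose
    exponential is a limit of short products. It is close to a point of the chart, and
    [transversal] forbids this if [Y] is not in [h]. *)
Theorem integral_Lie n (h : set 'M[C]_n) Y : Lie_subalgebra h ->
  (forall t : R, integral_subgroup h (expm ((t%:C)%C *: Y))) -> h Y.
Proof.
move=> hL HY; apply: contrapT => nhY.
have [B hB] := lin_matrix (Lie_lin hL).
pose Bb := row_base B.
have hBb X : h X <-> (mxvec X <= Bb)%MS by rewrite eq_row_base.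
have Bfree : row_free Bb := row_base_free B.
have [rho /andP[rho0 _] [c c0 chart]] := shortlim_chart hL Bfree hBb.
have [rho1 rho10 [c1 c10 trans]] := transversal Bfree hBb nhY.
pose m := Num.min rho rho1.
have m0 : 0 < m by rewrite lt_min rho0.
pose eta := m / (2 * c).
have eta0 : 0 < eta by rewrite divr_gt0 // mulr_gt0.
have ce : c * (eta + eta) = m by rewrite /eta; field; rewrite lt0r_neq0.
have [f hf] := boolp.choice (fun t : R => covering hL hB (HY t) eta0).
(* two parameters with the same element of the countable group *)
have [t [t' [ht ht' tt' ff]]] := pigeonhole_itv f rho10.
pose tau : C := ((t - t')%:C)%C.
have ntau : normc tau = `|t - t'| by rewrite normcR.
have short : shortlim h (eta + eta) (expm (tau *: Y)).
  have gu := ratprod_unit B (f t).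
  have s1 := hf t; have s2 := hf t'; rewrite -ff in s2.
  have pu : expm ((t'%:C)%C *: Y) *m invmx (ratprod B (f t)) \in unitmx.
    by rewrite unitmx_mul expm_unit unitmx_inv.
  have := shortlimM s1 (shortlimV (Lie_lin hL) pu s2).
  rewrite invmxM ?expm_unit ?unitmx_inv // invmxK expm_inv mulmxA mulmxKV // -expmD.
    by rewrite -scalerBl /tau rmorphB.
  by rewrite mulmxN mulNmx -!scalemxAl -!scalemxAr scalerA mulrC -scalerA.
have ntau0 : 0 < c1 * normc tau.
  by rewrite mulr_gt0 // ntau normr_gt0 subr_eq0; apply/eqP.
have cm : c * (eta + eta) <= rho by rewrite ce ge_min lexx.
have [s hs ns] := chart _ _ cm short _ ntau0.
have hs1 i : normc (s i) <= rho1 by apply: le_trans (hs i) _; rewrite ce ge_min lexx orbT.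
have ht1 : normc tau <= rho1.
  rewrite ntau ler_norml; move/andP: ht => [h1 h2]; move/andP: ht' => [h3 h4].
  by apply/andP; split; lra.
by have := trans s tau hs1 ht1; rewrite nmB leNgt ns.
Qed.

End LieOfIntegral.

(** * Diagonal matrices in a basis and the Jordan-Chevalley decomposition *)

Section DiagConj.
Variables (F : fieldType) (n : nat).
Implicit Types (P A : 'M[F]_n) (x y : 'rV[F]_n).

(** The matrix with the rows of [P] as eigenvectors and with eigenvalues [x]; all toral algebras are
    parametrized in this way. *)
Definition dg P x : 'M[F]_n := invmx P *m diag_mx x *m P.

Lemma dgM P x y : P \in unitmx -> dg P x *m dg P y = dg P (\row_j (x 0 j * y 0 j)).
Proof.
by move=> Pu; rewrite /dg -mulmx_diag !mulmxA mulmxK.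
Qed.

Lemma dg_comm P x y : P \in unitmx -> dg P x *m dg P y = dg P y *m dg P x.
Proof.
move=> Pu; rewrite !dgM //; congr dg; apply/rowP => j; by rewrite !mxE mulrC.
Qed.

Lemma dg_lin P a x y : dg P (a *: x + y) = a *: dg P x + dg P y.
Proof. by rewrite /dg linearP /= mulmxDr mulmxDl -scalemxAr -scalemxAl. Qed.

Lemma dg0 P : dg P 0 = 0.
Proof. by rewrite /dg linear0 mulmx0 mul0mx. Qed.

Lemma dgD P x y : dg P (x + y) = dg P x + dg P y.
Proof. by rewrite -[x]scale1r dg_lin !scale1r. Qed.

Lemma dgZ P a x : dg P (a *: x) = a *: dg P x.
Proof. by rewrite -[a *: x]addr0 dg_lin dg0 addr0. Qed.

Lemma dg_sum P (I : Type) (r : seq I) (G : I -> 'rV[F]_n) :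
  dg P (\sum_(i <- r) G i) = \sum_(i <- r) dg P (G i).
Proof. by elim/big_rec2: _ => [|i y1 y2 _ <-]; rewrite ?dg0 ?dgD. Qed.

Lemma dg_inj P x y : P \in unitmx -> dg P x = dg P y -> x = y.
Proof.
move=> Pu /(congr1 (fun A => P *m A *m invmx P)); rewrite /dg !mulmxA !mulmxK // mulmxV // !mul1mx.
by move/matrixP => e; apply/rowP => j; have := e j j; rewrite !mxE eqxx.
Qed.

Lemma char_poly_conj P A : P \in unitmx -> char_poly (invmx P *m A *m P) = char_poly A.
Proof.
move=> Pu; rewrite /char_poly /char_poly_mx.
have -> : 'X%:M - map_mx polyC (invmx P *m A *m P) =
   map_mx polyC (invmx P) *m ('X%:M - map_mx polyC A) *m map_mx polyC P.
  rewrite mulmxBr mulmxBl -!map_mxM; congr (_ - _).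
  rewrite scalar_mxC -mulmxA -map_mxM mulVmx // map_mx1 mulmx1 //.
rewrite !det_mulmx mulrC mulrA -det_mulmx -map_mxM mulmxV // map_mx1 det1 mul1r //.
Qed.

Lemma char_poly_dg P x : P \in unitmx -> char_poly (dg P x) = \prod_j ('X - (x 0 j)%:P).
Proof.
move=> Pu; rewrite char_poly_conj // char_poly_trig; last by rewrite diag_mx_is_trig.
by apply: eq_bigr => j _; rewrite mxE eqxx.
Qed.

(** The vector [x] lists the eigenvalues with multiplicity, so it is determined only up to a
    permutation. *)
Definition eigvals A x : Prop := char_poly A = \prod_j ('X - (x 0 j)%:P).

Lemma eigvals_perm A x y : eigvals A x -> eigvals A y -> exists s : {perm 'I_n}, y = \row_j x 0 (s j).
Proof.
move=> ex ey; have := prod_XsubC_eq.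
have e (z : 'rV[F]_n) : \prod_j ('X - (z 0 j)%:P) = \prod_(a <- [tuple z 0 j | j < n]) ('X - a%:P).
  by rewrite big_tuple; apply: eq_bigr => j _; rewrite tnth_mktuple.
move=> /(_ F [tuple y 0 j | j < n] [tuple x 0 j | j < n]); rewrite -!e -ex -ey => /(_ erefl).
move/tuple_permP => [s hs]; exists s; apply/rowP => j; rewrite mxE.
have := congr1 (fun t => nth 0 t j) hs; rewrite -!tnth_nth !tnth_mktuple.
by [].
Qed.

Lemma eigvals_reindex A x (s : {perm 'I_n}) : eigvals A x -> eigvals A (\row_j x 0 (s j)).
Proof.
rewrite /eigvals => ->; rewrite (reindex_inj (@perm_inj _ s)) /=.
by apply: eq_bigr => j _; rewrite mxE.
Qed.

Lemma interpolate (xs : seq F) (f : F -> F) : uniq xs ->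
  exists p : {poly F}, forall z : F, z \in xs -> p.[z] = f z.
Proof.
elim: xs => [|a xs IH] /=; first by exists 0.
case/andP => axs /IH [p hp]; pose q := \prod_(b <- xs) ('X - b%:P).
have qa : q.[a] != 0 by rewrite -rootE root_prod_XsubC.
exists (p + ((f a - p.[a]) / q.[a])%:P * q) => x; rewrite inE => /predU1P[->|xxs].
  by rewrite hornerD hornerM hornerC divfK // addrC subrK.
rewrite hornerD hornerM; have /rootP -> : root q x by rewrite root_prod_XsubC.
by rewrite mulr0 addr0 hp.
Qed.

(** The entries of [y] are a function of those of [x], hence a polynomial one. *)
Lemma interpolate_row x y : (forall i j, x 0 i = x 0 j -> y 0 i = y 0 j) ->
  exists p : {poly F}, forall j, p.[x 0 j] = y 0 j.
Proof.
move=> H; pose f a := if [pick j | x 0 j == a] is Some j then y 0 j else 0.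
have [p hp] := @interpolate (undup [seq x 0 j | j <- enum 'I_n]) f (undup_uniq _).
exists p => j; rewrite hp; last by rewrite mem_undup map_f // mem_enum.
by rewrite /f; case: pickP => [i /eqP /H //|/(_ j)]; rewrite eqxx.
Qed.

End DiagConj.

Section Horner.
Variables (F : fieldType) (n' : nat).
Local Notation n := n'.+1.
Implicit Types (P A : 'M[F]_n) (x y : 'rV[F]_n).

Lemma horner_dg P x p : P \in unitmx -> horner_mx (dg P x) p = dg P (map_mx (horner p) x).
Proof.
move=> Pu; have Pu' : invmx P \is a GRing.unit by move: Pu; rewrite -unitmx_inv.
by rewrite /dg -{2 4}[P]invmxK horner_mx_uconj // horner_mx_diag.
Qed.

Lemma horner_dg_sub P x y : P \in unitmx -> (forall i j, x 0 i = x 0 j -> y 0 i = y 0 j) ->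
  exists p, dg P y = horner_mx (dg P x) p.
Proof.
move=> Pu /interpolate_row [p hp]; exists p; rewrite horner_dg //.
by congr dg; apply/rowP => j; rewrite mxE hp.
Qed.

Lemma horner_mx_comm A B p : A *m B = B *m A -> horner_mx A p *m B = B *m horner_mx A p.
Proof. by move=> AB; apply: comm_horner_mx. Qed.

End Horner.

Section Jordan.
Variables (F : numClosedFieldType) (n' : nat).
Local Notation n := n'.+1.
Implicit Types (P A : 'M[F]_n).

(** Chinese remainders: [s] is constant to high order at each of the points. *)
Lemma crt_XsubC (rs : seq F) k : uniq rs ->
  exists s : {poly F}, forall a, a \in rs -> ('X - a%:P) ^+ k %| s - a%:P.
Proof.
elim: rs => [|a rs IH] /=; first by exists 0.
case/andP => ars urs; have [s hs] := IH urs.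
pose Q := \prod_(b <- rs) ('X - b%:P) ^+ k.
have cop : coprimep Q (('X - a%:P) ^+ k).
  rewrite /Q big_seq; apply: (big_ind (fun q => coprimep q _)); rewrite ?coprime1p //.
    by move=> p q hp hq; rewrite coprimepMl hp.
  move=> b brs; apply/coprimep_expl/coprimep_expr.
  by rewrite coprimep_XsubC root_XsubC; apply: contraNneq ars => ->.
have [[u v] /= uv] := Bezout_eq1_coprimepP _ _ cop.
exists (s + Q * (u * (a%:P - s))) => b; rewrite inE => /predU1P[->|bin].
  have -> : s + Q * (u * (a%:P - s)) - a%:P = (s - a%:P) * v * ('X - a%:P) ^+ k.
    by rewrite -mulrA -[v * _](addKr (u * Q)) uv; ring.
  exact: dvdp_mull.
rewrite addrAC dvdp_add ?hs // dvdp_mulr // /Q (perm_big _ (perm_to_rem bin)) big_cons.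
exact: dvdp_mulr.
Qed.

Lemma trig_mul_diag (A B : 'M[F]_n) i : is_trig_mx A -> is_trig_mx B ->
  (A *m B) i i = A i i * B i i.
Proof.
move=> /is_trig_mxP hA /is_trig_mxP hB; rewrite mxE (bigD1 i) //= big1 ?addr0 // => j ji.
have [ij|] := ltnP i j; first by rewrite hA ?mul0r.
by rewrite leq_eqVlt (inj_eq val_inj) (negbTE ji) /= => ?; rewrite hB ?mulr0.
Qed.

Lemma trig_expr_diag (A : 'M[F]_n) i k : is_trig_mx A ->
  is_trig_mx (A ^+ k) /\ (A ^+ k) i i = A i i ^+ k.
Proof.
move=> tA; elim: k => [|k [tk IH]].
  by rewrite !expr0 mxE eqxx; split=> //; exact: scalar_mx_is_trig.
rewrite !exprS -mulmxE trig_mul_diag // IH; split=> //.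
apply/is_trig_mxP => j l jl; rewrite mxE big1 // => m _.
have [jm|mj] := ltnP j m; first by rewrite (elimT is_trig_mxP tA) ?mul0r.
by rewrite (elimT is_trig_mxP tk) ?mulr0 // (leq_ltn_trans mj).
Qed.

(** Commuting matrices are triangularized simultaneously, and the diagonal of the nilpotent one is 0. *)
Lemma char_poly_nilp (S N : 'M[F]_n) k : S *m N = N *m S -> N ^+ k = 0 ->
  char_poly (S + N) = char_poly S.
Proof.
move=> SN Nk; have [P Pun /andP[tS tN]] := cotrigonalization2 SN.
have Pu : P \in unitmx by exact: unitarymx_unit.
have cE (A : 'M[F]_n) : char_poly A = char_poly (conjmx P A).
  rewrite conjumx // -{1}[P]invmxK char_poly_conj ?unitmx_inv //.
rewrite cE [RHS]cE; have eD : conjmx P (S + N) = conjmx P S + conjmx P N.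
  by rewrite !conjumx // mulmxDr mulmxDl.
have N0 i : conjmx P N i i = 0.
  have [_] := trig_expr_diag i k tN.
  have -> : conjmx P N ^+ k = conjmx P (N ^+ k).
    elim: (k) => [|l IH]; first by rewrite !expr0 !conjumx // mulmx1 mulmxV.
    rewrite !exprS IH -!mulmxE !conjumx // !mulmxA mulmxKV //.
  by rewrite Nk conjmx0 mxE => /esym /eqP; rewrite expf_eq0 => /andP[_ /eqP].
have tSN : is_trig_mx (conjmx P (S + N)).
  by rewrite eD; apply/is_trig_mxP => i j ij; rewrite mxE (elimT is_trig_mxP tS) // (elimT is_trig_mxP tN) // addr0.
rewrite !char_poly_trig //; apply: eq_bigr => i _.
by rewrite eD mxE N0 addr0.
Qed.

(** Evaluated at [A], a polynomial that is congruent to a modulo (X - a)^n for every eigenvalue a gives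
    the semisimple part. *)
Theorem jordan_chevalley (A : 'M[F]_n) : exists P (l : 'rV[F]_n) (s : {poly F}),
  [/\ P \in unitmx, horner_mx A s = dg P l, (A - dg P l) ^+ n = 0 & eigvals A l].
Proof.
have [rs0 hrs0] := closed_field_poly_normal (char_poly A).
rewrite (monicP (char_poly_monic A)) scale1r in hrs0.
have size_rs0 : size rs0 = n.
  by apply/eqP; rewrite -eqSS -(size_char_poly A) hrs0 size_prod_XsubC.
pose rs := undup rs0; have urs : uniq rs := undup_uniq _.
have [s hs] := crt_XsubC n urs.
have dvd : char_poly A %| \prod_(a <- rs) ('X - a%:P) ^+ n.
  rewrite prodrXl hrs0 -[in X in _ ^+ X]size_rs0.
  have : {subset rs0 <= rs} by move=> z; rewrite mem_undup.
  elim: (rs0) => [|z t IH] ht; first by rewrite big_nil expr0 dvdpp.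
  rewrite big_cons exprS dvdp_mul //; last by apply: IH => y yt; apply: ht; rewrite inE yt orbT.
  by rewrite dvdp_XsubCl root_prod_XsubC ht // mem_head.
have hornerA q : char_poly A %| q -> horner_mx A q = 0.
  by move=> /dvdpP[t ->]; rewrite rmorphM /= Cayley_Hamilton mulr0.
pose S := horner_mx A s.
have diagS : diagonalizable S.
  apply/diagonalizableP; exists rs => //; apply: mxminpoly_min.
  rewrite rmorph_prod /=.
  have -> : \prod_(a <- rs) horner_mx S ('X - a%:P) = horner_mx A (\prod_(a <- rs) (s - a%:P)).
    rewrite rmorph_prod; apply: eq_bigr => a _.
    by rewrite !rmorphB /= horner_mx_X !horner_mx_C.
  apply: hornerA; apply: dvdp_trans dvd _.
  elim: (rs) (hs) => [|a t IH] H; first by rewrite !big_nil dvdpp.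
  rewrite !big_cons dvdp_mul ?H ?mem_head //.
  by apply: IH => y yt; apply: H; rewrite inE yt orbT.
have [P Pu Pd] := diagS; have [l hl] := elimT (similar_diagLR Pu) Pd; exists P, l, s.
have eS : S = dg P l by rewrite hl conjumx ?unitmx_inv // invmxK.
have N0 : (A - S) ^+ n = 0.
  have -> : A - S = horner_mx A ('X - s) by rewrite rmorphB /= horner_mx_X.
  rewrite -rmorphXn; apply: hornerA; apply: dvdp_trans dvd _.
  rewrite prodrXl dvdp_exp2r //; apply: uniq_roots_dvdp; last by rewrite uniq_rootsE.
  apply/allP => a ain; rewrite rootE hornerD hornerN hornerX subr_eq0 eq_sym.
  have := hs a ain; move/(dvdp_trans (dvdp_exp2l _ (ltn0Sn n'))).
  by rewrite expr1 dvdp_XsubCl rootE hornerD hornerN hornerC subr_eq0.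
split; rewrite -?eS //.
have SA : S *m A = A *m S by apply: horner_mx_comm.
have SN : S *m (A - S) = (A - S) *m S by rewrite mulmxBr mulmxBl SA.
rewrite /eigvals -[A in char_poly A](subrK S) addrC (char_poly_nilp SN N0) eS.
exact: char_poly_dg.
Qed.

End Jordan.

(** * Rational toral algebras *)

Section RatHull.
Variables (F : numFieldType) (n : nat).
Implicit Types (K L : 'M[rat]_n) (x l : 'rV[F]_n).
Local Notation "K ^F" := (map_mx (ratr : rat -> F) K) (at level 2).

Definition rat_hull l K : Prop :=
  (l <= K ^F)%MS /\ forall K', (l <= K' ^F)%MS -> (K <= K')%MS.

(** Rational subspaces are stable under intersection. *)
Lemma rat_hull_ex l : exists K, rat_hull l K.
Proof.
pose P r := `[< exists K, \rank K = r /\ (l <= K ^F)%MS >].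
have exP : exists r, P r.
  exists (\rank (1%:M : 'M[rat]_n)); apply/asboolP; exists 1%:M; split=> //.
  by rewrite map_mx1 submx1.
have [r /asboolP [K [rK lK]] minr] := ex_minnP exP.
exists K; split=> // K' lK'.
have : P (\rank (K :&: K')%MS).
  apply/asboolP; exists (K :&: K')%MS; split=> //.
  by rewrite map_capmx sub_capmx lK.
move/minr; rewrite -rK => h.
have e : (K <= K :&: K')%MS by rewrite -(geq_leqif (mxrank_leqif_sup (capmxSl K K'))).
exact: submx_trans e (capmxSr _ _).
Qed.

(** The solutions of a rational equation form a rational subspace. *)
Lemma hull_relation l K (m : 'cV[rat]_n) x : rat_hull l K -> l *m m ^F = 0 ->
  (x <= K ^F)%MS -> x *m m ^F = 0.
Proof.
move=> [_ hK] lm xK.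
have : (l <= (kermx m) ^F)%MS by rewrite map_kermx; apply/sub_kermxP.
move/hK => Km; have : (x <= (kermx m) ^F)%MS by apply: submx_trans xK _; rewrite map_submx.
by rewrite map_kermx => /sub_kermxP ->.
Qed.

Lemma hull_eq l K x i j : rat_hull l K -> (x <= K ^F)%MS -> l 0 i = l 0 j -> x 0 i = x 0 j.
Proof.
move=> hK xK lij; pose m : 'cV[rat]_n := delta_mx i 0 - delta_mx j 0.
have e y : y *m m ^F = (y 0 i - y 0 j)%:M.
  rewrite /m map_mxB !map_delta_mx mulmxBr -!colE.
  by apply/matrixP => a b; rewrite !ord1 !mxE eqxx.
have := @hull_relation l K m x hK; rewrite !e lij subrr => /(_ _ xK).
have z : (0 : F)%:M = 0 :> 'M[F]_1 by exact: raddf0.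
move=> /(_ z) /matrixP /(_ 0 0); rewrite !mxE eqxx => /eqP.
by rewrite mulr1n subr_eq0 => /eqP.
Qed.

(** Rationality of [K] is what makes the exponential of this algebra an algebraic group. *)
Definition toral (P : 'M[F]_n) K : set 'M[F]_n := [set dg P x | x in [set x | (x <= K ^F)%MS]].

Lemma toral_comm P K a b : P \in unitmx -> toral P K a -> toral P K b -> a *m b = b *m a.
Proof. by move=> Pu [x _ <-] [y _ <-]; exact: dg_comm. Qed.

Lemma toral_lin P K : toral P K 0 /\ forall a X Y, toral P K X -> toral P K Y -> toral P K (a *: X + Y).
Proof.
split; first by exists 0; [exact: sub0mx|exact: dg0].
move=> a _ _ [x hx <-] [y hy <-]; exists (a *: x + y); last exact: dg_lin.
by rewrite /= addmx_sub // scalemx_sub.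
Qed.

Lemma toral_Lie P K : P \in unitmx -> Lie_subalgebra (toral P K).
Proof.
move=> Pu; have [h0 hl] := toral_lin P K; split=> // X Y hX hY.
by rewrite (toral_comm Pu hX hY) subrr.
Qed.

(** The complex dimension of [toral P K] is the rank of the rational matrix [K]. *)
Lemma toral_rank_le P K Q L : P \in unitmx -> Q \in unitmx ->
  toral P K `<=` toral Q L -> (\rank L <= \rank K)%N -> toral Q L `<=` toral P K.
Proof.
move=> Pu Qu sub rk.
have hex i : exists y, (y <= L ^F)%MS /\ dg Q y = dg P (row i K ^F).
  have [y yL e] : toral Q L (dg P (row i K ^F)) by apply: sub; exists (row i K ^F) => //=; exact: row_sub.
  by exists y.
have [f hf] := fin_all_exists hex.
pose T := \matrix_i f i.
have TL : (T <= L ^F)%MS by apply/row_subP => i; rewrite rowK; case: (hf i).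
have eT (w : 'rV[F]_n) : dg Q (w *m T) = dg P (w *m K ^F).
  rewrite !mulmx_sum_row !dg_sum; apply: eq_bigr => i _.
  by rewrite !dgZ rowK; case: (hf i) => _ ->.
have kerT : (kermx T <= kermx K ^F)%MS.
  apply/row_subP => i; apply/sub_kermxP; apply: (dg_inj Pu); rewrite -eT dg0.
  have -> : row i (kermx T) *m T = 0 by apply/sub_kermxP; exact: row_sub.
  exact: dg0.
have rT : (\rank K <= \rank T)%N.
  have := mxrankS kerT; rewrite !mxrank_ker mxrank_map.
  by have := rank_leq_row T; have := rank_leq_row K; lia.
have LT : (L ^F <= T)%MS.
  by rewrite -(geq_leqif (mxrank_leqif_sup TL)) mxrank_map (leq_trans rk).
move=> _ [y yL <-]; have /submxP[w ->] := submx_trans yL LT.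
by exists (w *m K ^F); [exact: submxMl|rewrite eT].
Qed.

Lemma rat_sum (K S L T : 'M[rat]_n) :
  (map_mx ratr (K *m S + L *m T)%MS :=: K ^F *m S ^F + L ^F *m T ^F)%MS.
Proof. by rewrite -!map_mxM; exact: map_addsmx. Qed.

End RatHull.

Section Avoid.
Variable R : realType.
Local Notation C := (R[i]).
Local Notation "K ^F" := (map_mx (ratr : rat -> C) K) (at level 2).

(** Countably many polynomials have countably many roots, and the real line is uncountable. *)
Lemma avoid_roots (T : countType) (p : T -> {poly C}) : (forall t, p t != 0) ->
  exists u : R, forall t, ~~ root (p t) (u%:C)%C.
Proof.
move=> p0; apply: contrapT => H.
have hex (u : R) : exists t, root (p t) (u%:C)%C.
  apply: contrapT => nt; apply: H; exists u => t; apply/negP => r; apply: nt; by exists t.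
have [f hf] := boolp.choice hex.
have hrs t : exists rs : seq C, p t = lead_coef (p t) *: \prod_(z <- rs) ('X - z%:P).
  by have [rs] := closed_field_poly_normal (p t); exists rs.
have [g hg] := boolp.choice hrs.
have mem u : (u%:C)%C \in g (f u).
  have := hf u; rewrite hg rootZ ?root_prod_XsubC // lead_coef_eq0; exact: p0.
pose k (u : R) := (f u, index (u%:C)%C (g (f u))).
have [u [u' [_ _ uu' e]]] := @pigeonhole_itv R _ k 1 ltr01.
apply: uu'; case: e => ef ei; apply: (@complexI R).
by rewrite -(nth_index 0 (mem u)) ei ef nth_index // -?ef.
Qed.

(** On the curve (1, u, u^2, ...) a nonzero linear form is a nonzero polynomial in u. *)
Lemma moment_poly k (d : 'cV[C]_k) : d != 0 ->
  exists2 p : {poly C}, p != 0 & forall u, p.[u] = ((\row_j u ^+ j) *m d) 0 0.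
Proof.
move=> d0; pose p := \poly_(j < k) (if insub j is Some i then d (i : 'I_k) 0 else 0).
exists p.
  apply: contraNneq d0 => pz; apply/eqP/matrixP => i j; rewrite ord1 mxE.
  by have := congr1 (fun q : {poly C} => q`_i) pz; rewrite coef_poly ltn_ord valK coef0.
move=> u; rewrite horner_poly mxE; apply: eq_bigr => i _.
by rewrite valK mxE mulrC.
Qed.

Lemma avoid_kernels k (T : countType) (d : T -> 'cV[C]_k) : (forall t, d t != 0) ->
  exists w : 'rV[C]_k, forall t, w *m d t != 0.
Proof.
move=> d0; have hex t := moment_poly (d0 t).
have [p hp] : exists p : T -> {poly C}, forall t, p t != 0 /\
    forall u, (p t).[u] = ((\row_j u ^+ j) *m d t) 0 0.
  have /boolp.choice[p hp] : forall t, exists p : {poly C}, p != 0 /\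
      forall u, p.[u] = ((\row_j u ^+ j) *m d t) 0 0.
    by move=> t; have [p p0 e] := hex t; exists p.
  by exists p.
have [u hu] := avoid_roots (fun t => proj1 (hp t)).
exists (\row_j (u%:C)%C ^+ j) => t; apply: contraNneq (hu t) => e.
by apply/rootP; rewrite (proj2 (hp t)) e mxE.
Qed.

(** A vector space is not a finite union of proper subspaces. *)
Lemma union_kernels k (I : finType) (d : I -> 'cV[C]_k) :
  (forall w : 'rV[C]_k, exists i, w *m d i = 0) -> exists i, d i = 0.
Proof.
move=> H; apply: contrapT => nd.
have d0 i : d i != 0 by apply/eqP => e; apply: nd; exists i.
have [w hw] := avoid_kernels d0; have [i e] := H w.
by have := hw i; rewrite e eqxx.
Qed.

Variable n : nat.
Implicit Types (P Q U : 'M[C]_n) (K L : 'M[rat]_n).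

(** In the second basis, each eigenvalue of the elements of the family is, element by element, one of
    the eigenvalues in the first basis. By [union_kernels] it is always the same one, so passing from
    one basis to the other selects columns of [K] and preserves rationality. *)
Lemma eigenbasis_change P U K (a : 'M[C]_n) : P \in unitmx -> U \in unitmx ->
  (forall i, dg P (row i K ^F) = dg U (row i a)) -> exists S : 'M[rat]_n, a = K ^F *m S ^F.
Proof.
move=> Pu Uu H.
have e (w : 'rV[C]_n) : dg P (w *m K ^F) = dg U (w *m a).
  rewrite !mulmx_sum_row !dg_sum; apply: eq_bigr => i _; by rewrite !dgZ H.
have hcol j : exists i, col j a = col i K ^F.
  have [i /eqP] : exists i : 'I_n, col j a - col i K ^F = 0.
    apply: union_kernels => w.
    have e1 : eigvals (dg U (w *m a)) (w *m K ^F) by rewrite -e; exact: char_poly_dg.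
    have [s hs] := eigvals_perm e1 (char_poly_dg _ Uu).
    exists (s j); rewrite mulmxBr !colE !mulmxA -!colE hs.
    by apply/matrixP => x y; rewrite !ord1 !mxE subrr.
  by rewrite subr_eq0 => /eqP ei; exists i.
have [s hs] := fin_all_exists hcol.
exists (\matrix_(k, j) (k == s j)%:R); apply/matrixP => i j.
have /matrixP /(_ i 0) := hs j; rewrite !mxE => ->.
rewrite (bigD1 (s j)) //= big1 ?addr0 => [|k ks]; rewrite !mxE ?eqxx ?rmorph1 ?mulr1 //.
by rewrite (negbTE ks) rmorph0 mulr0.
Qed.

(** All the elements are diagonal in a common basis, in which both spaces of eigenvalues are still
    rational by [eigenbasis_change]. *)
Lemma toral_sum P K Q L : P \in unitmx -> Q \in unitmx ->
  (forall a b, toral P K a -> toral Q L b -> a *m b = b *m a) ->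
  exists U M, [/\ U \in unitmx, toral P K `<=` toral U M, toral Q L `<=` toral U M &
    forall c, toral U M c -> exists a b, [/\ toral P K a, toral Q L b & c = a + b]].
Proof.
move=> Pu Qu cm.
pose f i := dg P (row i K ^F); pose g i := dg Q (row i L ^F).
have tf i : toral P K (f i) by exists (row i K ^F) => //=; exact: row_sub.
have tg i : toral Q L (g i) by exists (row i L ^F) => //=; exact: row_sub.
pose fs := [seq f i | i <- enum 'I_n] ++ [seq g i | i <- enum 'I_n].
have [U Uu /allP hU] : exists2 U, U \in unitmx & all [pred A | similar_diag U A] fs.
  apply/codiagonalizableP; split.
    move=> A B; rewrite !mem_cat => /orP[] /mapP[i _ ->] /orP[] /mapP[j _ ->];
      rewrite /comm_mx.
    - exact: (toral_comm Pu (tf i) (tf j)).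
    - exact: cm.
    - by apply/esym; exact: cm.
    - exact: (toral_comm Qu (tg i) (tg j)).
  have dd V x : V \in unitmx -> diagonalizable (dg V x).
    by move=> Vu; exists V => //; apply/similar_diagLR => //; exists x; rewrite conjumx ?unitmx_inv // invmxK.
  by move=> A; rewrite mem_cat => /orP[] /mapP[i _ ->]; exact: dd.
have hD A : A \in fs -> exists x, A = dg U x.
  move=> /hU /= /(similar_diagLR Uu) [x ->]; exists x.
  by rewrite conjumx ?unitmx_inv // invmxK.
have hfa i : exists x, f i = dg U x.
  apply: hD; rewrite mem_cat; apply/orP; left; apply: map_f; exact: mem_enum.
have hgb i : exists x, g i = dg U x.
  apply: hD; rewrite mem_cat; apply/orP; right; apply: map_f; exact: mem_enum.
have [fa ha] := fin_all_exists hfa; have [gb hb] := fin_all_exists hgb.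
have [S hS] : exists S : 'M[rat]_n, \matrix_i fa i = K ^F *m S ^F.
  by apply: (eigenbasis_change Pu Uu) => i; rewrite rowK -ha.
have [T hT] : exists T : 'M[rat]_n, \matrix_i gb i = L ^F *m T ^F.
  by apply: (eigenbasis_change Qu Uu) => i; rewrite rowK -hb.
have ea (w : 'rV[C]_n) : dg P (w *m K ^F) = dg U (w *m (K ^F *m S ^F)).
  rewrite -hS !mulmx_sum_row !dg_sum; apply: eq_bigr => i _.
  by rewrite !dgZ rowK -ha.
have eb (w : 'rV[C]_n) : dg Q (w *m L ^F) = dg U (w *m (L ^F *m T ^F)).
  rewrite -hT !mulmx_sum_row !dg_sum; apply: eq_bigr => i _.
  by rewrite !dgZ rowK -hb.
exists U, (K *m S + L *m T)%MS.
have eM := rat_sum C K S L T.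
split=> //.
- move=> _ [x /submxP[w ->] <-]; rewrite ea; exists (w *m (K ^F *m S ^F)) => //=.
  by rewrite eM (submx_trans (submxMl _ _)) // addsmxSl.
- move=> _ [x /submxP[w ->] <-]; rewrite eb; exists (w *m (L ^F *m T ^F)) => //=.
  by rewrite eM (submx_trans (submxMl _ _)) // addsmxSr.
move=> _ [x /= xM <-]; move: xM; rewrite eM => /sub_addsmxP[[w1 w2] /= ->].
exists (dg P (w1 *m K ^F)), (dg Q (w2 *m L ^F)); split.
- by exists (w1 *m K ^F) => //=; exact: submxMl.
- by exists (w2 *m L ^F) => //=; exact: submxMl.
by rewrite ea eb dgD.
Qed.

End Avoid.

(** * Polynomial and regular functions on matrices *)

Section ClosedClass.
Variables (F : fieldType) (T : Type) (Phi : (T -> F) -> Prop).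
Hypotheses (Pc : forall c, Phi (fun=> c))
  (PD : forall f g, Phi f -> Phi g -> Phi (fun t => f t + g t))
  (PM : forall f g, Phi f -> Phi g -> Phi (fun t => f t * g t)).

Lemma closed_sum (I : Type) (r : seq I) (f : I -> T -> F) :
  (forall i, Phi (f i)) -> Phi (fun t => \sum_(i <- r) f i t).
Proof.
move=> Hf; elim: r => [|i r IH].
  by rewrite (_ : (fun _ => _) = fun=> 0) //; apply/funext => t; rewrite big_nil.
rewrite (_ : (fun _ => _) = fun t => f i t + \sum_(i <- r) f i t); first exact: PD.
by apply/funext => t; rewrite big_cons.
Qed.

Lemma closed_prod (I : Type) (r : seq I) (f : I -> T -> F) :
  (forall i, Phi (f i)) -> Phi (fun t => \prod_(i <- r) f i t).
Proof.
move=> Hf; elim: r => [|i r IH].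
  by rewrite (_ : (fun _ => _) = fun=> 1) //; apply/funext => t; rewrite big_nil.
rewrite (_ : (fun _ => _) = fun t => f i t * \prod_(i <- r) f i t); first exact: PM.
by apply/funext => t; rewrite big_cons.
Qed.

Lemma closed_exp (f : T -> F) k : Phi f -> Phi (fun t => f t ^+ k).
Proof.
move=> Hf; elim: k => [|k IH].
  by rewrite (_ : (fun _ => _) = fun=> 1) //; apply/funext => t; rewrite expr0.
rewrite (_ : (fun _ => _) = fun t => f t * f t ^+ k); first exact: PM.
by apply/funext => t; rewrite exprS.
Qed.

Lemma closed_meval m (v : T -> 'I_m -> F) (p : mpoly.mpoly m F) :
  (forall i, Phi (fun t => v t i)) -> Phi (fun t => mpoly.meval (v t) p).
Proof.
move=> Hv; apply: closed_sum => k; apply: PM; first exact: Pc.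
by apply: closed_prod => i; exact: closed_exp.
Qed.

(** A class of functions containing the constants and closed under sums and products contains the
    values of a polynomial at matrices with entries in the class. *)
Lemma closed_mx_eval m (M : T -> 'M[F]_m) p :
  (forall i j, Phi (fun t => M t i j)) -> Phi (fun t => mx_eval p (M t)).
Proof.
move=> HM; apply: closed_meval => i.
case/mxvec_indexP: i => i j; rewrite (_ : (fun _ => _) = fun t => M t i j) //.
by apply/funext => t; rewrite mxvecE.
Qed.

End ClosedClass.

Section PolyFun.
Variables (F : fieldType) (m : nat).
Implicit Types (A : 'M[F]_m) (phi psi : 'M[F]_m -> F).

Definition polyfun phi : Prop := exists p : mpoly.mpoly (m * m) F, forall A, phi A = mx_eval p A.

Lemma polyfun_cst c : polyfun (fun=> c).
Proof. by exists (mpoly.mpolyC (m * m) c) => A; rewrite /mx_eval mpoly.mevalC. Qed.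

Lemma polyfun_entry i j : polyfun (fun A => A i j).
Proof.
exists (mpoly.mpolyX F (mpoly.mnm1 (mxvec_index i j))) => A.
by rewrite /mx_eval mpoly.mevalXU mxvecE.
Qed.

Lemma polyfunD phi psi : polyfun phi -> polyfun psi -> polyfun (fun A => phi A + psi A).
Proof.
by move=> [p hp] [q hq]; exists (p + q) => A; rewrite hp hq /mx_eval mpoly.mevalD.
Qed.

Lemma polyfunM phi psi : polyfun phi -> polyfun psi -> polyfun (fun A => phi A * psi A).
Proof.
by move=> [p hp] [q hq]; exists (p * q) => A; rewrite hp hq /mx_eval mpoly.mevalM.
Qed.

Lemma polyfun_ext phi psi : phi =1 psi -> polyfun phi -> polyfun psi.
Proof. by move=> e [p hp]; exists p => A; rewrite -e hp. Qed.

Lemma polyfun_det k (M : 'M[F]_m -> 'M[F]_k) :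
  (forall i j, polyfun (fun A => M A i j)) -> polyfun (fun A => \det (M A)).
Proof.
move=> H; apply: (closed_sum polyfun_cst polyfunD) => s; apply: polyfunM; first exact: polyfun_cst.
by apply: (closed_prod polyfun_cst polyfunM) => i; exact: H.
Qed.

Lemma polyfun_mul k l (P : 'M[F]_(k, m)) (Q : 'M[F]_(m, l)) i j :
  polyfun (fun A => (P *m A *m Q) i j).
Proof.
apply: (@polyfun_ext (fun A => \sum_b (\sum_a P i a * A a b) * Q b j)).
  by move=> A; rewrite mxE; apply: eq_bigr => b _; rewrite mxE.
apply: (closed_sum polyfun_cst polyfunD) => b; apply: polyfunM (polyfun_cst _).
by apply: (closed_sum polyfun_cst polyfunD) => a; apply: polyfunM (polyfun_cst _) (polyfun_entry _ _).
Qed.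

Definition regfun (H : set 'M[F]_m) phi : Prop :=
  exists (p : mpoly.mpoly (m * m) F) (k : nat),
    forall A, H A -> phi A = mx_eval p A / \det A ^+ k.

Variable H : set 'M[F]_m.
Hypothesis Hu : forall A, H A -> A \in unitmx.

Lemma det_neq0 A : H A -> \det A != 0.
Proof. by move/Hu; rewrite unitmxE unitfE. Qed.

Lemma regfun_poly phi : polyfun phi -> regfun H phi.
Proof. by move=> [p hp]; exists p, 0%N => A _; rewrite expr0 divr1. Qed.

Lemma regfun_polydiv phi k : polyfun phi -> regfun H (fun A => phi A / \det A ^+ k).
Proof. by move=> [p hp]; exists p, k => A _; rewrite hp. Qed.

Lemma polyfun_detA : polyfun (fun A => \det A).
Proof. by apply: polyfun_det => i j; exact: polyfun_entry. Qed.

Lemma regfun_ext phi psi : (forall A, H A -> phi A = psi A) -> regfun H phi -> regfun H psi.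
Proof. by move=> e [p [k hp]]; exists p, k => A HA; rewrite -e // hp. Qed.

Lemma regfunM phi psi : regfun H phi -> regfun H psi -> regfun H (fun A => phi A * psi A).
Proof.
move=> [p [k hp]] [q [l hq]].
have pq : polyfun (fun A => mx_eval p A * mx_eval q A) by apply: polyfunM; eexists.
apply: regfun_ext (regfun_polydiv (k + l) pq) => A HA.
by rewrite hp // hq // exprD invfM mulrACA.
Qed.

Lemma regfunD phi psi : regfun H phi -> regfun H psi -> regfun H (fun A => phi A + psi A).
Proof.
move=> [p [k hp]] [q [l hq]].
have pq : polyfun (fun A => mx_eval p A * \det A ^+ l + mx_eval q A * \det A ^+ k).
  by apply: polyfunD; apply: polyfunM; first [by eexists | apply: (closed_exp polyfun_cst polyfunM); exact: polyfun_detA].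
apply: regfun_ext (regfun_polydiv (k + l) pq) => A HA.
have d0 := det_neq0 HA; rewrite hp // hq // mulrDl exprD invfM.
have dk : \det A ^+ k != 0 by rewrite expf_neq0.
have dl : \det A ^+ l != 0 by rewrite expf_neq0.
by congr (_ + _); rewrite -mulrA; congr (_ * _); [rewrite mulrCA divff ?mulr1|rewrite mulrA divff ?mul1r].
Qed.

Lemma regfun_cst c : regfun H (fun=> c).
Proof. exact: regfun_poly (polyfun_cst _). Qed.

Lemma regfun_exprz phi psi (z : int) : regfun H phi -> regfun H psi ->
  (forall A, H A -> phi A * psi A = 1) -> regfun H (fun A => phi A ^ z).
Proof.
move=> h1 h2 e; case: z => k; first exact: (closed_exp regfun_cst regfunM).
apply: regfun_ext (closed_exp regfun_cst regfunM k.+1 h2) => A HA.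
have p0 : phi A != 0.
  by apply/eqP => p0; have := e A HA; rewrite p0 mul0r => /esym/eqP; rewrite oner_eq0.
by rewrite NegzE -exprnN; apply: (mulfI (expf_neq0 k.+1 p0));
  rewrite -exprMn e // expr1n divff // expf_neq0.
Qed.

(** Cramer's formula. *)
Lemma regfun_inv i j : regfun H (fun A => (invmx A) i j).
Proof.
have pc : polyfun (fun A => (\adj A) i j).
  apply: (@polyfun_ext (fun A => (-1) ^+ (j + i) * \det (row' j (col' i A)))).
    by move=> A; rewrite mxE.
  apply: polyfunM; first exact: polyfun_cst.
  apply: polyfun_det => a b; apply: (polyfun_ext _ (polyfun_entry (lift j a) (lift i b))).
  by move=> A; rewrite !mxE.
apply: regfun_ext (regfun_polydiv 1 pc) => A HA.
have -> : invmx A = (\det A)^-1 *: \adj A by rewrite /invmx (Hu HA).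
move: (\adj A) (\det A) => B d; by rewrite mxE expr1 mulrC.
Qed.

Lemma regfun_mulinv k l (P : 'M[F]_(k, m)) (Q : 'M[F]_(m, l)) i j :
  regfun H (fun A => (P *m invmx A *m Q) i j).
Proof.
apply: (@regfun_ext (fun A => \sum_b (\sum_a P i a * (invmx A) a b) * Q b j)).
  by move=> A _; rewrite mxE; apply: eq_bigr => b _; rewrite mxE.
apply: (closed_sum regfun_cst regfunD) => b; apply: regfunM (regfun_cst _).
by apply: (closed_sum regfun_cst regfunD) => a; apply: regfunM (regfun_cst _) (regfun_inv _ _).
Qed.

End PolyFun.

(** * Exponentials of rational toral algebras are tori *)

Section ToralGroup.
Variables (R : realType) (n : nat).
Local Notation C := (R[i]).
Local Notation "K ^F" := (map_mx (ratr : rat -> C) K) (at level 2).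
Implicit Types (P : 'M[C]_n) (K : 'M[rat]_n) (x : 'rV[C]_n).

Lemma expm_dg P x : P \in unitmx -> expm (dg P x) = dg P (map_mx (@cexp R) x).
Proof. by move=> Pu; rewrite /dg (expm_conj _ Pu) expm_diag. Qed.

(** The algebra is commutative, so that the exponentials already form a group. *)
Lemma integral_toral P K : P \in unitmx ->
  integral_subgroup (toral P K) = (@expm _ n) @` (toral P K).
Proof.
move=> Pu; have hh := toral_lin P K; apply/seteqP; split; last first.
  by move=> _ [X hX <-]; exact: integral_exp.
apply: integral_min => [|X hX]; last by exists X.
split.
- by move=> _ [X _ <-]; exact: expm_unit.
- by exists 0; [case: hh|exact: expm0].
- move=> _ _ [X hX <-] [Y hY <-]; exists (X + Y); first exact: lin_closedD.
  by apply: expmD; exact: toral_comm hX hY.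
- by move=> _ [X hX <-]; exists (- X); [exact: lin_closedN|rewrite expm_inv].
Qed.

(** The Smith normal form of an integer matrix with the same row space. *)
Lemma rat_smith K : exists (U : 'M[int]_n) (I : {set 'I_n}), U \in unitmx /\
  forall x : 'rV[C]_n, (x <= K ^F)%MS <-> exists2 s : 'rV[C]_n,
    (forall i, i \notin I -> s 0 i = 0) & x = s *m map_mx intr U.
Proof.
(* a common denominator of the entries *)
pose D := \prod_(p : 'I_n * 'I_n) denq (K p.1 p.2).
pose KI : 'M[int]_n := \matrix_(i, j) (numq (K i j) * \prod_(p | p != (i, j)) denq (K p.1 p.2)).
have D0 : (D%:~R : C) != 0.
  by rewrite intr_eq0; apply/prodf_neq0 => p _; exact: denq_neq0.
have eKI : map_mx intr KI = (D%:~R : C) *: K ^F.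
  apply/matrixP => i j.
  have eD : D = denq (K i j) * \prod_(p | p != (i, j)) denq (K p.1 p.2).
    by rewrite /D (bigD1 (i, j)).
  rewrite !mxE eD; set q := \prod_(p | _) _; rewrite !intrM.
  rewrite [RHS]mulrAC; congr (_ * _).
  by rewrite /ratr mulrC divfK // intr_eq0 denq_neq0.
have [L Lu [U Uu [d _ eLDU]]] := int_Smith_normal_form KI.
have unitC (M : 'M[int]_n) : M \in unitmx -> map_mx intr M \in (unitmx : {pred 'M[C]_n}).
  by rewrite !unitmxE det_map_mx; exact: rmorph_unit.
pose DC : 'M[C]_n := map_mx intr (\matrix_(i, j) (d`_i *+ (i == j :> nat))).
have eC : map_mx intr KI = map_mx intr L *m DC *m map_mx intr U :> 'M[C]_n.
  by rewrite eLDU !map_mxM.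
exists U, [set i : 'I_n | d`_i != 0]%SET; split=> // x.
have wD (w : 'rV[C]_n) i : (w *m DC) 0 i = w 0 i * (d`_i)%:~R.
  rewrite mxE (bigD1 i) //= big1 ?addr0 => [|j ji]; first by rewrite !mxE eqxx mulr1n.
  move: ji; rewrite -(inj_eq val_inj) !mxE => /negbTE /= ->.
  by rewrite mulr0n mulr0.
have eq1 : (x <= K ^F)%MS = (x <= (map_mx intr KI : 'M[C]_n))%MS.
  by rewrite eKI (eqmx_scale _ D0).
rewrite eq1 eC; split.
  move=> /submxP[w ->]; exists (w *m map_mx intr L *m DC); last by rewrite !mulmxA.
  by move=> i; rewrite inE negbK => /eqP di; rewrite wD di mulr0.
move=> [s hs ->]; pose w := \row_i (s 0 i / (d`_i)%:~R).
have -> : s = w *m DC.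
  apply/rowP => i; rewrite wD mxE; have [di|di] := eqVneq d`_i 0.
    by rewrite hs ?inE ?di ?eqxx // mulr0.
  by rewrite divfK // intr_eq0.
have -> : w = w *m invmx (map_mx intr L) *m map_mx intr L by rewrite mulmxKV // unitC.
by apply/submxP; exists (w *m invmx (map_mx intr L)); rewrite !mulmxA.
Qed.

Lemma cexp_row_mul m (s : 'rV[C]_m) (U : 'M[int]_(m, n)) j :
  cexp ((s *m map_mx intr U) 0 j) = \prod_i cexp (s 0 i) ^ (U i j).
Proof.
rewrite mxE cexp_sum; apply: eq_bigr => i _.
by rewrite mxE mulrzr cexp_intmul.
Qed.

Lemma cexp_surj_row (y : 'rV[C]_n) : (forall j, y 0 j != 0) ->
  exists x : 'rV[C]_n, map_mx (@cexp R) x = y.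
Proof.
move=> y0; have [x hx] := fin_all_exists (fun j => cexp_surj (y0 j)).
by exists (\row_j x j); apply/rowP => j; rewrite !mxE.
Qed.

End ToralGroup.

Section ToralTorus.
Variables (R : realType) (n : nat).
Local Notation C := (R[i]).
Local Notation "K ^F" := (map_mx (ratr : rat -> C) K) (at level 2).
Variables (P : 'M[C]_n) (K : 'M[rat]_n) (Pu : P \in unitmx).

Lemma diag_torusP r (A : 'M[C]_r) : diagonal_torus A ->
  exists t : 'rV[C]_r, A = diag_mx (map_mx (@cexp R) t).
Proof.
move=> [Au /is_diag_mxP Ad].
have eA : A = diag_mx (\row_j A j j).
  apply/matrixP => i j; rewrite !mxE; case: eqP => [->|/eqP ij]; first by rewrite mulr1n.
  by rewrite mulr0n Ad.
have dA : \det A = \prod_j A j j.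
  by rewrite [in LHS]eA det_diag; apply: eq_bigr => j _; rewrite mxE.
have A0 j : (\row_j A j j) 0 j != 0.
  by move: Au; rewrite unitmxE dA unitfE mxE => /prodf_neq0 H; exact: H.
by have [t ht] := cexp_surj_row A0; exists t; rewrite ht.
Qed.

Lemma diag_cexp_torus r (t : 'rV[C]_r) : @diagonal_torus C r (diag_mx (map_mx (@cexp R) t)).
Proof.
split; last exact: diag_mx_is_diag.
rewrite unitmxE det_diag unitfE; apply/prodf_neq0 => j _; rewrite mxE; exact: cexp_neq0.
Qed.

(** In the basis given by [rat_smith], the exponential consists of the matrices whose eigenvalues are
    monomials in free coordinates indexed by [I], and the inverse unimodular matrix expresses these
    coordinates as monomials in the eigenvalues. This is the isomorphism with a diagonal torus, and
    the equations are the off-diagonal entries and the monomials that must be equal to 1. *)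
Theorem toral_torus : algebraic_torus ((@expm _ n) @` (toral P K)).
Proof.
have [U [I [Uu hK]]] := rat_smith R K.
set S := _ @` _.
have SGL : GL_subgroup S by rewrite /S -integral_toral //; exact: integral_GL.
pose UC : 'M[C]_n := map_mx intr U.
pose W := invmx U; pose WC : 'M[C]_n := map_mx intr W.
have UW : UC *m WC = 1%:M by rewrite -map_mxM mulmxV // map_mx1.
have WU : WC *m UC = 1%:M by rewrite -map_mxM mulVmx // map_mx1.
have Sform A : S A <-> exists2 s : 'rV[C]_n, (forall i, i \notin I -> s 0 i = 0) &
    A = dg P (map_mx (@cexp R) (s *m UC)).
  split; first by move=> [_ [x /= /hK [s hs ->] <-] <-]; exists s; rewrite ?expm_dg.
  move=> [s hs ->]; exists (dg P (s *m UC)); last by rewrite expm_dg.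
  by exists (s *m UC) => //=; apply/hK; exists s.
pose dd (A : 'M[C]_n) j := (P *m A *m invmx P) j j.
have dgK x : P *m dg P x *m invmx P = diag_mx x.
  by rewrite /dg !mulmxA mulmxV // mul1mx mulmxK.
have ddE x j : dd (dg P x) j = x 0 j by rewrite /dd dgK mxE eqxx mulr1n.
have Su A : S A -> A \in unitmx by case: SGL => H _ _ _; exact: H.
have Ddiag r (A : 'M[C]_r) : diagonal_torus A -> A \in unitmx by move=> [].
split; last first.
  pose r := #|I|; exists r.
  pose ext (t : 'rV[C]_r) : 'rV[C]_n := \row_i (if [pick a : 'I_r | enum_val a == i] is Some a then t 0 a else 0).
  have extE t (a : 'I_r) : ext t 0 (enum_val a) = t 0 a.
    rewrite mxE; case: pickP => [b /eqP /enum_val_inj -> //|/(_ a)]; by rewrite eqxx.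
  have ext0 t i : i \notin I -> ext t 0 i = 0.
    move=> iI; rewrite mxE; case: pickP => // a /eqP e; move: iI; rewrite -e enum_valP //.
  pose res (s : 'rV[C]_n) : 'rV[C]_r := \row_a s 0 (enum_val a).
  have resK (s : 'rV[C]_n) : (forall i, i \notin I -> s 0 i = 0) -> ext (res s) = s.
    move=> hs; apply/rowP => i; have [iI|iI] := boolP (i \in I); last by rewrite ext0 // hs.
    by rewrite -(enum_rankK_in iI iI) extE mxE.
  have extK (t : 'rV[C]_r) : res (ext t) = t by apply/rowP => a; rewrite mxE extE.
  pose f (A : 'M[C]_r) := dg P (\row_j \prod_a (A a a) ^ (U (enum_val a) j)).
  pose g (B : 'M[C]_n) : 'M[C]_r := diag_mx (\row_a \prod_j (dd B j) ^ (W j (enum_val a))).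
  have fE (t : 'rV[C]_r) : f (diag_mx (map_mx (@cexp R) t)) = dg P (map_mx (@cexp R) (ext t *m UC)).
    congr dg; apply/rowP => j; rewrite [LHS]mxE [RHS]mxE cexp_row_mul.
    rewrite [RHS](bigID (mem I)) /= [X in _ * X]big1 ?mulr1 => [|i iI].
      transitivity (\prod_(a < r) cexp (ext t 0 (enum_val a)) ^ U (enum_val a) j).
        by apply: eq_bigr => a _; rewrite extE !mxE eqxx mulr1n.
      by symmetry; exact: (@big_enum_val _ _ _ _ (mem I) (fun i => cexp (ext t 0 i) ^ U i j)).
    by rewrite ext0 // cexp0 exp1rz.
  have gE (s : 'rV[C]_n) : (forall i, i \notin I -> s 0 i = 0) ->
     g (dg P (map_mx (@cexp R) (s *m UC))) = diag_mx (map_mx (@cexp R) (res s)).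
    move=> hs; congr diag_mx; apply/rowP => a; rewrite [LHS]mxE [RHS]mxE [res s 0 a]mxE.
    transitivity (cexp ((s *m UC *m WC) 0 (enum_val a))); last by rewrite -mulmxA UW mulmx1.
    by rewrite cexp_row_mul; apply: eq_bigr => j _; rewrite ddE mxE.
  exists f, g; split.
  - split=> i j.
      have rz a z : regfun (@diagonal_torus C r) (fun A => (A a a) ^ z).
        apply: (@regfun_exprz _ _ _ (fun A => A a a) (fun A => (invmx A) a a)).
        - by apply: regfun_poly; exact: polyfun_entry.
        - exact: (regfun_inv (Ddiag r)).
        - move=> A [Au /is_diag_mxP Ad]; have /matrixP /(_ a a) := mulmxV Au.
          rewrite mxE (bigD1 a) //= big1 ?addr0 => [|b ba]; first by rewrite mxE eqxx.
          by rewrite Ad ?mul0r // eq_sym.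
      apply: (@regfun_ext _ _ _ (fun A => \sum_k
        (invmx P i k * \prod_a (A a a) ^ (U (enum_val a) k)) * P k j)).
        move=> A _; rewrite /f /dg mxE; apply: eq_bigr => k _; congr (_ * _).
        by rewrite mul_mx_diag !mxE.
      apply: (closed_sum (@regfun_cst _ _ _) (regfunD (Ddiag r))) => k; apply: (regfunM _ (regfun_cst _ _)).
      by apply: (regfunM (regfun_cst _ _)); apply: (closed_prod (@regfun_cst _ _ _) (@regfunM _ _ _)) => a; exact: rz.
    have rz k z : regfun S (fun A => (dd A k) ^ z).
      apply: (@regfun_exprz _ _ _ (fun A => dd A k) (fun A => (P *m invmx A *m invmx P) k k)).
      - by apply: regfun_poly; exact: polyfun_mul.
      - exact: (regfun_mulinv Su).
      - move=> A SA; have Au := Su A SA; have [s hs eA] := (Sform A).1 SA.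
        have e1 : (P *m A *m invmx P) *m (P *m invmx A *m invmx P) = 1%:M.
          by rewrite !mulmxA mulmxKV // -(mulmxA P A) mulmxV // mulmx1 mulmxV.
        move/matrixP: e1 => /(_ k k); rewrite /dd {1 3}eA dgK => e1.
        move: e1; rewrite mxE (bigD1 k) //= big1 ?addr0 => [|b bk]; first by rewrite [X in _ = X -> _]mxE eqxx.
        by rewrite [X in X * _]mxE eq_sym (negbTE bk) mulr0n mul0r.
    have [->|ij] := eqVneq i j; last first.
      apply: (@regfun_ext _ _ _ (fun=> 0)); last exact: regfun_cst.
      by move=> A _; rewrite mxE (negbTE ij) mulr0n.
    apply: (@regfun_ext _ _ _ (fun A => \prod_l (dd A l) ^ (W l (enum_val j)))).
      by move=> A _; rewrite !mxE eqxx mulr1n.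
    by apply: (closed_prod (@regfun_cst _ _ _) (@regfunM _ _ _)) => l; exact: rz.
  - split=> [A /diag_torusP [t ->]|B /Sform [s hs ->]].
      by apply/Sform; exists (ext t); [exact: ext0|exact: fE].
    by rewrite gE //; exact: diag_cexp_torus.
  - split=> [A /diag_torusP [t ->]|B /Sform [s hs ->]].
      by rewrite (fE t) (gE _ (ext0 t)) extK.
    by rewrite (gE _ hs) (fE (res s)) (resK _ hs).
  - move=> A A' [_ /is_diag_mxP dA] [_ /is_diag_mxP dA']; rewrite /f (dgM _ _ Pu).
    congr dg; apply/rowP => j; rewrite !mxE -big_split /=; apply: eq_bigr => a _.
    rewrite mxE (bigD1 a) //= big1 ?addr0 => [|b ba]; first by rewrite expfzMl.
    by rewrite dA ?mul0r // eq_sym.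
split=> //; exists [set p | forall A, S A -> mx_eval p A = 0].
apply/seteqP; split=> [A SA|A [Au hA]] /=.
  by split=> [|p hp]; [exact: Su|exact: hp].
have vanish phi : polyfun phi -> (forall B, S B -> phi B = 0) -> phi A = 0.
  by move=> [p hp] h0; rewrite hp; apply: hA => B SB; rewrite -hp h0.
have off i j : i != j -> (P *m A *m invmx P) i j = 0.
  move=> ij; apply: (vanish (fun A => (P *m A *m invmx P) i j)) (polyfun_mul _ _ _ _) _.
  by move=> B /Sform [s hs ->]; rewrite dgK mxE (negbTE ij) mulr0n.
pose d : 'rV[C]_n := \row_j dd A j.
have eD : P *m A *m invmx P = diag_mx d.
  apply/matrixP => i j; rewrite !mxE; have [->|ij] := eqVneq i j; first by rewrite mulr1n /dd mxE.
  by have := off i j ij; rewrite mxE => ->; rewrite mulr0n.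
have eA : A = dg P d by rewrite /dg -eD !mulmxA mulVmx // mul1mx mulmxKV.
have d0 j : d 0 j != 0.
  have : P *m A *m invmx P \in unitmx by rewrite !unitmx_mul Pu Au unitmx_inv Pu.
  by rewrite eD unitmxE det_diag unitfE => /prodf_neq0 H; exact: H.
(* a monomial relation is made polynomial by separating positive and negative exponents *)
pose zp (z : int) := if z is Posz k then k else 0%N.
pose zn (z : int) := if z is Negz k then k.+1 else 0%N.
have zE (y : C) z : y != 0 -> y ^ z = y ^+ zp z / y ^+ zn z.
  by move=> y0; case: z => k /=; rewrite ?expr0 ?divr1 ?mul1r // NegzE -exprnN.
have rel i : i \notin I -> \prod_j d 0 j ^ (W j i) = 1.
  move=> iI.
  pose phi B := \prod_j dd B j ^+ zp (W j i) + (-1) * \prod_j dd B j ^+ zn (W j i).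
  have zprod (y : 'rV[C]_n) : (forall j, y 0 j != 0) ->
      \prod_j y 0 j ^ (W j i) = (\prod_j y 0 j ^+ zp (W j i)) / \prod_j y 0 j ^+ zn (W j i).
    by move=> y0; rewrite -prodf_div; apply: eq_bigr => j _; rewrite zE.
  have pp : polyfun phi.
    have pd (e : 'I_n -> nat) : polyfun (fun B => \prod_j dd B j ^+ e j).
      apply: (closed_prod (@polyfun_cst _ _) (@polyfunM _ _)) => j.
      by apply: (closed_exp (@polyfun_cst _ _) (@polyfunM _ _)); exact: polyfun_mul.
    apply: polyfunD (pd _) _; apply: polyfunM (pd _); exact: polyfun_cst.
  have phi0 : phi A = 0.
    apply: vanish pp _ => B /Sform [s hs ->].
    have : \prod_j (map_mx (@cexp R) (s *m UC)) 0 j ^ (W j i) = 1.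
      have e1 : \prod_j cexp ((s *m UC) 0 j) ^ (W j i) = 1.
        by rewrite -cexp_row_mul -mulmxA UW mulmx1 hs // cexp0.
      by rewrite -[RHS]e1; apply: eq_bigr => j _; rewrite mxE.
    rewrite zprod => [|j]; last by rewrite mxE cexp_neq0.
    have n0 : \prod_j (map_mx (@cexp R) (s *m UC)) 0 j ^+ zn (W j i) != 0.
      by apply/prodf_neq0 => j _; rewrite expf_neq0 // mxE cexp_neq0.
    move=> /(canRL (divfK n0)); rewrite mul1r => e1.
    rewrite /phi; under eq_bigr do rewrite ddE.
    by under [X in _ + _ * X]eq_bigr do rewrite ddE; rewrite e1 mulN1r subrr.
  rewrite zprod //; move/eqP: phi0; rewrite /phi mulN1r subr_eq0 => /eqP e1.
  have ed j : d 0 j = dd A j by rewrite mxE.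
  under eq_bigr do rewrite ed.
  under [X in _ / X]eq_bigr do rewrite ed.
  rewrite e1 divff //; apply/prodf_neq0 => j _; rewrite -ed expf_neq0 //; exact: d0.
have [x hx] := cexp_surj_row d0.
pose s' := x *m WC; pose s : 'rV[C]_n := \row_i (if i \in I then s' 0 i else 0).
apply/Sform; exists s => [i iI|]; first by rewrite mxE (negbTE iI).
rewrite eA; congr dg; apply/rowP => j; rewrite [RHS]mxE cexp_row_mul.
transitivity (cexp ((s' *m UC) 0 j)); first by rewrite -mulmxA WU mulmx1 -hx mxE.
have es i : cexp (s 0 i) = cexp (s' 0 i).
  have -> : s 0 i = if i \in I then s' 0 i else 0 by rewrite mxE.
  case: (boolP (i \in I)) => [_|iI]; first by [].
  rewrite cexp0 cexp_row_mul -[LHS](rel i iI).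
  by apply: eq_bigr => l _; rewrite -hx mxE.
rewrite cexp_row_mul; apply: eq_bigr => i _; by rewrite es.
Qed.

End ToralTorus.

(** * Tori are exponentials of rational toral algebras *)

Section TorusToral.
Variables (R : realType) (n' : nat).
Local Notation n := n'.+1.
Local Notation C := (R[i]).
Local Notation "K ^F" := (map_mx (ratr : rat -> C) K) (at level 2).

Lemma poly_vanish (q : {poly C}) : (forall y, y != 0 -> q.[y] = 0) -> q = 0.
Proof.
move=> h; apply/eqP; apply: contraT => q0.
have X0 : forall t : unit, 'X * q != 0 by rewrite mulf_neq0 // polyX_eq0.
have [u /(_ tt)] := avoid_roots X0; rewrite rootE hornerM hornerX.
have [->|u0] := eqVneq ((u%:C)%C : C) 0; first by rewrite mul0r eqxx.
by rewrite h // mulr0 eqxx.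
Qed.

Lemma mat_coefs d (B : nat -> 'M[C]_n) :
  (forall y, y != 0 -> \sum_(l < d) y ^+ l *: B l = 0) -> forall l, (l < d)%N -> B l = 0.
Proof.
move=> h l ld; apply/matrixP => i j.
have q0 : \poly_(l < d) B l i j = 0.
  apply: poly_vanish => y y0; rewrite horner_poly.
  have /matrixP /(_ i j) := h y y0; rewrite summxE mxE => e; rewrite -[RHS]e.
  by apply: eq_bigr => k _; rewrite mxE mulrC.
by have := congr1 (fun q : {poly C} => q`_l) q0; rewrite coef_poly ld coef0 mxE.
Qed.

Lemma mat_coefs2 d e (B : nat -> nat -> 'M[C]_n) :
  (forall y z, y != 0 -> z != 0 -> \sum_(l < d) \sum_(k < e) (y ^+ l * z ^+ k) *: B l k = 0) ->
  forall l k, (l < d)%N -> (k < e)%N -> B l k = 0.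
Proof.
move=> h l k ld ke.
apply: (mat_coefs (d := e) (B := B l)) ke => z z0.
apply: (mat_coefs (d := d) (B := fun l => \sum_(k < e) z ^+ k *: B l k)) ld => y y0.
rewrite -[RHS](h y z y0 z0); apply: eq_bigr => i _; rewrite scaler_sumr.
by apply: eq_bigr => j _; rewrite scalerA.
Qed.

(** The expansion [h y = y ^- k * \sum_l y ^+ l *: E l], with the denominator cleared. *)
Definition laurent (h : C -> 'M[C]_n) k d (E : nat -> 'M[C]_n) : Prop :=
  forall y, y != 0 -> y ^+ k *: h y = \sum_(l < d) y ^+ l *: E l.

Lemma laurent_ex (h : C -> 'M[C]_n) :
  (forall i j, exists (q : {poly C}) k, forall y, y != 0 -> h y i j = q.[y] / y ^+ k) ->
  exists k d E, laurent h k d E.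
Proof.
move=> H.
have /boolp.choice[f hf] : forall p : 'I_n * 'I_n, exists qk : {poly C} * nat,
    forall y, y != 0 -> h y p.1 p.2 = qk.1.[y] / y ^+ qk.2.
  by move=> [i j]; have [q [k hk]] := H i j; exists (q, k).
pose k := (\sum_p (f p).2)%N.
have fk p : ((f p).2 <= k)%N by rewrite /k (bigD1 p) //= leq_addr.
pose Q p := (f p).1 * 'X^(k - (f p).2).
pose d := (\sum_p size (Q p))%N.
have sd p : (size (Q p) <= d)%N by rewrite /d (bigD1 p) //= leq_addr.
exists k, d, (fun l => \matrix_(i, j) (Q (i, j))`_l) => y y0.
apply/matrixP => i j; rewrite summxE mxE (hf (i, j) y y0).
transitivity (Q (i, j)).[y].
  rewrite hornerM hornerXn mulrCA; congr (_ * _).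
  by rewrite -[in LHS](subnK (fk (i, j))) exprD mulfK // expf_neq0.
by rewrite (horner_coef_wide _ (sd (i, j))); apply: eq_bigr => l _; rewrite !mxE mulrC.
Qed.

(** Compare the coefficients in h(yz) = h(y) h(z): the coefficients of [h] are orthogonal idempotents. *)
Lemma laurent_idem (h : C -> 'M[C]_n) k d E : laurent h k d E ->
  (forall y z, y != 0 -> z != 0 -> h (y * z) = h y *m h z) ->
  forall l m, (l < d)%N -> (m < d)%N -> E l *m E m = if l == m then E l else 0.
Proof.
move=> hE hM l m ld md; apply/eqP; rewrite -subr_eq0; apply/eqP.
apply: (mat_coefs2 (d := d) (e := d)
  (B := fun l m => E l *m E m - if l == m then E l else 0)) ld md => y z y0 z0.
have := hE _ (mulf_neq0 y0 z0).
rewrite hM // exprMn -scalerA scalemxAr scalemxAl !hE // => e.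
transitivity ((\sum_(l < d) y ^+ l *: E l) *m (\sum_(l < d) z ^+ l *: E l) -
   \sum_(l < d) (y * z) ^+ l *: E l); last by apply/eqP; rewrite subr_eq0; apply/eqP.
rewrite mulmx_suml -sumrB; apply: eq_bigr => i _; rewrite mulmx_sumr.
have -> : (y * z) ^+ i *: E i = \sum_(j < d) (y ^+ i * z ^+ j) *: (if i == j :> nat then E i else 0).
  rewrite (bigD1 i) //= eqxx big1 ?addr0 ?exprMn // => j ji.
  by rewrite eq_sym (inj_eq val_inj) (negbTE ji) scaler0.
rewrite -sumrB; apply: eq_bigr => j _.
by rewrite scalerBr -scalemxAl -scalemxAr scalerA.
Qed.

Lemma laurent_comm (h h' : C -> 'M[C]_n) k k' d d' E E' :
  laurent h k d E -> laurent h' k' d' E' ->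
  (forall y z, y != 0 -> z != 0 -> h y *m h' z = h' z *m h y) ->
  forall l m, (l < d)%N -> (m < d')%N -> E l *m E' m = E' m *m E l.
Proof.
move=> hE hE' cm l m ld md; apply/eqP; rewrite -subr_eq0; apply/eqP.
apply: (mat_coefs2 (d := d) (e := d') (B := fun l m => E l *m E' m - E' m *m E l)) ld md => y z y0 z0.
transitivity ((\sum_(l < d) y ^+ l *: E l) *m (\sum_(l < d') z ^+ l *: E' l) -
   (\sum_(l < d') z ^+ l *: E' l) *m (\sum_(l < d) y ^+ l *: E l)); last first.
  rewrite -hE // -hE' // -!scalemxAl -!scalemxAr !scalerA cm //.
  by rewrite [z ^+ k' * _]mulrC subrr.
rewrite mulmx_suml mulmx_sumr -sumrB; apply: eq_bigr => i _; rewrite mulmx_sumr mulmx_suml -sumrB.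
by apply: eq_bigr => j _; rewrite scalerBr -!scalemxAl -!scalemxAr !scalerA [z ^+ j * _]mulrC.
Qed.

Lemma idem_diagonalizable (E : 'M[C]_n) : E *m E = E -> diagonalizable E.
Proof.
move=> EE; apply/diagonalizableP; exists [:: 0; 1]; first by rewrite /= inE eq_sym oner_eq0.
rewrite mxminpoly_min // big_cons big_seq1 subr0 rmorphM rmorphB /= horner_mx_X horner_mx_C.
by rewrite mulrBr mulr1 -mulmxE EE subrr.
Qed.

(** The coefficients of all the Laurent expansions are commuting idempotents, diagonal in a common
    basis. On a vector of this basis exactly one coefficient of each expansion is 1, and its degree is
    the weight. *)
Lemma torus_weights r (h : 'I_r -> C -> 'M[C]_n) :
  (forall a i j, exists (q : {poly C}) k, forall y, y != 0 -> h a y i j = q.[y] / y ^+ k) ->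
  (forall a y z, y != 0 -> z != 0 -> h a (y * z) = h a y *m h a z) ->
  (forall a, h a 1 = 1%:M) ->
  (forall a b y z, y != 0 -> z != 0 -> h a y *m h b z = h b z *m h a y) ->
  exists P (kap : 'M[int]_(r, n)), P \in unitmx /\
    forall a y, y != 0 -> h a y = dg P (\row_j y ^ (kap a j)).
Proof.
move=> hq hM h1 hC.
have /boolp.choice[k0 hk] : forall a, exists kdE : nat * nat * (nat -> 'M[C]_n),
    laurent (h a) kdE.1.1 kdE.1.2 kdE.2.
  by move=> a; have [k [d [E hE]]] := laurent_ex (hq a); exists (k, d, E).
pose k a := (k0 a).1.1; pose d a := (k0 a).1.2; pose E a := (k0 a).2.
have hE a : laurent (h a) (k a) (d a) (E a) by exact: hk.
have Eid a l m : (l < d a)%N -> (m < d a)%N -> E a l *m E a m = if l == m then E a l else 0.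
  exact: (laurent_idem (hE a) (hM a)).
pose Es := [seq E a l | a <- enum 'I_r, l <- iota 0 (d a)].
have inEs A : A \in Es -> exists a l, (l < d a)%N /\ A = E a l.
  move=> /allpairsPdep[a [l [_]]]; rewrite mem_iota => /andP[_ ld] ->.
  by exists a, l.
have [P0 P0u /allP hP] : exists2 P, P \in unitmx & all [pred A | similar_diag P A] Es.
  apply/codiagonalizableP; split.
    move=> A B /inEs[a [l [la ->]]] /inEs[b [m [mb ->]]].
    exact: (laurent_comm (hE a) (hE b) (hC a b)).
  move=> A /inEs[a [l [la ->]]]; apply: idem_diagonalizable.
  by rewrite Eid // eqxx.
have /boolp.choice[e0 he] : forall al : 'I_r * nat, exists x : 'rV[C]_n,
    (al.2 < d al.1)%N -> E al.1 al.2 = dg P0 x.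
  move=> [a l] /=; have [ld|ld] := boolP (l < d a)%N; last by exists 0.
  have /hP : E a l \in Es by apply/allpairsPdep; exists a, l; rewrite mem_enum mem_iota ld.
  move=> /= /(similar_diagLR P0u) [x ->]; exists x => _.
  by rewrite conjumx ?unitmx_inv // invmxK.
pose e a l := e0 (a, l).
have eE a l : (l < d a)%N -> E a l = dg P0 (e a l) by exact: (he (a, l)).
have e1 a j : \sum_(l < d a) e a l 0 j = 1.
  have := hE a 1 (oner_neq0 _); rewrite h1 expr1n scale1r.
  under eq_bigr do rewrite expr1n scale1r.
  under eq_bigr => l _ do rewrite eE //.
  rewrite -dg_sum => e1; have -> : 1 = (const_mx 1 : 'rV[C]_n) 0 j by rewrite mxE.
  rewrite -summxE; congr (fun_of_matrix _ 0 j); apply: (dg_inj P0u); rewrite -e1 /dg.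
  by rewrite diag_const_mx mulmx1 mulVmx.
have eM a l m j : (l < d a)%N -> (m < d a)%N ->
    e a l 0 j * e a m 0 j = if l == m then e a l 0 j else 0.
  move=> ld md; have := Eid a l m ld md; rewrite !eE // dgM //.
  move=> H; have : dg P0 (\row_j0 (e a l 0 j0 * e a m 0 j0)) = dg P0 (if l == m then e a l else 0).
    by rewrite H; case: (l == m); rewrite ?dg0.
  move=> /(dg_inj P0u)/rowP/(_ j); rewrite mxE => ->; by case: (l == m); rewrite ?mxE.
have /boolp.choice[lev hlev] : forall aj : 'I_r * 'I_n, exists l : nat,
    (l < d aj.1)%N /\ forall m, (m < d aj.1)%N -> e aj.1 m 0 aj.2 = (m == l)%:R.
  move=> [a j] /=; have [l el] : exists l : 'I_(d a), e a l 0 j != 0.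
    apply: contrapT => H; have := e1 a j; rewrite big1 => [/esym/eqP|l _]; first by rewrite oner_eq0.
    by apply/eqP; apply: contraT => h0; case: H; exists l.
  have el1 : e a l 0 j = 1.
    by apply: (mulfI el); rewrite mulr1 eM // eqxx.
  exists l; split=> // m md; have := eM a m l j md (ltn_ord l); rewrite el1 mulr1 => ->.
  by case: eqP => // ->; rewrite el1.
exists P0, (\matrix_(a, j) ((lev (a, j))%:Z - (k a)%:Z)); split=> // a y y0.
have yk : y ^+ k a != 0 by rewrite expf_neq0.
have -> : h a y = (y ^+ k a)^-1 *: \sum_(l < d a) y ^+ l *: E a l.
  by rewrite -hE // scalerA mulVf // scale1r.
under eq_bigr => l _ do rewrite eE // -dgZ.
rewrite -dg_sum -dgZ; congr dg; apply/rowP => j; rewrite !mxE summxE.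
have [/= ld hl] := hlev (a, j).
rewrite (bigD1 (Ordinal ld)) //= big1 ?addr0 => [|m ml].
  by rewrite mxE hl // eqxx mulr1 mulrC expfzDr // -exprnP -exprnN.
by rewrite mxE hl // -(inj_eq val_inj) /= in ml *; rewrite (negbTE ml) mulr0.
Qed.

(** The images of the coordinate subgroups act by integral weights in a common eigenbasis, and the
    weights span the rational subspace. *)
Theorem torus_toral (T : set 'M[C]_n) : algebraic_torus T ->
  exists P (K : 'M[rat]_n), P \in unitmx /\ T = (@expm _ n) @` (toral P K).
Proof.
move=> [[[Tu T1 TM _] _] [r [f [g [[fr _] [fT gD] [_ fg] fM]]]]].
pose D := @diagonal_torus C r.
pose del a (y : C) : 'M[C]_r := diag_mx (\row_b (if b == a then y else 1)).
have diagD (x : 'rV[C]_r) : (forall b, x 0 b != 0) -> D (diag_mx x).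
  move=> x0; split; last exact: diag_mx_is_diag.
  by rewrite unitmxE det_diag unitfE; apply/prodf_neq0 => b _; exact: x0.
have diagM (x y : 'rV[C]_r) : diag_mx x *m diag_mx y = diag_mx (\row_b (x 0 b * y 0 b)).
  apply/matrixP => i j; rewrite mul_mx_diag !mxE; have [->|_] := eqVneq i j; first by rewrite !mulr1n.
  by rewrite !mulr0n mul0r.
have delD a y : y != 0 -> D (del a y).
  by move=> y0; apply: diagD => b; rewrite mxE; case: ifP => // _; exact: oner_neq0.
have D1 : D 1%:M.
  rewrite (_ : 1%:M = diag_mx (const_mx 1)); last by rewrite diag_const_mx.
  by apply: diagD => b; rewrite mxE oner_neq0.
have f1 : f 1%:M = 1%:M.
  have u := Tu _ (fT _ D1); have := fM _ _ D1 D1; rewrite mulmx1 => e.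
  by move/(congr1 (mulmx (invmx (f 1%:M)))): e; rewrite mulmxA mulVmx // mul1mx => <-.
have delM a y z : del a (y * z) = del a y *m del a z.
  rewrite diagM; congr diag_mx; apply/rowP => b; rewrite !mxE; case: ifP => // _; by rewrite mulr1.
have diagC (x y : 'rV[C]_r) : diag_mx x *m diag_mx y = diag_mx y *m diag_mx x.
  by rewrite !diagM; congr diag_mx; apply/rowP => b; rewrite !mxE mulrC.
have [||||P [kap [Pu hkap]]] := @torus_weights r (fun a y => f (del a y)).
- move=> a i j; have [p [k hp]] := fr i j.
  pose Phi (phi : C -> C) := exists q : {poly C}, forall y, phi y = q.[y].
  have [q hq] : Phi (fun y => mx_eval p (del a y)).
    apply: (@closed_mx_eval _ _ Phi).
    - by move=> c; exists c%:P => y; rewrite hornerC.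
    - by move=> f1' f2 [q1 h1] [q2 h2]; exists (q1 + q2) => y; rewrite h1 h2 hornerD.
    - by move=> f1' f2 [q1 h1] [q2 h2]; exists (q1 * q2) => y; rewrite h1 h2 hornerM.
    move=> b c; exists ((if b == a then 'X else 1) *+ (b == c)) => y.
    by rewrite !mxE hornerMn; case: (b == a); rewrite ?hornerX ?hornerC.
  exists q, k => y y0; rewrite hp; last exact: delD.
  have -> : \det (del a y) = y.
    by rewrite det_diag (bigD1 a) //= mxE eqxx big1 ?mulr1 // => b ba; rewrite mxE (negbTE ba).
  by rewrite hq.
- by move=> a y z y0 z0; rewrite delM; apply: fM; exact: delD.
- move=> a; rewrite -[RHS]f1; congr f; rewrite -diag_const_mx; congr diag_mx.
  by apply/rowP => b; rewrite !mxE; case: ifP.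
- move=> a b y z y0 z0; rewrite -!fM; try exact: delD.
  by congr f; exact: diagC.
have fdiag (x : 'rV[C]_r) : (forall b, x 0 b != 0) ->
    f (diag_mx x) = dg P (\row_j \prod_a x 0 a ^ kap a j).
  move=> x0.
  have H s : uniq s -> f (diag_mx (\row_b (if b \in s then x 0 b else 1))) =
      dg P (\row_j \prod_(a <- s) x 0 a ^ kap a j).
    elim: s => [_|a s IH /andP[ns us]].
      rewrite (_ : (\row_b (if b \in [::] then x 0 b else 1)) = const_mx 1); last by apply/rowP => b; rewrite !mxE in_nil.
      rewrite (_ : (\row_j \prod_(a <- [::]) x 0 a ^ kap a j) = const_mx 1); last by apply/rowP => b; rewrite !mxE big_nil.
      by rewrite /dg !diag_const_mx f1 mulmx1 mulVmx.
    rewrite (_ : diag_mx _ = del a (x 0 a) *m diag_mx (\row_b (if b \in s then x 0 b else 1))).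
      rewrite fM; first last.
      - by apply: diagD => b; rewrite mxE; case: ifP => // _; exact: oner_neq0.
      - by apply: delD.
      rewrite (IH us) hkap; last exact: x0.
      rewrite (dgM _ _ Pu); congr dg; apply/rowP => j.
      by rewrite [RHS]mxE big_cons [LHS]mxE; congr (_ * _); rewrite mxE.
    rewrite diagM; congr diag_mx; apply/rowP => b; rewrite !mxE inE.
    have [->|ba] := eqVneq b a; first by rewrite (negbTE ns) mulr1.
    by rewrite mul1r.
  have := H _ (enum_uniq 'I_r); rewrite (_ : (\row_b (if b \in enum 'I_r then x 0 b else 1)) = x); last first.
    by apply/rowP => b; rewrite mxE mem_enum.
  move=> ->; congr dg; apply/rowP => j; rewrite !mxE; apply: big_enum.
pose KQ : 'M[rat]_(r, n) := map_mx intr kap.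
exists P, <<KQ>>%MS; split=> //.
have eK : map_mx (ratr : rat -> C) KQ = map_mx intr kap.
  by apply/matrixP => i j; rewrite !mxE ratr_int.
have inK (x : 'rV[C]_n) : (x <= <<KQ>>%MS ^F)%MS <-> exists t : 'rV[C]_r, x = t *m map_mx intr kap.
  rewrite map_genmx genmxE eK; split=> [/submxP[t ->]|[t ->]]; first by exists t.
  exact: submxMl.
have fE (t : 'rV[C]_r) : f (diag_mx (map_mx (@cexp R) t)) = expm (dg P (t *m map_mx intr kap)).
  rewrite expm_dg // fdiag => [|b]; last by rewrite mxE cexp_neq0.
  congr dg; apply/rowP => j; rewrite [RHS]mxE cexp_row_mul mxE.
  by apply: eq_bigr => a _; rewrite mxE.
apply/seteqP; split=> [B TB|_ [_ [x /inK [t ->] <-] <-]]; last first.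
  by rewrite -fE; apply: fT; exact: diag_cexp_torus.
have [t ht] := diag_torusP (gD _ TB).
exists (dg P (t *m map_mx intr kap)); first by exists (t *m map_mx intr kap) => //=; apply/inK; exists t.
by rewrite -fE -ht fg.
Qed.

End TorusToral.

(** * Independence of exponentials *)

Section ExpPoly.
Variables (R : realType).
Local Notation C := (R[i]).

Lemma small_scale (ds : seq C) : exists2 h : C, h != 0 & forall d, d \in ds -> normc (h * d) < 1.
Proof.
pose S := 1 + \sum_(d <- ds) normc d.
have S0 : 0 < S by rewrite ltr_pwDl // sumr_ge0 // => d _; exact: normc_ge0.
exists ((S^-1)%:C)%C.
  by apply/eqP => /(congr1 (@complex.Re R)) /= /eqP; rewrite invr_eq0 gt_eqF.
move=> d dds; rewrite normcM normcR ger0_norm ?invr_ge0 ?(ltW S0) // mulrC ltr_pdivrMr // mul1r.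
rewrite /S (big_rem d) //= ltr_pwDl // lerDl sumr_ge0 // => e _; exact: normc_ge0.
Qed.

(** A difference operator lowers the degree of a polynomial. *)
Lemma comp_shift_size (p : {poly C}) h d : (size p <= d.+1)%N ->
  (size (p \Po ('X + h%:P) - p)%R <= d)%N.
Proof.
move=> sp; have [->|p0] := eqVneq p 0; first by rewrite comp_poly0 subrr size_poly0.
have sh : size ('X + h%:P : {poly C}) = 2%N by rewrite size_XaddC.
have sc : size (p \Po ('X + h%:P)) = size p by rewrite size_comp_poly2.
have lc : lead_coef (p \Po ('X + h%:P)) = lead_coef p.
  by rewrite lead_coef_comp ?sh // lead_coefXaddC expr1n mulr1.
apply/leq_sizeP => j; rewrite leq_eqVlt => /predU1P[<-|dj]; last first.
  by rewrite coefB !nth_default ?subrr // ?sc (leq_trans sp).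
have [e|ne] := eqVneq (size p) d.+1; last first.
  have lt : (size p <= d)%N by rewrite -ltnS ltn_neqAle ne.
  by rewrite coefB !nth_default ?subrr // sc.
by move: lc; rewrite !lead_coefE sc e /= coefB => ->; rewrite subrr.
Qed.

(** The leading coefficient is invariant under translations. *)
Lemma comp_shift_eq (p : {poly C}) h w : w != 1 -> w *: (p \Po ('X + h%:P)) = p -> p = 0.
Proof.
move=> w1 e; have sh : size ('X + h%:P : {poly C}) = 2%N by rewrite size_XaddC.
have := congr1 lead_coef e; rewrite lead_coefZ lead_coef_comp ?sh // lead_coefXaddC expr1n mulr1.
move/eqP; rewrite -subr_eq0 -{2}[lead_coef p]mul1r -mulrBl mulf_eq0 subr_eq0 (negbTE w1) /=.
by rewrite lead_coef_eq0 => /eqP.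
Qed.

Lemma mul_swap (F : comNzRingType) (a b c d p : F) : a * b = c * d -> a * p * b = c * (p * d).
Proof. by move=> e; rewrite mulrAC e -mulrA [d * p]mulrC. Qed.

(** The difference operator twisted by one of the exponentials lowers the degree of its coefficient
    and, the step being small enough to separate the exponents, is injective on the other coefficients.
    Iterating it eliminates one exponential. *)
Lemma exp_indep (us : seq C) (Q : C -> {poly C}) : uniq us ->
  (forall z, \sum_(u <- us) (Q u).[z] * cexp (z * u) = 0) -> forall u, u \in us -> Q u = 0.
Proof.
elim: us Q => // u us IH Q /andP[nu uus] hQ.
have [h h0 hs] := small_scale [seq v - u | v <- us].
have rest d : forall Q : C -> {poly C}, (size (Q u) <= d)%N ->
    (forall z, \sum_(v <- u :: us) (Q v).[z] * cexp (z * v) = 0) -> forall v, v \in us -> Q v = 0.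
  elim: d => [|d IHd] {hQ}Q sQ hQ v vus.
    move: sQ; rewrite leqn0 size_poly_eq0 => /eqP Qu.
    by apply: IH vus => // z; have := hQ z; rewrite big_cons Qu horner0 mul0r add0r.
  pose Q' v := cexp (h * (v - u)) *: (Q v \Po ('X + h%:P)) - Q v.
  have /IHd H : (size (Q' u) <= d)%N.
    by rewrite /Q' subrr mulr0 cexp0 scale1r; exact: comp_shift_size.
  apply: (comp_shift_eq (h := h) (w := cexp (h * (v - u)))).
    apply/eqP => e1; have vu : v - u \in [seq v - u | v <- us] by exact: map_f.
    have /eqP := cexp_eq1_small (hs _ vu) e1; rewrite mulf_eq0 (negbTE h0) subr_eq0 /= => /eqP e.
    by move: nu; rewrite -e vus.
  apply/eqP; rewrite -subr_eq0; apply/eqP; apply: (H _ v vus) => z.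
  transitivity (cexp (- (h * u)) * (\sum_(v <- u :: us) (Q v).[z + h] * cexp ((z + h) * v))
    - \sum_(v <- u :: us) (Q v).[z] * cexp (z * v)); last first.
    have aux (a b c : C) : a = 0 -> b = 0 -> c * a - b = 0 by move=> -> ->; rewrite mulr0 subrr.
    exact: aux (hQ (z + h)) (hQ z).
  rewrite mulr_sumr -sumrB; apply: eq_bigr => w _.
  rewrite hornerD hornerN hornerZ horner_comp hornerD hornerX hornerC mulrBl; congr (_ - _).
  have e : cexp (h * (w - u)) * cexp (z * w) = cexp (- (h * u)) * cexp ((z + h) * w).
    transitivity (cexp (h * (w - u) + z * w)).
    exact: esym (cexpD _ _).
    rewrite mulrBr mulrDl [h * w - _]addrC -addrA [h * w + _]addrC.
    exact: (cexpD (- (h * u)) (z * w + h * w)).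
  exact: mul_swap e.
have Qus := rest _ Q (leqnn _) hQ; move=> v; rewrite inE => /predU1P[->|]; last exact: Qus.
apply: poly_vanish => y _; have := hQ y; rewrite big_cons big_seq big1 => [|w wus].
  by rewrite addr0 => /eqP; rewrite mulf_eq0 (negbTE (cexp_neq0 _)) orbF => /eqP.
by rewrite Qus // horner0 mul0r.
Qed.

(** Group the terms by exponents: by independence the coefficient of each exponential is 0, and the
    specialization does not separate terms of the same group. *)
Lemma exp_specialize (T : finType) (q : T -> {poly C}) (mu nu : T -> C) :
  (forall a b, mu a = mu b -> nu a = nu b) ->
  (forall z, \sum_a (q a).[z] * cexp (z * mu a) = 0) ->
  \sum_a (q a).[0] * nu a = 0.
Proof.
move=> hmu hz; pose us := undup [seq mu a | a <- enum T].
have inus a : mu a \in us by rewrite mem_undup map_f // mem_enum.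
pose Q u := \sum_(a | mu a == u) q a.
have part (f : T -> C) : \sum_a f a = \sum_(u <- us) \sum_(a | mu a == u) f a.
  rewrite (exchange_big_dep predT) //=; apply: eq_bigr => a _.
  rewrite big_mkcond (bigD1_seq (mu a)) ?undup_uniq //= eqxx big1 ?addr0 //= => u ua.
  by rewrite eq_sym (negbTE ua).
have Q0 u : u \in us -> Q u = 0.
  apply: exp_indep; first exact: undup_uniq.
  move=> z; rewrite -[RHS](hz z) [RHS]part; apply: eq_bigr => v _.
  by rewrite /Q horner_sum mulr_suml; apply: eq_bigr => a /eqP ->.
rewrite part big_seq big1 // => u uus.
have [a ma] : exists a, mu a == u.
  by move: uus; rewrite mem_undup => /mapP[a _ ->]; exists a.
transitivity ((Q u).[0] * nu a); last by rewrite Q0 // horner0 mul0r.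
rewrite /Q horner_sum mulr_suml; apply: eq_bigr => b /eqP mb.
by congr (_ * _); apply: hmu; rewrite mb (eqP ma).
Qed.

End ExpPoly.

(** * The rational toral algebra of an element *)

Section Replica.
Variables (R : realType) (n' : nat).
Local Notation n := n'.+1.
Local Notation C := (R[i]).
Local Notation "K ^F" := (map_mx (ratr : rat -> C) K) (at level 2).

Definition pairing (v : 'rV[C]_n) (m : 'cV[rat]_n) : C := (v *m m ^F) 0 0.

Lemma pairingD v m1 m2 : pairing v (m1 + m2) = pairing v m1 + pairing v m2.
Proof. by rewrite /pairing map_mxD mulmxDr mxE. Qed.

Lemma pairing0 v : pairing v 0 = 0.
Proof. by rewrite /pairing map_mx0 mulmx0 mxE. Qed.

Lemma pairing_delta v j : pairing v (delta_mx j 0) = v 0 j.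
Proof. by rewrite /pairing map_delta_mx -colE mxE. Qed.

Variables l x : 'rV[C]_n.

(** On [Some z], an exponential polynomial in z whose exponents are rational combinations of [l]; on
    [None], its value at 0 after the same combinations of [x] have replaced the exponents. The
    relation between the two is compatible with sums and products, as it has to be evaluated on
    polynomial equations. *)
Definition exppoly (f : option C -> C) : Prop :=
  exists (T : finType) (q : T -> {poly C}) (m : T -> 'cV[rat]_n),
    (forall z, f (Some z) = \sum_a (q a).[z] * cexp (z * pairing l (m a))) /\
    f None = \sum_a (q a).[0] * cexp (pairing x (m a)).

Lemma exppoly_poly (p : {poly C}) : exppoly (fun o => p.[odflt 0 o]).
Proof.
exists unit, (fun=> p), (fun=> 0); split=> [z|]; rewrite (bigD1 tt) //= big1 ?addr0.
- by rewrite pairing0 mulr0 cexp0 mulr1.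
- by case.
- by rewrite pairing0 cexp0 mulr1.
- by case.
Qed.

Lemma exppoly_cst c : exppoly (fun=> c).
Proof.
have [T [q [m [h1 h2]]]] := exppoly_poly c%:P.
by exists T, q, m; split=> [z|]; [move: (h1 z)|move: h2]; rewrite /= hornerC.
Qed.

Lemma exppoly_cexp j : exppoly (fun o => if o is Some z then cexp (z * l 0 j) else cexp (x 0 j)).
Proof.
exists unit, (fun=> 1), (fun=> delta_mx j 0); split=> [z|]; rewrite (bigD1 tt) //= big1 ?addr0.
- by rewrite pairing_delta hornerC mul1r.
- by case.
- by rewrite pairing_delta hornerC mul1r.
- by case.
Qed.

Lemma exppolyD f g : exppoly f -> exppoly g -> exppoly (fun o => f o + g o).
Proof.
move=> [T [q [m [h1 h2]]]] [T' [q' [m' [h1' h2']]]].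
exists (T + T')%type, (fun a => match a with inl a => q a | inr b => q' b end),
  (fun a => match a with inl a => m a | inr b => m' b end).
by split=> [z|]; rewrite big_sumType /=; [rewrite h1 h1'|rewrite h2 h2'].
Qed.

Lemma exppolyM f g : exppoly f -> exppoly g -> exppoly (fun o => f o * g o).
Proof.
move=> [T [q [m [h1 h2]]]] [T' [q' [m' [h1' h2']]]].
exists (T * T')%type, (fun a => q a.1 * q' a.2), (fun a => m a.1 + m' a.2).
split=> [z|].
  rewrite h1 h1' big_distrlr pair_big; apply: eq_bigr => -[a b] _ /=.
  by rewrite hornerM pairingD mulrDr cexpD mulrACA.
rewrite h2 h2' big_distrlr pair_big; apply: eq_bigr => -[a b] _ /=.
by rewrite hornerM pairingD cexpD mulrACA.
Qed.

Lemma exppoly_mulmx m1 m2 m3 (A : option C -> 'M[C]_(m1, m2)) (B : option C -> 'M[C]_(m2, m3)) :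
  (forall i j, exppoly (fun o => A o i j)) -> (forall i j, exppoly (fun o => B o i j)) ->
  forall i j, exppoly (fun o => (A o *m B o) i j).
Proof.
move=> hA hB i j; rewrite (_ : (fun _ => _) = fun o => \sum_k A o i k * B o k j).
  by apply: (closed_sum exppoly_cst exppolyD) => k; exact: exppolyM.
by apply/funext => o; rewrite mxE.
Qed.

(** A coincidence between exponents is a rational relation of [l], hence of [x], so that
    [exp_specialize] applies. *)
Lemma exppoly_zero K f : rat_hull l K -> (x <= K ^F)%MS -> exppoly f ->
  (forall z, f (Some z) = 0) -> f None = 0.
Proof.
move=> hK xK [T [q [m [h1 h2]]]] f0; rewrite h2.
apply: (exp_specialize (mu := fun a => pairing l (m a)) (nu := fun a => cexp (pairing x (m a)))).
  move=> a b /eqP; rewrite -subr_eq0 => /eqP e.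
  have rel (v : 'rV[C]_n) : v *m (m a - m b) ^F = (pairing v (m a) - pairing v (m b))%:M.
    rewrite map_mxB mulmxBr /pairing; move: (v *m _) (v *m _) => A B.
    by rewrite [LHS]mx11_scalar; congr _%:M; rewrite !mxE.
  have e1 : l *m (m a - m b) ^F = 0 by rewrite rel e raddf0.
  have := hull_relation hK e1 xK; rewrite rel => /matrixP /(_ 0 0); rewrite !mxE mulr1n => e2.
  by congr cexp; apply/eqP; rewrite -subr_eq0 e2.
by move=> z; rewrite -h1.
Qed.

End Replica.

Section ReplicaAlgebra.
Variables (R : realType) (n' : nat).
Local Notation n := n'.+1.
Local Notation C := (R[i]).
Local Notation "K ^F" := (map_mx (ratr : rat -> C) K) (at level 2).

(** The entries of exp(zX) are exponential polynomials with exponents in the span of the eigenvalues.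
    An equation of the group vanishes on them for all z, hence also after the exponents have been
    specialized to an element of the hull and the nilpotent part has been set to 0. *)
Theorem replica (h : set 'M[C]_n) X P (l : 'rV[C]_n) (s : {poly C}) K :
  Lie_subalgebra h -> algebraic_subgroup (integral_subgroup h) -> h X ->
  P \in unitmx -> horner_mx X s = dg P l -> (X - dg P l) ^+ n = 0 -> rat_hull l K ->
  toral P K `<=` h.
Proof.
move=> hh [_ [PP hPP]] hX Pu hs Nn hK _ [x xK <-].
set N := X - dg P l in Nn.
have SN : dg P l *m N = N *m dg P l.
  by rewrite /N mulmxBr mulmxBl -hs; congr (_ - _); exact: horner_mx_comm.
have main (y : 'rV[C]_n) : (y <= K ^F)%MS -> integral_subgroup h (expm (dg P y)).
  move=> yK.
  pose f j (o : option C) := if o is Some z then cexp (z * l 0 j) else cexp (y 0 j).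
  pose c (o : option C) : C := odflt 0 o.
  pose D o : 'M[C]_n := diag_mx (\row_j f j o).
  (* the unipotent part; on [None] only the term of degree 0 remains, since [c None = 0] *)
  pose U o : 'M[C]_n := \sum_(k < n) (c o ^+ k / k`!%:R) *: N ^+ k.
  pose M o := invmx P *m D o *m P *m U o.
  have MS z : M (Some z) = expm (z *: X).
    have eX : z *: X = dg P (z *: l) + z *: N by rewrite dgZ -scalerDr /N addrC subrK.
    have zc : dg P (z *: l) *m (z *: N) = (z *: N) *m dg P (z *: l).
      by rewrite dgZ -!scalemxAl -!scalemxAr SN.
    have eD : invmx P *m D (Some z) *m P = expm (dg P (z *: l)).
      have er : \row_j f j (Some z) = map_mx (@cexp R) (z *: l).
        apply/rowP => j; rewrite [LHS]mxE [RHS]mxE [(z *: l) 0 j]mxE; exact: erefl.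
      by rewrite /D er; exact: esym (expm_dg (z *: l) Pu).
    have eU : U (Some z) = expm (z *: N).
      rewrite (@expm_nilp _ _ _ n); last by rewrite exprZn Nn scaler0.
      rewrite big_mkord; apply: eq_bigr => k _.
      by rewrite /expt exprZn scalerA /c /= mulrC.
    by rewrite eX (expmD zc) -eD -eU.
  have MN : M None = expm (dg P y).
    rewrite /M (_ : U None = 1%:M) ?mulmx1; last first.
      rewrite /U big_ord_recl big1 ?addr0 => [|k _]; last by rewrite /c /= expr0n /= mul0r scale0r.
      by rewrite /c /= expr0 fact0 divr1 scale1r expr0.
    have er : \row_j f j None = map_mx (@cexp R) y.
      apply/rowP => j; rewrite [LHS]mxE [RHS]mxE; exact: erefl.
    by rewrite /D er; exact: esym (expm_dg y Pu).
  have Mexp i j : exppoly l y (fun o => M o i j).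
    have kst (A : 'M[C]_n) a b : exppoly l y (fun _ => A a b) by exact: exppoly_cst.
    apply: exppoly_mulmx => {i j}[i j|i j].
      apply: exppoly_mulmx => {i j}[|//]; apply: exppoly_mulmx => // i j.
      rewrite (_ : (fun _ => _) = fun o => (i == j)%:R * f i o).
        by apply: exppolyM; [exact: exppoly_cst|exact: exppoly_cexp].
      by apply/funext => o; rewrite !mxE mulr_natl.
    rewrite (_ : (fun _ => _) = fun o => \sum_(k < n) ((k`!%:R)^-1 *: 'X^k : {poly C}).[c o] * (N ^+ k) i j).
      apply: (closed_sum (exppoly_cst _ _) (@exppolyD _ _ _ _)) => k; apply: exppolyM => //.
      exact: exppoly_poly.
    apply/funext => o; rewrite /U summxE; apply: eq_bigr => k _.
    by rewrite mxE hornerZ hornerXn [_^-1 * _]mulrC.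
  rewrite hPP; split; first exact: expm_unit.
  move=> p Pp; rewrite -MN.
  apply: (exppoly_zero (f := fun o => mx_eval p (M o)) hK yK).
    exact: (closed_mx_eval (exppoly_cst _ _) (@exppolyD _ _ _ _) (@exppolyM _ _ _ _)).
  move=> z; rewrite MS.
  have : integral_subgroup h (expm (z *: X)).
    by apply: integral_exp; exact: lin_closedZ (Lie_lin hh) hX.
  by rewrite hPP => -[_]; apply.
apply: (integral_Lie hh) => t; rewrite -dgZ; apply: main; exact: scalemx_sub.
Qed.

Lemma horner_mx_comp (X : 'M[C]_n) (p s : {poly C}) :
  horner_mx X (p \Po s) = horner_mx (horner_mx X s) p.
Proof.
elim/poly_ind: p => [|p c IH]; first by rewrite comp_poly0 !rmorph0.
rewrite comp_polyD comp_polyM comp_polyX comp_polyC !rmorphD !rmorphM /= IH.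
by rewrite !horner_mx_C horner_mx_X.
Qed.

(** The eigenvalues are a function of those of [X], hence a polynomial one, and the semisimple part is
    itself a polynomial in [X]. *)
Lemma replica_horner X P (l : 'rV[C]_n) (s : {poly C}) K c :
  P \in unitmx -> horner_mx X s = dg P l -> rat_hull l K -> toral P K c ->
  exists q : {poly C}, c = horner_mx X q.
Proof.
move=> Pu hs hK [x xK <-].
have [p ->] := horner_dg_sub Pu (fun i j => hull_eq (i := i) (j := j) hK xK).
by exists (p \Po s); rewrite -hs horner_mx_comp.
Qed.

End ReplicaAlgebra.

(** * Continuity of the characteristic polynomial *)

Section CharPolyLimit.
Variables (R : realType) (n : nat).
Local Notation C := (R[i]).

Lemma mcvg_det (u : nat -> 'M[C]_n) (l : 'M[C]_n) : mcvg u l ->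
  mcvg (fun k => (\det (u k))%:M : 'M[C]_1) (\det l)%:M.
Proof.
move=> ul; pose Phi (f : option nat -> C) := mcvg (fun k => (f (Some k))%:M : 'M[C]_1) (f None)%:M.
pose M o := if o is Some k then u k else l.
have Pc c : Phi (fun=> c) by exact: mcvg_cst.
have PD f g : Phi f -> Phi g -> Phi (fun t => f t + g t).
  move=> hf hg; have := mcvgD hf hg; rewrite /Phi raddfD; congr (mcvg _ _).
  by apply/funext => k; rewrite raddfD.
have PM f g : Phi f -> Phi g -> Phi (fun t => f t * g t).
  move=> hf hg; have := mcvgM hf hg; rewrite /Phi scalar_mxM; congr (mcvg _ _).
  by apply/funext => k; rewrite scalar_mxM.
suff : Phi (fun o => \det (M o)) by [].
apply: (closed_sum Pc PD) => s; apply: (PM); first exact: Pc.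
by apply: (closed_prod Pc PM) => i; exact: mcvg_entry.
Qed.

Lemma char_poly_horner (A : 'M[C]_n) z : (char_poly A).[z] = \det (z%:M - A).
Proof.
rewrite /char_poly -horner_evalE -det_map_mx; congr (\det _).
apply/matrixP => i j; rewrite !mxE /horner_eval.
by rewrite /= /horner_eval hornerD hornerN hornerC hornerMn hornerX.
Qed.

Lemma char_poly_mcvg (u : nat -> 'M[C]_n) (l : 'M[C]_n) p : mcvg u l ->
  (forall k, char_poly (u k) = p) -> char_poly l = p.
Proof.
move=> ul hp; apply/eqP; rewrite -subr_eq0; apply/eqP; apply: poly_vanish => z _.
rewrite hornerD hornerN; apply/eqP; rewrite subr_eq0; apply/eqP; rewrite char_poly_horner.
apply: scalar1_inj; apply: (mcvg_uniq (u := fun k => (\det (z%:M - u k))%:M)).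
  apply: mcvg_det; apply: mcvgD (mcvg_cst _) _.
  by move: (mcvgZ (-1) ul); rewrite scaleN1r; congr (mcvg _ _); apply/funext => k; rewrite scaleN1r.
rewrite (_ : (fun k => _) = fun=> (p.[z])%:M); first exact: mcvg_cst.
by apply/funext => k; rewrite -char_poly_horner hp.
Qed.

End CharPolyLimit.

(** * Functions of the bracket with a diagonal matrix *)

Section Hadamard.
Variables (R : realType) (n : nat).
Local Notation C := (R[i]).
Variables (P : 'M[C]_n) (Pu : P \in unitmx) (w : 'rV[C]_n).
Implicit Types (A B : 'M[C]_n) (phi : C -> C).

(** The matrix of the operator in the basis [P]. *)
Definition coordmx A : 'M[C]_n := P *m A *m invmx P.

Lemma coordmxK A : invmx P *m coordmx A *m P = A.
Proof. by rewrite /coordmx !mulmxA mulVmx // mul1mx mulmxKV. Qed.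

Lemma coordmxKr B : coordmx (invmx P *m B *m P) = B.
Proof. by rewrite /coordmx !mulmxA mulmxV // mul1mx mulmxK. Qed.

Lemma coordmx_inj A B : (forall i j, coordmx A i j = coordmx B i j) -> A = B.
Proof. by move=> /matrixP e; rewrite -(coordmxK A) e coordmxK. Qed.

Lemma coordmx_lin a A B i j : coordmx (a *: A + B) i j = a * coordmx A i j + coordmx B i j.
Proof.
rewrite /coordmx mulmxDr mulmxDl -scalemxAr -scalemxAl.
by move: (P *m A *m _) (P *m B *m _) => A' B'; rewrite !mxE.
Qed.

Lemma coordmxB A B i j : coordmx (A - B) i j = coordmx A i j - coordmx B i j.
Proof.
have -> : coordmx (A - B) = coordmx A - coordmx B by rewrite /coordmx mulmxBr mulmxBl.
by move: (coordmx A) (coordmx B) => A' B'; rewrite !mxE.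
Qed.

Lemma coordmxM A B : coordmx (A *m B) = coordmx A *m coordmx B.
Proof.
by rewrite /coordmx -(mulmxA P B (invmx P)) (mulmxA (P *m A *m invmx P) P) (mulmxKV Pu) !mulmxA.
Qed.

(** The function [phi] of the operator of bracketing with [dg P w], which is diagonal with the
    differences of the [w 0 i] as eigenvalues. *)
Definition adfun phi A : 'M[C]_n :=
  invmx P *m (\matrix_(i, j) (phi (w 0 i - w 0 j) * coordmx A i j)) *m P.

Lemma coordmx_adfun phi A i j : coordmx (adfun phi A) i j = phi (w 0 i - w 0 j) * coordmx A i j.
Proof. by rewrite coordmxKr mxE. Qed.

Lemma adfun_lin phi a A B : adfun phi (a *: A + B) = a *: adfun phi A + adfun phi B.
Proof.
apply: coordmx_inj => i j.
have e1 := coordmx_adfun phi (a *: A + B) i j; have e2 := coordmx_lin a (adfun phi A) (adfun phi B) i j.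
apply: (etrans e1); apply: etrans (esym e2).
apply: etrans (congr2 (fun u v => a * u + v) (esym (coordmx_adfun phi A i j)) (esym (coordmx_adfun phi B i j))).
apply: (etrans (congr1 ( *%R _) (coordmx_lin a A B i j))).
by move: (phi _) (coordmx A i j) (coordmx B i j) => p u v; rewrite mulrDr mulrCA.
Qed.

Lemma coordmx_dg x : coordmx (dg P x) = diag_mx x.
Proof. by rewrite coordmxKr. Qed.

Lemma coordmx_bracket x A i j :
  coordmx (dg P x *m A - A *m dg P x) i j = (x 0 i - x 0 j) * coordmx A i j.
Proof.
rewrite coordmxB (coordmxM (dg P x) A) (coordmxM A (dg P x)) coordmx_dg; move: (coordmx A) => B.
rewrite mul_diag_mx mul_mx_diag !mxE mulrBl; congr (_ - _).
by rewrite mulrC.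
Qed.

(** On the finitely many eigenvalues [phi] agrees with a polynomial, and [g] is stable under the bracket. *)
Lemma adfun_g (g : set 'M[C]_n) phi A : Lie_subalgebra g -> g (dg P w) -> g A -> g (adfun phi A).
Proof.
move=> [g0 gl gb] gH gA.
have [p hp] := interpolate phi (undup_uniq [seq w 0 p.1 - w 0 p.2 | p <- enum {: 'I_n * 'I_n}]).
have -> : adfun phi A = adfun (horner p) A.
  apply: coordmx_inj => i j; apply: (etrans (coordmx_adfun phi A i j)).
  apply: etrans (esym (coordmx_adfun (horner p) A i j)); congr (_ * _).
  symmetry; apply: hp; rewrite mem_undup.
  by apply/mapP; exists (i, j); rewrite ?mem_enum.
elim/poly_ind: p {hp} A gA => [|p c IH] A gA.
  have -> : adfun (horner 0) A = 0; last exact: g0.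
  apply: coordmx_inj => i j; rewrite coordmx_adfun horner0 mul0r /coordmx mulmx0 mul0mx.
  by rewrite mxE.
have -> : adfun (horner (p * 'X + c%:P)) A =
    c *: A + adfun (horner p) (dg P w *m A - A *m dg P w).
  apply: coordmx_inj => i j; apply: (etrans (coordmx_adfun _ A i j)).
  set B := _ *m A - _; apply: (etrans _ (esym (coordmx_lin c A (adfun (horner p) B) i j))).
  apply: etrans (congr1 (fun u => _ + u) (esym (coordmx_adfun (horner p) B i j))).
  rewrite /B coordmx_bracket; move: (coordmx A i j) (w 0 i - w 0 j) => a d.
  by rewrite hornerD hornerM hornerX hornerC mulrDl addrC mulrA.
by apply: gl; [exact: gA|apply: IH; exact: gb].
Qed.

Lemma adfun_nm phi : exists2 k : R, 0 <= k & forall A, nm (adfun phi A) <= k * nm A.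
Proof.
pose S := \sum_i \sum_j normc (phi (w 0 i - w 0 j)).
have S0 : 0 <= S by apply: sumr_ge0 => i _; apply: sumr_ge0 => j _; exact: normc_ge0.
exists (nm (invmx P) * (S * (nm P * nm (invmx P))) * nm P).
  by rewrite !mulr_ge0 ?nm_ge0.
move=> A; rewrite /adfun mulrAC (le_trans (nmM _ _)) // ler_wpM2r ?nm_ge0 //.
rewrite (le_trans (nmM _ _)) // -mulrA ler_wpM2l ?nm_ge0 //.
apply: (@le_trans _ _ (S * nm (coordmx A))).
  rewrite /nm mulr_suml; apply: ler_sum => i _; rewrite mulr_suml; apply: ler_sum => j _.
  by rewrite mxE normcM ler_wpM2l ?normc_ge0 //; exact: nm_entry.
rewrite -mulrA ler_wpM2l // /coordmx (le_trans (nmM _ _)) // mulrAC ler_wpM2r ?nm_ge0 //.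
exact: nmM.
Qed.

(* 0^-1 = 0, hence [adinv] kills the centralizer *)
(** The projection onto the centralizer along the image of the bracket. *)
Definition adproj := adfun (fun z => (z == 0)%:R).
Definition adinv := adfun (fun z => z^-1).

Lemma adproj_split A : A - adproj A = dg P w *m adinv A - adinv A *m dg P w.
Proof.
apply: coordmx_inj => i j; rewrite coordmx_bracket; apply: (etrans (coordmxB _ _ i j)).
apply: (etrans (congr1 (fun u => coordmx A i j - u) (coordmx_adfun _ A i j))).
apply: etrans (congr1 ( *%R _) (esym (coordmx_adfun _ A i j))).
move: (w 0 i - w 0 j) (coordmx A i j) => d a.
have [->|d0] := eqVneq d 0; first by rewrite mul1r mul0r subrr.
by rewrite mul0r subr0 mulrA divff // mul1r.
Qed.

Lemma adproj_idem A : adproj (adproj A) = adproj A.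
Proof.
apply: coordmx_inj => i j; apply: (etrans (coordmx_adfun _ _ i j)).
apply: (etrans (congr1 ( *%R _) (coordmx_adfun _ A i j))).
apply: etrans (esym (coordmx_adfun _ A i j)).
move: (w 0 i - w 0 j) (coordmx A i j) => d a.
by rewrite mulrA -natrM mulnb andbb.
Qed.

(** For a general [w], the centralizer of [dg P w] is that of the whole toral algebra. *)
Lemma adproj_comm A (x : 'rV[C]_n) : (forall i j, w 0 i = w 0 j -> x 0 i = x 0 j) ->
  adproj A = A -> dg P x *m A = A *m dg P x.
Proof.
move=> h eA; apply/eqP; rewrite -subr_eq0; apply/eqP; rewrite -eA; apply: coordmx_inj => i j.
apply: (etrans (coordmx_bracket x (adproj A) i j)).
apply: (etrans (congr1 ( *%R _) (coordmx_adfun _ A i j))).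
have -> : coordmx 0 i j = 0 by rewrite /coordmx mulmx0 mul0mx mxE.
move: (coordmx A i j) => a.
have [/eqP|d0] := boolP (w 0 i - w 0 j == 0); last by rewrite mul0r mulr0.
by move/eqP; rewrite subr_eq0 => /eqP /h ->; rewrite subrr mul0r.
Qed.

End Hadamard.

(** * Conjugation into the centralizer of a torus *)

Section Newton.
Variables (R : realType) (n : nat).
Local Notation C := (R[i]).
Variables (g : set 'M[C]_n) (H : 'M[C]_n) (E J : 'M[C]_n -> 'M[C]_n) (k : R).
Hypotheses (hg : Lie_subalgebra g) (gH : g H)
  (Elin : forall a A B, E (a *: A + B) = a *: E A + E B) (Eid : forall A, E (E A) = E A)
  (Eg : forall A, g A -> g (E A)) (Jg : forall A, g A -> g (J A))
  (EJ : forall A, A - E A = H *m J A - J A *m H) (k1 : 1 <= k)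
  (kE : forall A, nm (E A) <= k * nm A) (kJ : forall A, nm (J A) <= k * nm A)
  (kF : forall A, nm (A - E A) <= k * nm A).

Let glin := Lie_lin hg.

(* [Z] commutes with the toral algebra, [m] is the error *)
Let small_pair (d : R) (Z m : 'M[C]_n) : Prop :=
  [/\ g Z, g m, E Z = Z, E m = 0 & nm Z + nm m <= d].

(** To first order, conjugation by exp(Y) is the bracket with [Y]. *)
Lemma Ad_expand (Y X : 'M[C]_n) : nm Y <= 1 ->
  nm (expm Y *m X *m expm (- Y) - X - (Y *m X - X *m Y)) <= 6%:R * nm Y ^+ 2 * nm X.
Proof.
move=> Y1; set a := expm Y - 1%:M; set b := expm (- Y) - 1%:M.
have eN : nm (- Y) = nm Y by rewrite nmN.
have ha : nm (a - Y) <= nm Y ^+ 2 by exact: expm_le.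
have hb : nm (b + Y) <= nm Y ^+ 2.
  by have := @expm_le _ _ (- Y); rewrite opprK eN; apply.
have ha1 : nm a <= 2 * nm Y by exact: expm1_le.
have hb1 : nm b <= 2 * nm Y by have := @expm1_le _ _ (- Y); rewrite eN; apply.
have -> : expm Y *m X *m expm (- Y) - X - (Y *m X - X *m Y) =
   (a - Y) *m X + X *m (b + Y) + a *m X *m b.
  have -> : expm Y = a + 1%:M by rewrite /a subrK.
  have -> : expm (- Y) = b + 1%:M by rewrite /b subrK.
  move: a b {ha hb ha1 hb1} => a b.
  rewrite !mulmxDl !mulmxDr !mul1mx !mulmx1 mulNmx.
  move: (a *m X *m b) (X *m b) (a *m X) (X *m Y) (Y *m X) => c1 c2 c3 c4 c5.
  by apply/matrixP => i j; rewrite !mxE; ring.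
have hX := nm_ge0 X; have hY := nm_ge0 Y.
rewrite (le_trans (nmD _ _)) // (_ : 6%:R * nm Y ^+ 2 * nm X =
   nm Y ^+ 2 * nm X + nm X * nm Y ^+ 2 + (2 * nm Y) * nm X * (2 * nm Y)); last by ring.
apply: lerD.
  apply: (le_trans (nmD _ _)); apply: lerD; apply: (le_trans (nmM _ _)).
    exact: ler_wpM2r hX _ _ ha.
  exact: ler_wpM2l hX _ _ hb.
apply: (le_trans (nmM _ _)); apply: ler_pM (nm_ge0 _) (nm_ge0 _) _ hb1.
apply: (le_trans (nmM _ _)); exact: ler_wpM2r hX _ _ ha1.
Qed.

(** Conjugation by exp(J m) cancels the error [m] to first order, as the bracket of [H] with [J m] is
    [m]. What remains is of order |m| (|Z| + |m|), less than |m|/2 when both terms are small. *)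
Lemma newton_step : exists2 d : R, 0 < d & forall Z m, small_pair d Z m ->
  exists Z' m', [/\ small_pair d Z' m', nm m' <= nm m / 2, nm (Z' - Z) <= nm m / 2 &
    char_poly (H + Z' + m') = char_poly (H + Z + m)].
Proof.
(* the new error is at most C1 |m| (|Z| + |m|), from the bracket of [J m] with [Z + m] and from [Ad_expand] *)
pose C1 := 2 * k + 6%:R * k ^+ 2 * (nm H + 1).
have hH := nm_ge0 H.
have k0 : 0 < k by exact: lt_le_trans k1.
have C1k : 2 <= C1.
  have h6 : 0 <= 6%:R * k ^+ 2 * (nm H + 1) by rewrite !mulr_ge0 ?exprn_ge0 ?addr_ge0 // ltW.
  by rewrite /C1; move: h6 k1; lra.
have C10 : 0 < C1 by exact: lt_le_trans C1k.
pose d := (2 * k * C1)^-1.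
have d0 : 0 < d by rewrite invr_gt0 !mulr_gt0.
have dE : k * (C1 * d) = 1 / 2.
  by rewrite /d; move: (lt0r_neq0 k0) (lt0r_neq0 C10); move=> ? ?; field; apply/andP.
have dk : k * d <= 1.
  have : 0 <= k * d by rewrite mulr_ge0 ?ltW.
  by move: dE C1k; nra.
have d1 : d <= 1 by rewrite (le_trans _ dk) // ler_peMl // ltW.
exists d => // Z m [gZ gm EZ Em hd].
have hZ := nm_ge0 Z; have hm := nm_ge0 m.
pose Y := J m; pose X := H + Z + m.
have hY0 := nm_ge0 Y; have hY : nm Y <= k * nm m by exact: kJ.
have Y1 : nm Y <= 1 by nra.
pose Rm := expm Y *m X *m expm (- Y) - H - Z.
have gX : g X by apply: (lin_closedD glin _ gm); exact: (lin_closedD glin).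
have gR : g Rm.
  apply: (lin_closedB glin _ gZ); apply: (lin_closedB glin _ gH).
  exact: Ad_Lie hg gX (Jg gm).
have eR : Rm = (Y *m (Z + m) - (Z + m) *m Y) +
    (expm Y *m X *m expm (- Y) - X - (Y *m X - X *m Y)).
  have eY : H *m Y - Y *m H = m by rewrite -EJ Em subr0.
  have -> : Y *m X - X *m Y = Y *m (Z + m) - (Z + m) *m Y - m.
    rewrite -{3}eY /X !(mulmxDl, mulmxDr).
    move: (Y *m H) (H *m Y) (Y *m Z) (Z *m Y) (Y *m m) (m *m Y) => c1 c2 c3 c4 c5 c6.
    by apply/matrixP => i j; rewrite !mxE; ring.
  rewrite /Rm /X; move: (Y *m (Z + m) - _) (expm Y *m _ *m _) => c1 c2.
  by apply/matrixP => i j; rewrite !mxE; ring.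
have nX : nm X <= nm H + 1.
  by rewrite (le_trans (nmD _ _)) // (le_trans (lerD (nmD _ _) (lexx _))) //; nra.
have nR : nm Rm <= C1 * d * nm m.
  rewrite eR (le_trans (nmD _ _)) //.
  have h1 : nm (Y *m (Z + m) - (Z + m) *m Y) <= 2 * nm Y * (nm Z + nm m).
    rewrite (le_trans (nmD _ _)) // nmN (_ : 2 * nm Y * _ = nm Y * (nm Z + nm m) + (nm Z + nm m) * nm Y); last by ring.
    by apply: lerD; rewrite (le_trans (nmM _ _)) // ?ler_wpM2l ?ler_wpM2r // nmD.
  have h2 := Ad_expand X Y1.
  have h3 : nm Y * (nm Z + nm m) <= k * nm m * d.
    by apply: ler_pM => //; rewrite addr_ge0.
  have h4 : nm Y ^+ 2 <= k ^+ 2 * (nm m * d).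
    rewrite (le_trans (ler_pM hY0 hY0 hY hY)) //.
    rewrite (_ : k * nm m * (k * nm m) = k ^+ 2 * (nm m * nm m)); last by ring.
    rewrite ler_wpM2l ?exprn_ge0 ?(le_trans ler01) // ler_wpM2l //; lra.
  have h5 : nm Y ^+ 2 * nm X <= k ^+ 2 * (nm m * d) * (nm H + 1).
    by apply: ler_pM => //; rewrite ?exprn_ge0 ?nm_ge0.
  have -> : C1 * d * nm m = 2 * (k * nm m * d) + 6%:R * (k ^+ 2 * (nm m * d) * (nm H + 1)).
    by rewrite /C1; ring.
  apply: lerD; first by apply: (le_trans h1); rewrite -mulrA ler_wpM2l.
  by apply: (le_trans h2); rewrite -mulrA ler_wpM2l.
have nR2 : k * nm Rm <= nm m / 2.
  apply: (le_trans (ler_wpM2l (ltW k0) nR)).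
  by rewrite mulrA dE mulrAC mul1r.
exists (Z + E Rm), (Rm - E Rm); split.
- split.
  + exact: (lin_closedD glin gZ (Eg gR)).
  + exact: (lin_closedB glin gR (Eg gR)).
  + by rewrite -[Z]scale1r Elin Eid !scale1r EZ.
  + by rewrite -[- E Rm]scaleN1r addrC Elin Eid scaleN1r addNr.
  + rewrite (le_trans (lerD (nmD _ _) (kF _))) // addrC.
    rewrite (le_trans (lerD (lexx _) (lerD (lexx _) (kE _)))) //; lra.
- by rewrite (le_trans (kF _)).
- by rewrite addrC addKr (le_trans (kE _)).
have -> : H + (Z + E Rm) + (Rm - E Rm) = expm Y *m X *m expm (- Y).
  rewrite /Rm; move: (expm Y *m _ *m _) (E _) => c1 c2.
  by apply/matrixP => i j; rewrite !mxE; ring.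
by rewrite -expm_inv -{1}[expm Y]invmxK char_poly_conj ?unitmx_inv ?expm_unit.
Qed.

(** Conjugating by exponentials halves the error at each step, so that the commuting parts converge;
    the characteristic polynomial is preserved by conjugation and passes to the limit. *)
Theorem newton_limit : exists2 e : R, 0 < e & forall M, g M -> nm M <= e ->
  exists Z, [/\ g Z, E Z = Z & char_poly (H + M) = char_poly (H + Z)].
Proof.
have [d d0 step] := newton_step.
have /boolp.choice[st hst] : forall p : 'M[C]_n * 'M[C]_n, exists q : 'M[C]_n * 'M[C]_n,
    small_pair d p.1 p.2 -> [/\ small_pair d q.1 q.2, nm q.2 <= nm p.2 / 2, nm (q.1 - p.1) <= nm p.2 / 2 &
    char_poly (H + q.1 + q.2) = char_poly (H + p.1 + p.2)].
  move=> p; case: (pselect (small_pair d p.1 p.2)) => [hp|np]; last by exists p.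
  by have [Z' [m' h]] := step _ _ hp; exists (Z', m').
have k0 : 0 < k by exact: lt_le_trans k1.
exists (d / (2 * k)); first by rewrite divr_gt0 // mulr_gt0.
move=> M gM nM.
have kM : 2 * (k * nm M) <= d.
  by move: nM; rewrite ler_pdivlMr ?mulr_gt0 // mulrC -mulrA.
pose p j := iter j st (E M, M - E M).
have pinv j : small_pair d (p j).1 (p j).2.
  elim: j => [|j IH]; last by have [] := hst _ IH.
  split; first exact: Eg.
  - exact: (lin_closedB glin gM (Eg gM)).
  - exact: Eid.
  - by rewrite /p /= -[- E M]scaleN1r addrC Elin Eid scaleN1r addNr.
  by rewrite /p /= (le_trans (lerD (kE _) (kF _))) // -mulr2n -mulr_natl.
have pm j : nm (p j).2 <= geometric d (1 / 2) j.
  elim: j => [|j IH].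
    rewrite /geometric /= expr0 mulr1 (le_trans (kF _)) //.
    by apply: le_trans kM; rewrite ler_peMl ?mulr_ge0 ?nm_ge0 ?ler1n // ltW.
  have [_ h _ _] := hst _ (pinv j); apply: (le_trans h).
  have -> : geometric d (1 / 2) j.+1 = geometric d (1 / 2) j / 2.
    by rewrite /geometric /= exprSr mulrA div1r.
  by rewrite ler_pM2r ?invr_gt0.
(* the increments of the commuting part are summable *)
pose a j := (p j.+1).1 - (p j).1.
have na j : nm (a j) <= geometric d (1 / 2) j.
  have [_ _ h _] := hst _ (pinv j); apply: (le_trans h); apply: le_trans (pm j).
  by rewrite ler_pdivrMr // ler_peMr ?nm_ge0 ?ler1n.
have half1 : `|1 / 2 : R| < 1 by rewrite ger0_norm; lra.
have [S hS] := mcvg_series na (is_cvg_geometric_series half1).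
pose Z := (p 0%N).1 + S.
have pZ : mcvg (fun j => (p j).1) Z.
  move: (mcvgD (mcvg_cst (p 0%N).1) hS); congr (mcvg _ _); apply/funext => j.
  by rewrite /series /= telescope_sumr // addrC subrK.
have pm0 : mcvg (fun j => (p j).2) 0.
  apply: mcvg_le (cvg_geometric d half1) => j; rewrite subr0; exact: pm.
have [gZ EZ] : g Z /\ E Z = Z.
  apply: (@lin_closed_mcvg _ _ [set Z | g Z /\ E Z = Z] _ _ _ pZ).
    split; first split; first by case: glin.
      by have := Elin (-1) 0 0; rewrite scaler0 addr0 scaleN1r addNr.
    move=> b X Y [gX eX] [gY eY]; split; first by case: glin => _; apply.
    by rewrite Elin eX eY.
  by move=> j; have [h1 _ h2 _ _] := pinv j.
exists Z; split; [exact: gZ|exact: EZ|apply/esym].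
apply: (@char_poly_mcvg _ _ (fun j => H + (p j).1 + (p j).2)).
  by rewrite -[H + Z]addr0; apply: mcvgD pm0; apply: mcvgD pZ; exact: mcvg_cst.
elim=> [|j IH]; first by rewrite /p /= -addrA [E M + _]addrC subrK.
by have [_ _ _ ->] := hst _ (pinv j).
Qed.

End Newton.

(** * Eigenvalues along a line of matrices *)

Section SymNorm.
Variables (F : fieldType) (n : nat).

(** The product is symmetric in the eigenvalues, hence a polynomial in their elementary symmetric
    functions. *)
Lemma sym_norm (c : 'cV[F]_n) : exists t : mpoly.mpoly n F,
  forall (A : 'M[F]_n) (l : 'rV[F]_n), eigvals A l ->
  mpoly.meval (fun i : 'I_n => (-1) ^+ i.+1 * (char_poly A)`_(n - i.+1)) t =
  \prod_(s : {perm 'I_n}) \sum_i c i 0 * l 0 (s i).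
Proof.
pose X (i : 'I_n) : mpoly.mpoly n F := mpoly.mpolyX F (mpoly.mnm1 i).
pose p : mpoly.mpoly n F := \prod_(s : {perm 'I_n}) \sum_i c i 0 *: X (s i).
have ps : p \is @mpoly.symmetric n F.
  apply/mpoly.issymP => u; rewrite /p rmorph_prod /=.
  rewrite [RHS](reindex_inj (mulIg u)) /=; apply: eq_bigr => s _.
  rewrite raddf_sum /=; apply: eq_bigr => i _; rewrite mpoly.msymZ; congr (_ *: _).
  by rewrite permM /X /mpoly.msym mpoly.mmapX mpoly.mmap1U.
have [t [tp _]] := mpoly.sym_fundamental ps.
exists t => A l hl.
transitivity (mpoly.meval (fun i => l 0 i) p); last first.
  rewrite /p rmorph_prod /=; apply: eq_bigr => s _; rewrite raddf_sum /=.
  by apply: eq_bigr => i _; rewrite mpoly.mevalZ mpoly.mevalXU.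
rewrite -tp mpoly.comp_mpoly_meval; apply: mpoly.meval_eq => i.
have hi : (i.+1 < n.+1)%N by rewrite ltnS.
have := mpoly.mroots_coeff [tuple l 0 i | i < n] (Ordinal hi).
rewrite big_tuple /= (eq_bigr (fun i => 'X - (l 0 i)%:P)) => [|j _]; last by rewrite tnth_mktuple.
rewrite -hl => ->; rewrite mulrA -exprD addnn -signr_odd odd_double mul1r tnth_mktuple.
by apply: mpoly.meval_eq => j; rewrite tnth_mktuple.
Qed.

End SymNorm.

Section LineNorm.
Variables (F : fieldType) (n : nat).

Lemma line_char_poly (A B : 'M[F]_n) j :
  exists q : {poly F}, forall z, (char_poly (A + z *: B))`_j = q.[z].
Proof.
pose M : 'M[{poly F}]_n := map_mx polyC A + 'X *: map_mx polyC B.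
exists (char_poly M)`_j => z.
have -> : A + z *: B = map_mx (horner_eval z) M.
  by apply/matrixP => a b; rewrite !mxE /= /horner_eval hornerD hornerM hornerX !hornerC.
by rewrite -map_char_poly coef_map.
Qed.

Lemma line_norm (A B : 'M[F]_n) (c : 'cV[F]_n) : exists q : {poly F},
  forall z l, eigvals (A + z *: B) l -> q.[z] = \prod_(s : {perm 'I_n}) \sum_i c i 0 * l 0 (s i).
Proof.
have [t ht] := sym_norm c.
pose Phi (f : F -> F) := exists q : {poly F}, forall z, f z = q.[z].
have Pc d : Phi (fun=> d) by exists d%:P => z; rewrite hornerC.
have PD f g : Phi f -> Phi g -> Phi (fun z => f z + g z).
  by move=> [p hp] [q hq]; exists (p + q) => z; rewrite hp hq hornerD.
have PM f g : Phi f -> Phi g -> Phi (fun z => f z * g z).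
  by move=> [p hp] [q hq]; exists (p * q) => z; rewrite hp hq hornerM.
have [q hq] : Phi (fun z => mpoly.meval (fun i : 'I_n =>
    (-1) ^+ i.+1 * (char_poly (A + z *: B))`_(n - i.+1)) t).
  apply: (closed_meval Pc PD PM) => i; apply: (PM); [exact: Pc|exact: line_char_poly].
by exists q => z l /ht <-; rewrite hq.
Qed.

End LineNorm.

Section LineAvoid.
Variables (R : realType) (n : nat).
Local Notation C := (R[i]).

(** The vector has no reordering in [W], so by [union_kernels] some linear form vanishing on [W] is
    nonzero on all its reorderings. The product of the values of this form on the reorderings is
    polynomial along the line. *)
Lemma line_avoid (W : 'M[C]_n) (A B : 'M[C]_n) z0 l0 : eigvals (A + z0 *: B) l0 ->
  (forall s : {perm 'I_n}, ~ (\row_j l0 0 (s j) <= W)%MS) ->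
  exists2 q : {poly C}, q != 0 & forall z l, (l <= W)%MS -> eigvals (A + z *: B) l -> root q z.
Proof.
move=> h0 hs.
pose d (s : {perm 'I_n}) : 'cV[C]_n := (\row_j l0 0 (s j) *m cokermx W)^T.
have [w hw] : exists w : 'rV[C]_n, forall s, w *m d s != 0.
  apply: contrapT => H.
  have [s ds0] : exists s, d s = 0.
    apply: union_kernels => w; apply: contrapT => nw; apply: H; exists w => s.
    by apply/eqP => ws; apply: nw; exists s.
  apply: (hs s); rewrite submxE; apply/eqP; apply: trmx_inj; rewrite trmx0; exact: ds0.
pose c : 'cV[C]_n := cokermx W *m w^T.
have cE (e : 'cV[C]_n) (l : 'rV[C]_n) (s : {perm 'I_n}) :
    \sum_i e i 0 * l 0 (s i) = (\row_j l 0 (s j) *m e) 0 0.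
  rewrite [RHS]mxE; apply: eq_bigr => i _; rewrite [in RHS]mxE; exact: mulrC.
have [q hq] := line_norm A B c; exists q.
  apply/eqP => q0; have := hq _ _ h0; rewrite q0 horner0 => /esym/eqP; apply/negP.
  apply/prodf_neq0 => s _; rewrite cE /c; apply: contraNneq (hw s) => e.
  apply/eqP; apply: trmx_inj; rewrite trmx0 /d trmx_mul trmxK -mulmxA.
  by apply/matrixP => i j; rewrite !ord1 e mxE.
move=> z l lW hl; rewrite rootE (hq _ _ hl) (bigD1 (1%g : {perm 'I_n})) //= mulf_eq0; apply/orP; left.
rewrite cE (_ : \row_j l 0 ((1%g : {perm 'I_n}) j) = l); last by apply/rowP => j; rewrite mxE perm1.
have -> : l *m c = 0; last by rewrite mxE.
move: lW; rewrite submxE => /eqP; rewrite /c; move: (cokermx W) => N e.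
by rewrite mulmxA e mul0mx.
Qed.

(** There are more roots than the degree allows. *)
Lemma poly_vanish_large (q : {poly C}) k0 : (forall k, (k0 <= k)%N -> q.[k%:R] = 0) -> q = 0.
Proof.
move=> h; apply/eqP; apply: contraT => q0.
pose rs : seq C := [seq (k%:R : C) | k <- iota k0 (size q)].
have urs : uniq rs by rewrite map_inj_uniq ?iota_uniq // => a b /eqP; rewrite eqr_nat => /eqP.
have ars : all (root q) rs.
  by apply/allP => _ /mapP[k + ->]; rewrite mem_iota => /andP[kk _]; rewrite rootE h.
by have := max_poly_roots q0 ars urs; rewrite size_map size_iota ltnn.
Qed.

(** The polynomial given by [line_avoid] would have infinitely many roots. *)
Lemma line_eigvals (W : 'M[C]_n) (A B : 'M[C]_n) k0 :
  (forall k, (k0 <= k)%N -> exists2 l, (l <= W)%MS & eigvals (A + (k%:R : C) *: B) l) ->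
  forall z l, eigvals (A + z *: B) l -> exists s : {perm 'I_n}, (\row_j l 0 (s j) <= W)%MS.
Proof.
move=> h z l hl; apply: contrapT => ns.
have [|q q0 hq] := line_avoid (W := W) hl; first by move=> s hs; apply: ns; exists s.
move/eqP: q0; apply; apply: (poly_vanish_large (k0 := k0)) => k /h[l' l'W hl'].
by apply/eqP; exact: hq l'W hl'.
Qed.

Local Notation "K ^F" := (map_mx (ratr : rat -> C) K) (at level 2).

(** A vector outside the countably many hyperplanes cut out by the rational linear forms that do not
    vanish on [K]. *)
Lemma hull_vector (K : 'M[rat]_n) : exists w, rat_hull (w : 'rV[C]_n) K.
Proof.
(* a dummy nonzero vector stands for the relations that hold on [K] *)
pose d (m : 'cV[rat]_n) : 'cV[C]_n := if K *m m == 0 then const_mx 1 else K ^F *m m ^F.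
have [n0|n0] := posnP n.
  exists 0; split=> [|K' _]; first exact: sub0mx.
  by rewrite submxE; apply/eqP/matrixP => i; have := ltn_ord i; rewrite {2}n0.
have d0 m : d m != 0.
  rewrite /d; case: ifP => [_|/negbT h].
    by apply/eqP => /matrixP /(_ (Ordinal n0) 0); rewrite !mxE => /eqP; rewrite oner_eq0.
  by rewrite -map_mxM map_mx_eq0.
have [v hv] := avoid_kernels d0.
have key (m : 'cV[rat]_n) : v *m K ^F *m m ^F = 0 -> K *m m = 0.
  by move=> e; apply/eqP; apply: contraNT (hv m) => nz; rewrite /d (negbTE nz) mulmxA e.
exists (v *m K ^F); split=> [|K' wK']; first exact: submxMl.
rewrite submxE; apply/eqP/matrixP => i j; rewrite [RHS]mxE.
have : K *m col j (cokermx K') = 0.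
  apply: key; move: wK'; rewrite submxE -map_cokermx => /eqP e.
  by rewrite colE map_mxM mulmxA e mul0mx.
by rewrite colE mulmxA -colE => /matrixP /(_ i 0); rewrite !mxE.
Qed.

End LineAvoid.

(** * Weights of a maximal torus *)

(** The Jordan decomposition scales. *)
Lemma eigvals_scale (F : numClosedFieldType) n' (A : 'M[F]_n'.+1) (x : 'rV[F]_n'.+1) c :
  eigvals A x -> eigvals (c *: A) (c *: x).
Proof.
move=> hx; have [P [l [s [Pu hs Nn hl]]]] := jordan_chevalley A.
set N := A - dg P l in Nn.
have SN : dg P l *m N = N *m dg P l.
  by rewrite /N mulmxBr mulmxBl -hs; congr (_ - _); exact: horner_mx_comm.
have hcl : eigvals (c *: A) (c *: l).
  have -> : c *: A = dg P (c *: l) + c *: N by rewrite dgZ -scalerDr /N addrC subrK.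
  rewrite /eigvals (@char_poly_nilp _ _ _ _ n'.+1); first exact: char_poly_dg.
    by rewrite dgZ -!scalemxAl -!scalemxAr SN.
  by rewrite exprZn Nn scaler0.
have [s' ->] := eigvals_perm hl hx.
have := eigvals_reindex s' hcl; congr (eigvals _ _).
by apply/rowP => j; rewrite !mxE.
Qed.

Section Core.
Variables (R : realType) (n' : nat).
Local Notation n := n'.+1.
Local Notation C := (R[i]).
Local Notation "K ^F" := (map_mx (ratr : rat -> C) K) (at level 2).
Variables (g : set 'M[C]_n) (hg : Lie_subalgebra g)
  (galg : algebraic_subgroup (integral_subgroup g)).
Variables (P : 'M[C]_n) (K : 'M[rat]_n) (Pu : P \in unitmx) (tg : toral P K `<=` g).
Hypothesis tmax : forall Q L, Q \in unitmx -> toral Q L `<=` g -> toral P K `<=` toral Q L ->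
  toral Q L `<=` toral P K.

Let glin := Lie_lin hg.

(** The toral algebra of the element commutes with the maximal one, being made of polynomials in the
    element. Their sum is toral and contained in [g], hence in the maximal one. *)
Lemma centralizer_eigvals X : g X -> (forall c, toral P K c -> c *m X = X *m c) ->
  exists2 x, (x <= K ^F)%MS & eigvals X x.
Proof.
move=> gX cX; have [Q [l [s [Qu hs Nn hl]]]] := jordan_chevalley X.
have [L hL] := rat_hull_ex l.
have ag := replica hg galg gX Qu hs Nn hL.
have cm a b : toral P K a -> toral Q L b -> a *m b = b *m a.
  move=> ta /(replica_horner Qu hs hL) [q ->]; apply/esym; apply: horner_mx_comm.
  by apply/esym; exact: cX.
have [U [M [Uu PU QU UM]]] := toral_sum Pu Qu cm.
have Ug : toral U M `<=` g.
  by move=> c /UM [a [b [ta tb ->]]]; apply: (lin_closedD glin); [exact: tg|exact: ag].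
have [x xK ex] : toral P K (dg Q l).
  by apply: (tmax Uu Ug PU); apply: QU; exists l => //=; case: hL.
exists x; first exact: xK.
by rewrite /eigvals hl -(char_poly_dg l Qu) -ex; exact: char_poly_dg.
Qed.

(** For large z the element X + zH is a multiple of a small perturbation of a general element H of the
    torus. Such a perturbation has the eigenvalues of an element of the centralizer, and
    [line_eigvals] extends this to z = 0. *)
Theorem eigvals_weight X l : g X -> eigvals X l ->
  exists s : {perm 'I_n}, (\row_j l 0 (s j) <= K ^F)%MS.
Proof.
move=> gX hl; have [w hw] := hull_vector R K.
pose H := dg P w; have gH : g H by apply: tg; exists w => //=; case: hw.
have [kE kE0 hkE] := adfun_nm P w (fun z => (z == 0)%:R).
have [kJ kJ0 hkJ] := adfun_nm P w (fun z => z^-1).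
pose k := 1 + kE + kJ.
have [e e0 he] : exists2 e : R, 0 < e & forall M, g M -> nm M <= e ->
    exists Z, [/\ g Z, adproj P w Z = Z & char_poly (H + M) = char_poly (H + Z)].
  apply: (@newton_limit R n g H (adproj P w) (adinv P w) k hg gH).
  - by move=> a A B; exact: adfun_lin.
  - by move=> A; exact: adproj_idem.
  - by move=> A gA; exact: adfun_g.
  - by move=> A gA; exact: adfun_g.
  - by move=> A; exact: adproj_split.
  - by rewrite /k -addrA lerDl addr_ge0.
  - by move=> A; apply: (le_trans (hkE A)); apply: ler_wpM2r (nm_ge0 _) _ _ _; rewrite /k; lra.
  - by move=> A; apply: (le_trans (hkJ A)); apply: ler_wpM2r (nm_ge0 _) _ _ _; rewrite /k; lra.
  move=> A; apply: (le_trans (nmD _ _)); rewrite nmN; apply: (le_trans (lerD (lexx _) (hkE A))).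
  by have := mulr_ge0 kJ0 (nm_ge0 A); rewrite /k; lra.
pose k0 := (Num.truncn (nm X / e)).+1.
apply: (@line_eigvals _ _ _ X H k0 _ 0 l); last by rewrite scale0r addr0.
move=> m m0.
have mp : 0 < (m%:R : R) by rewrite ltr0n (leq_trans _ m0).
have mC : (m%:R : C) != 0 by rewrite pnatr_eq0 -lt0n (leq_trans _ m0).
pose M := (m%:R : C)^-1 *: X.
have gM : g M by exact: lin_closedZ glin gX.
have nM : nm M <= e.
  rewrite /M nmZ normcV normc_nat mulrC ler_pdivrMr // mulrC -ler_pdivrMr //.
  apply: le_trans (_ : k0%:R <= _); last by rewrite ler_nat.
  by apply: ltW; exact: truncnS_gt.
have [Z [gZ EZ eZ]] := he M gM nM.
have gHZ : g (H + Z) by exact: lin_closedD glin gH gZ.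
have [x xK hx] : exists2 x, (x <= K ^F)%MS & eigvals (H + Z) x.
  apply: (centralizer_eigvals gHZ) => _ [y yK <-].
  have h1 : dg P y *m H = H *m dg P y by exact: dg_comm.
  have h2 : dg P y *m Z = Z *m dg P y.
    by apply: (adproj_comm Pu _ EZ) => i j; exact: hull_eq hw yK.
  by move: (dg P y) h1 h2 => D h1 h2; rewrite mulmxDr mulmxDl h1 h2.
exists ((m%:R : C) *: x); first exact: scalemx_sub.
have -> : X + m%:R *: H = m%:R *: (H + M).
  by rewrite scalerDr /M scalerA (mulfV mC) scale1r addrC.
have hM : eigvals (H + M) x by rewrite /eigvals eZ; exact: hx.
exact: (eigvals_scale (m%:R : C) hM).
Qed.

(** A single permutation has to send all the eigenvalue vectors of the algebra into the weight space, as
    finitely many proper subspaces do not cover. *)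
Theorem toral_rank Q L : Q \in unitmx -> toral Q L `<=` g -> (\rank L <= \rank K)%N.
Proof.
move=> Qu Lg.
have [s hs] : exists s : {perm 'I_n}, (col_perm s L ^F <= K ^F)%MS.
  apply: contrapT => ns.
  have hex (s : {perm 'I_n}) : exists j, col j (col_perm s L ^F *m cokermx K ^F) != 0.
    apply: contrapT => nj; apply: ns; exists s; rewrite submxE; apply/eqP/matrixP => i j.
    have : col j (col_perm s L ^F *m cokermx K ^F) == 0.
      by apply: contraT => h; case: nj; exists j.
    by move/eqP/matrixP/(_ i 0); rewrite [LHS]mxE [RHS]mxE => ->; rewrite mxE.
  have [f hf] := fin_all_exists hex.
  have [w hw] := avoid_kernels hf.
  pose y := w *m L ^F.
  have gy : g (dg Q y) by apply: Lg; exists y => //=; exact: submxMl.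
  have [s] := eigvals_weight gy (char_poly_dg y Qu).
  have -> : \row_j y 0 (s j) = w *m col_perm s L ^F.
    by rewrite col_permE mulmxA -/y -col_permE; apply/rowP => j; rewrite !mxE.
  rewrite submxE => /eqP e; have := hw s.
  by rewrite colE mulmxA mulmxA e mul0mx eqxx.
have := mxrankS hs; rewrite !mxrank_map col_permE mxrankMfree ?row_free_unit ?unitmx_perm //.
by rewrite mxrank_map.
Qed.

End Core.

(** * Complexification and conjugation *)

Section RealForm.
Variables (R : realType) (n : nat).
Local Notation C := (R[i]).
Local Notation "K ^F" := (map_mx (ratr : rat -> C) K) (at level 2).
Local Notation toC := (map_mx (real_complex R)).
Local Notation cjg := (map_mx (@conjc R)).
Implicit Types (X Y : 'M[R]_n) (Z : 'M[C]_n).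

Lemma complexE X Y : \matrix_(i, j) (X i j +i* Y i j)%C = toC X + ('i%C : C) *: toC Y.
Proof.
apply/matrixP => i j; rewrite !mxE; move: (X i j) (Y i j) => x y.
by simpc.
Qed.

Lemma LieCP (h : set 'M[R]_n) Z : Lie_complexification h Z <->
  exists X Y, [/\ h X, h Y & Z = toC X + ('i%C : C) *: toC Y].
Proof.
split; first by move=> [X hX [Y hY <-]]; exists X, Y; rewrite complexE.
by move=> [X [Y [hX hY ->]]]; exists X => //; exists Y => //; exact: complexE.
Qed.

Lemma complex_inj X Y X' Y' : toC X + ('i%C : C) *: toC Y = toC X' + ('i%C : C) *: toC Y' ->
  X = X' /\ Y = Y'.
Proof.
rewrite -!complexE => /matrixP e.
by split; apply/matrixP => i j; have := e i j; rewrite !mxE => -[].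
Qed.

Lemma LieC_mono (h h' : set 'M[R]_n) : h `<=` h' ->
  Lie_complexification h `<=` Lie_complexification h'.
Proof. by move=> s Z [X hX [Y hY <-]]; exists X; [exact: s|exists Y => //; exact: s]. Qed.

(** Bilinearity of the bracket. *)
Lemma LieC_Lie (h : set 'M[R]_n) : Lie_subalgebra h -> Lie_subalgebra (Lie_complexification h).
Proof.
move=> [h0 hl hb].
have hD X Y : h X -> h Y -> h (X + Y) by move=> hX hY; rewrite -[X]scale1r; exact: hl.
have hZ a X : h X -> h (a *: X) by move=> hX; rewrite -[a *: X]addr0; exact: hl.
have hB X Y : h X -> h Y -> h (X - Y) by move=> hX hY; rewrite addrC -scaleN1r; exact: hl.
split.
- by apply/LieCP; exists 0, 0; split=> //; rewrite map_mx0 scaler0 addr0.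
- move=> [u v] _ _ /LieCP[X [Y [hX hY ->]]] /LieCP[X' [Y' [hX' hY' ->]]]; apply/LieCP.
  exists (u *: X - v *: Y + X'), (v *: X + u *: Y + Y'); split.
  + by apply: (hD _ _ _ hX'); apply: (hB); exact: hZ.
  + by apply: (hD _ _ _ hY'); apply: (hD); exact: hZ.
  apply/matrixP => i j; rewrite !mxE; move: (X i j) (Y i j) (X' i j) (Y' i j) => x y x' y'.
  by simpc; congr (_ +i* _)%C; ring.
move=> _ _ /LieCP[X [Y [hX hY ->]]] /LieCP[X' [Y' [hX' hY' ->]]]; apply/LieCP.
have ii : ('i%C : C) * 'i%C = -1 by rewrite -expr2 sqr_i.
have cM (A B A' B' : 'M[C]_n) : (A + ('i%C : C) *: B) *m (A' + ('i%C : C) *: B') =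
    (A *m A' - B *m B') + ('i%C : C) *: (A *m B' + B *m A').
  rewrite mulmxDl !mulmxDr -!scalemxAl -!scalemxAr scalerA ii scaleN1r scalerDr.
  move: (A *m A') (B *m B') (_ *: (A *m B')) (_ *: (B *m A')) => a b c d.
  by apply/matrixP => i j; rewrite !mxE; ring.
exists ((X *m X' - X' *m X) - (Y *m Y' - Y' *m Y)), ((X *m Y' - Y' *m X) + (Y *m X' - X' *m Y)).
split; [by apply: (hB); exact: hb|by apply: (hD); exact: hb|].
rewrite !cM -!map_mxM -!map_mxB -!map_mxD.
move: (X *m X') (X' *m X) (Y *m Y') (Y' *m Y) (X *m Y') (Y' *m X) (Y *m X') (X' *m Y) => a b c d e f a' b'.
apply/matrixP => i j; rewrite !mxE; simpc.
by congr (_ +i* _)%C; ring.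
Qed.

Lemma cjg_toC X Y : cjg (toC X + ('i%C : C) *: toC Y) = toC X + ('i%C : C) *: toC (- Y).
Proof.
by apply/matrixP => i j; rewrite !mxE; move: (X i j) (Y i j) => x y; simpc.
Qed.

Lemma LieC_cjg (h : set 'M[R]_n) Z : Lie_subalgebra h ->
  Lie_complexification h Z -> Lie_complexification h (cjg Z).
Proof.
move=> [h0 hl _] /LieCP[X [Y [hX hY ->]]]; apply/LieCP; exists X, (- Y); split=> //.
  by rewrite -scaleN1r -[_ *: _]addr0; exact: hl.
exact: cjg_toC.
Qed.

Lemma cjg_ratr (K : 'M[rat]_n) : cjg (K ^F) = K ^F.
Proof.
apply/matrixP => i j; rewrite !mxE; exact: (fmorph_eq_rat (@conjc R \o (ratr : rat -> C))).
Qed.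

Lemma cjg_dg (Q : 'M[C]_n) (x : 'rV[C]_n) : cjg (dg Q x) = dg (cjg Q) (map_mx (@conjc R) x).
Proof. by rewrite /dg !map_mxM map_invmx map_diag_mx. Qed.

Lemma cjg_toral (Q : 'M[C]_n) (K : 'M[rat]_n) Z : toral Q K Z -> toral (cjg Q) K (cjg Z).
Proof.
move=> [x /= xK <-]; exists (map_mx (@conjc R) x); last by rewrite cjg_dg.
by rewrite /= -cjg_ratr map_submx.
Qed.

Lemma complex_parts Z : exists X Y, [/\ Z = toC X + ('i%C : C) *: toC Y,
  toC X = (2^-1 : C) *: (Z + cjg Z) & toC Y = (- 'i%C / 2 : C) *: (Z - cjg Z)].
Proof.
exists (map_mx (@complex.Re R) Z), (map_mx (@complex.Im R) Z).
have e : Z = toC (map_mx (@complex.Re R) Z) + ('i%C : C) *: toC (map_mx (@complex.Im R) Z).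
  by rewrite -complexE; apply/matrixP => i j; rewrite !mxE; case: (Z i j).
have two (W : 'M[C]_n) : W + W = (2 : C) *: W by rewrite scaler_nat mulr2n.
have n2 : (2 : C) != 0 by rewrite pnatr_eq0.
split; first exact: e.
  move: e; move: (map_mx (@complex.Re R) Z) (map_mx (@complex.Im R) Z) => X Y ->; rewrite cjg_toC.
  by rewrite map_mxN scalerN addrACA subrr addr0 two scalerA (mulVf n2) scale1r.
move: e; move: (map_mx (@complex.Re R) Z) (map_mx (@complex.Im R) Z) => X Y ->; rewrite cjg_toC.
rewrite map_mxN scalerN opprD opprK addrACA subrr add0r two !scalerA (divfK n2).
by rewrite mulNr -expr2 sqr_i opprK scale1r.
Qed.

End RealForm.

(** * A toral algebra invariant under conjugation *)

Section RealToral.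
Variables (R : realType) (n' : nat).
Local Notation n := n'.+1.
Local Notation C := (R[i]).
Local Notation "K ^F" := (map_mx (ratr : rat -> C) K) (at level 2).
Local Notation toC := (map_mx (real_complex R)).
Local Notation cjg := (map_mx (@conjc R)).

(** At u = i the vector of eigenvalues has hull [K], so that it is in no rational subspace of smaller
    rank, whatever the order of the eigenvalues. Each of these countably many subspaces excludes the
    roots of one polynomial in u. *)
Lemma avoid_small_hulls (K : 'M[rat]_n) (w : 'rV[C]_n) (A B : 'M[R]_n) : rat_hull w K ->
  eigvals (toC A + ('i%C : C) *: toC B) w -> exists u : R, forall (l : 'rV[C]_n) (M : 'M[rat]_n),
    eigvals (toC (u *: B + A)) l -> (l <= M ^F)%MS -> (\rank K <= \rank M)%N.
Proof.
move=> hw ew.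
have hex (M : 'M[rat]_n) : exists q : {poly C}, q != 0 /\ ((\rank M < \rank K)%N ->
    forall z l, (l <= M ^F)%MS -> eigvals (toC A + z *: toC B) l -> root q z).
  have [rk|rk] := ltnP (\rank M) (\rank K); last by exists 1; rewrite oner_neq0.
  have [|q q0 hq] := line_avoid (W := M ^F) ew; last by exists q.
  move=> s hs.
  have : (w <= (col_perm s^-1 M) ^F)%MS.
    have e : w = col_perm s^-1 (\row_j w 0 (s j)) by apply/rowP => j; rewrite !mxE permKV.
    by rewrite e map_col_perm !col_permE; exact: submxMr.
  move/(proj2 hw) => /mxrankS; rewrite col_permE mxrankMfree ?row_free_unit ?unitmx_perm //.
  by rewrite leqNgt rk.
have [q hq] := boolp.choice hex.
have [u hu] := avoid_roots (fun M => proj1 (hq M)).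
exists u => l M hl lM; rewrite leqNgt; apply/negP => rk.
have := hu M; apply/negP; rewrite negbK; apply: (proj2 (hq M) rk _ l lM).
have -> : toC A + (u%:C)%C *: toC B = toC (u *: B + A); last exact: hl.
apply/matrixP => i j; rewrite !mxE.
by rewrite rmorphD rmorphM addrC.
Qed.

Variables (g : set 'M[C]_n) (hg : Lie_subalgebra g)
  (galg : algebraic_subgroup (integral_subgroup g)).
Variables (l0 : set 'M[R]_n) (hl0 : Lie_subalgebra l0).
Let l := Lie_complexification l0.
Hypotheses (lalg : algebraic_subgroup (integral_subgroup l)) (lg : l `<=` g).
Variables (P : 'M[C]_n) (K : 'M[rat]_n) (Pu : P \in unitmx) (tl : toral P K `<=` l).
Hypothesis tmax : forall Q L, Q \in unitmx -> toral Q L `<=` g -> toral P K `<=` toral Q L ->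
  toral Q L `<=` toral P K.

(** The toral algebra of a general real element X of the pencil. It commutes with its conjugate because
    both are made of polynomials in the real matrix X; by maximality of the rank it contains the sum. *)
Theorem real_toral : exists Q L, [/\ Q \in unitmx, toral Q L `<=` l, \rank L = \rank K &
  forall Z, toral Q L Z -> toral Q L (cjg Z)].
Proof.
have hl := LieC_Lie hl0; have llin := Lie_lin hl.
have tg : toral P K `<=` g by move=> Z /tl /lg.
have rk := toral_rank hg galg Pu tg tmax.
have [w hw] := hull_vector R K.
have lH : l (dg P w) by apply: tl; exists w => //=; case: hw.
have [A [B [hA hB eH]]] := (LieCP l0 (dg P w)).1 lH.
have ew : eigvals (toC A + ('i%C : C) *: toC B) w by rewrite -eH; exact: char_poly_dg.
have [u hu] := avoid_small_hulls hw ew.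
pose X := u *: B + A.
have l0X : l0 X by case: hl0 => _ h _; exact: h.
have lX : l (toC X).
  apply/LieCP; exists X, 0; split; [exact: l0X|by case: hl0|].
  by rewrite map_mx0 scaler0 addr0.
have [Q [x [s [Qu hs Nn hx]]]] := jordan_chevalley (toC X).
have [L hL] := rat_hull_ex x.
have al := replica hl lalg lX Qu hs Nn hL.
have rL : \rank L = \rank K.
  apply/eqP; rewrite eqn_leq (rk Q L Qu) /=; last by move=> Z /al /lg.
  by apply: (hu x L hx); case: hL.
exists Q, L; split=> //.
have Qcu : cjg Q \in unitmx by rewrite map_unitmx.
have cX : cjg (toC X) = toC X.
  by apply/matrixP => i j; rewrite !mxE; exact: conjc_real.
have cjgH (q : {poly C}) : cjg (horner_mx (toC X) q) = horner_mx (toC X) (map_poly (@conjc R) q).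
  by rewrite map_horner_mx cX.
have cK (Z : 'M[C]_n) : cjg (cjg Z) = Z by apply/matrixP => i j; rewrite !mxE conjcK.
have ccK (Z : 'M[C]_n) : toral (cjg Q) L Z -> toral Q L (cjg Z).
  by move/cjg_toral; rewrite cK.
have cm a b : toral Q L a -> toral (cjg Q) L b -> a *m b = b *m a.
  move=> /(replica_horner Qu hs hL) [q ->] /ccK /(replica_horner Qu hs hL) [p ep].
  by rewrite -[b]cK ep cjgH; exact: comm_horner_mx2.
have [U [M [Uu QU QcU UM]]] := toral_sum Qu Qcu cm.
have Ul : toral U M `<=` l.
  move=> c /UM [a [b [ta tb ->]]]; apply: (lin_closedD llin); first exact: al.
  by rewrite -[b]cK; apply: (LieC_cjg hl0); apply: al; exact: ccK.
have UQ : toral U M `<=` toral Q L.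
  by apply: (toral_rank_le Qu Uu QU); rewrite rL; apply: (rk U M Uu) => Z /Ul /lg.
by move=> Z tZ; apply/UQ/QcU; exact: cjg_toral.
Qed.

End RealToral.

(** * Real points of a complex group *)

Section RealGroup.
Variables (R : realType) (n : nat).
Local Notation C := (R[i]).
Local Notation toC := (map_mx (real_complex R)).
Implicit Types (h : set 'M[R]_n) (X Y : 'M[R]_n).

Lemma expm_unitR X : expm X \in unitmx.
Proof. by rewrite -(map_unitmx (real_complex R)) expm_toC expm_unit. Qed.

Lemma integral_expR h X : h X -> integral_subgroup h (expm X).
Proof. by move=> hX; apply: sub_gen_smallest; exists X. Qed.

Lemma integral_minR h (A : set 'M[R]_n) : GL_subgroup A ->
  (forall X, h X -> A (expm X)) -> integral_subgroup h `<=` A.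
Proof. by move=> Agl hA; apply: smallest_sub => // _ [X hX <-]; exact: hA. Qed.

Lemma integral_GLR h : GL_subgroup (integral_subgroup h).
Proof. by apply: GL_subgroup_capP => _ [X _ <-]; exact: expm_unitR. Qed.

Lemma integral_toC (a : set 'M[C]_n) X :
  integral_subgroup [set Z | a (toC Z)] X -> integral_subgroup a (toC X).
Proof.
have [au a1 aM aV] := integral_GL a.
move: X; apply: (@integral_minR _ [set X | integral_subgroup a (toC X)]).
  split=> /=.
  - by move=> A /au; rewrite map_unitmx.
  - by rewrite map_mx1.
  - by move=> A B hA hB; rewrite map_mxM; exact: aM.
  - by move=> A hA; rewrite map_invmx; exact: aV.
by move=> X aX /=; rewrite expm_toC; exact: integral_exp.
Qed.

(** After extension of scalars, this is [integral_Lie]. *)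
Lemma Lie_real_points (a : set 'M[C]_n) : Lie_subalgebra a ->
  Lie (integral_subgroup [set Z | a (toC Z)]) = [set Z | a (toC Z)].
Proof.
move=> ha; apply/seteqP; split=> X /=.
  move=> hX; apply: (integral_Lie ha) => t.
  have := integral_toC (hX t); rewrite expm_toC; congr (integral_subgroup _ (expm _)).
  by apply/matrixP => i j; rewrite !mxE rmorphM.
move=> aX t; apply: integral_expR => /=.
have -> : toC (t *: X) = (t%:C)%C *: toC X by apply/matrixP => i j; rewrite !mxE rmorphM.
exact: lin_closedZ (Lie_lin ha) aX.
Qed.

Lemma real_points_Lie (a : set 'M[C]_n) : Lie_subalgebra a ->
  Lie_subalgebra [set Z : 'M[R]_n | a (toC Z)].
Proof.
move=> [a0 al ab]; split=> /=.
- by rewrite map_mx0.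
- move=> t X Y aX aY; have -> : toC (t *: X + Y) = (t%:C)%C *: toC X + toC Y.
    by apply/matrixP => i j; rewrite !mxE rmorphD rmorphM.
  exact: al.
- by move=> X Y aX aY; rewrite map_mxB !map_mxM; exact: ab.
Qed.

(** The real and imaginary parts of an element are combinations of it and its conjugate. *)
Lemma LieC_real_points (a : set 'M[C]_n) : Lie_subalgebra a ->
  (forall Z, a Z -> a (map_mx (@conjc R) Z)) ->
  Lie_complexification [set Z | a (toC Z)] = a.
Proof.
move=> ha hc; have alin := Lie_lin ha; apply/seteqP; split=> Z.
  move=> /LieCP[X [Y [aX aY ->]]]; apply: (lin_closedD alin); first exact: aX.
  exact: lin_closedZ alin aY.
move=> aZ; have [X [Y [eZ eX eY]]] := complex_parts Z; have aZ' := hc Z aZ.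
apply/LieCP; exists X, Y; split=> //=.
- by rewrite eX; apply: (lin_closedZ _ alin); exact: lin_closedD alin aZ aZ'.
- by rewrite eY; apply: (lin_closedZ _ alin); exact: lin_closedB alin aZ aZ'.
Qed.

End RealGroup.

Lemma Cartan_subgroup_ex (R : realType) (n' : nat) (G L : set 'M[R]_n'.+1)
    (hG : real_algebraic_group G) (hL : real_algebraic_group L) (hLG : L `<=` G)
    (hT : exists T : set 'M[R[i]]_n'.+1,
        maximal_torus (complexification G) T /\ T `<=` complexification L) :
  exists C : set 'M[R]_n'.+1, Cartan_subgroup G C /\ C `<=` L.
Proof.
have [[hg0 eG] galg] := hG; have [[hl0 eL] lalg] := hL.
have [T [[Ttor TG Tmax] TL]] := hT.
set g := Lie_complexification (Lie G); set l := Lie_complexification (Lie L).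
have hg : Lie_subalgebra g by exact: LieC_Lie.
have hl : Lie_subalgebra l by exact: LieC_Lie.
have lg : l `<=` g by apply: LieC_mono => X hX t; exact: hLG (hX t).
have inLie (h a : set 'M[R[i]]_n'.+1) : Lie_subalgebra h -> lin_closed a ->
    (@expm _ _ @` a) `<=` integral_subgroup h -> a `<=` h.
  move=> hh ha sub Z aZ; apply: (integral_Lie hh) => t; apply: sub.
  by exists ((t%:C)%C *: Z) => //; exact: lin_closedZ ha aZ.
have tlin (P : 'M[R[i]]_n'.+1) (K : 'M[rat]_n'.+1) : lin_closed (toral P K) by exact: toral_lin.
have [P [K [Pu eT]]] := torus_toral Ttor.
have tl : toral P K `<=` l by apply: (inLie _ _ hl (tlin P K)); rewrite -eT.
have tmax Q M : Q \in unitmx -> toral Q M `<=` g -> toral P K `<=` toral Q M -> toral Q M `<=` toral P K.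
  move=> Qu Qg PQ; apply: (inLie _ _ (toral_Lie K Pu) (tlin Q M)); rewrite integral_toral // -eT.
  rewrite -(Tmax _ (toral_torus M Qu)) //.
  - by move=> _ [Z QZ <-]; apply: integral_exp; exact: Qg.
  - by rewrite eT => _ [Z PZ <-]; exists Z => //; exact: PQ.
have [Q [M [Qu al rM acj]]] := real_toral hg galg hl0 lalg lg Pu tl tmax.
have tg : toral P K `<=` g by move=> Z /tl /lg.
set a := toral Q M in al acj.
have ha : Lie_subalgebra a by exact: toral_Lie.
set c := [set Z : 'M[R]_n'.+1 | a (map_mx (real_complex R) Z)].
have eLie : Lie (integral_subgroup c) = c by exact: Lie_real_points.
have eC : complexification (integral_subgroup c) = (@expm _ _ @` a).
  by rewrite /complexification eLie LieC_real_points // integral_toral.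
have CL : integral_subgroup c `<=` L.
  rewrite eL; apply: (integral_minR (integral_GLR _)) => X aX; apply: integral_expR.
  have /LieCP[Y [Z [lY lZ e]]] := al _ aX.
  have [-> _] : X = Y /\ 0 = Z; last exact: lY.
  by apply: complex_inj; rewrite -e map_mx0 scaler0 addr0.
exists (integral_subgroup c); split; last exact: CL.
split.
- by split; rewrite eLie //; exact: real_points_Lie.
- by move=> X /CL /hLG.
rewrite eC; split.
- exact: toral_torus.
- by move=> _ [Z aZ <-]; apply: integral_exp; apply: lg; exact: al.
move=> T' T'tor T'G aT'; have [P' [K' [P'u eT']]] := torus_toral T'tor.
have t'g : toral P' K' `<=` g by apply: (inLie _ _ hg (tlin P' K')); rewrite -eT'.
have at' : a `<=` toral P' K'.
  by apply: (inLie _ _ (toral_Lie K' P'u) (tlin Q M)); rewrite integral_toral // -eT'.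
have t'a : toral P' K' `<=` a.
  by apply: (toral_rank_le Qu P'u at'); rewrite rM; exact: (toral_rank hg galg Pu tg tmax P'u t'g).
rewrite eT'; apply/seteqP; split=> _ [Z hZ <-]; exists Z => //; [exact: t'a|exact: at'].
Qed.

Theorem proposition8 (R : realType) (n : nat) (G L : set 'M[R]_n)
    (hG : real_algebraic_group G)
    (hL : real_algebraic_group L)
    (hLG : L `<=` G)
    (hT : exists T : set 'M[R[i]]_n,
        maximal_torus (complexification G) T /\ T `<=` complexification L) :
  exists C : set 'M[R]_n, Cartan_subgroup G C /\ C `<=` L.
Proof.
(* in size 0 all the groups are trivial and [L] itself is a Cartan subgroup *)
case: n G L hG hL hLG hT => [|n'] G L hG hL hLG hT; last exact: Cartan_subgroup_ex.
have [T [Tmax TL]] := hT; exists L; split; last exact: subset_refl.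
split; [by case: hL|exact: hLG|].
have -> : complexification L = T; last exact: Tmax.
have T1 : T 1%:M by case: Tmax => [[[[_ h _ _] _] _] _ _].
apply/seteqP; split=> // A _.
by rewrite (_ : A = 1%:M) //; apply/matrixP => -[].
Qed.
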